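(* Let $K,K'\in\mathbb{R}$, let $(X,d)$ be a geodesic length space with curvature bounded below (respectively above) by $K$, let $I\subseteq\mathbb{R}$ be an open interval and $f:I\to(0,\infty)$ continuous. If the generalized cone $I\times_f\mathbb{M}^2(K)$ has timelike curvature bounded below (respectively above) by $K'$, then $Y=I\times_f X$ has timelike curvature bounded below (respectively above) by $K'$.
   Context: $\mathbb{M}^2(K)$ is the two-dimensional Riemannian model space of constant curvature $K$ (round sphere of radius $1/\sqrt K$ for $K>0$, Euclidean plane for $K=0$, hyperbolic plane of curvature $K$ for $K<0$), viewed as a metric space. Curvature bounded below/above by $K$ for a geodesic length space is meant in the usual Alexandrov (triangle comparison with $\mathbb{M}^2(K)$) sense. Generalized cone $I\times_f Z$ over a metric space $(Z,d)$: the set $I\times Z$ with metric $D((t,x),(t',x'))=|t-t'|+d(x,x')$; a curve $\gamma=(\alpha,\beta)$ is causal if $D$-absolutely continuous, $\alpha$ strictly monotone and $-\dot\alpha^2+(f\circ\alpha)^2v_\beta^2\le0$ a.e. ($v_\beta$ the metric derivative; timelike if $<0$ a.e.), future directed if $\dot\alpha>0$ a.e.; $L(\gamma)=\int\sqrt{\dot\alpha^2-(f\circ\alpha)^2v_\beta^2}$; $\tau(y,y')$ is the supremum of $L$ over future directed causal curves from $y$ to $y'$ ($0$ if none); $y\ll y'$ (resp. $y\le y'$) iff there is a future directed timelike (resp. causal) curve from $y$ to $y'$ (or $y=y'$ for $\le$). Timelike curvature bounds: let $\mathbb{L}^2(K')$ be the two-dimensional simply connected Lorentzian model space of constant curvature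 $K'$. A timelike geodesic triangle is $(x,y,z)$ with $x\ll y\ll z$, $\tau(x,z)<\infty$, sides realized by maximal future directed causal curves. The space has timelike curvature bounded below (above) by $K'$ if each point has a neighborhood $U$ with: $\tau|_{U\times U}$ finite and continuous; any $x\ll y$ in $U$ joined by a causal curve in $U$ of $\tau$-length $\tau(x,y)$; and for every timelike geodesic triangle in $U$ with side lengths $a=\tau(x,y)$, $b=\tau(y,z)$, $c=\tau(x,z)$ satisfying the size bounds for $K'$ ($c\ge a+b$, and if $c=a+b$ and $K'>0$ or $c>a+b$ and $K'<0$ then $c<\pi/\sqrt{|K'|}$), and any points $p,q$ on its sides with corresponding points $p',q'$ on a comparison triangle in $\mathbb{L}^2(K')$, one has $\tau(p,q)\le\tau'(p',q')$ (resp. $\ge$). *)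

(* Defs.v *)
From HB Require Import structures.
From mathcomp Require Import all_boot all_order all_algebra.
From mathcomp Require Import all_classical all_reals all_analysis.
Set Implicit Arguments. Unset Strict Implicit. Unset Printing Implicit Defensive.
Import Order.TTheory GRing.Theory Num.Theory.
Import numFieldNormedType.Exports.
Local Open Scope classical_set_scope.
Local Open Scope ring_scope.

Section Defs.
Variable R : realType.

Definition is_metric (X : Type) (d : X -> X -> R) : Prop :=
  (forall x y, 0 <= d x y) /\ (forall x y, d x y = 0 <-> x = y) /\
  (forall x y, d x y = d y x) /\ (forall x y z, d x z <= d x y + d y z).

Definition geod_seg (X : Type) (d : X -> X -> R) (g : R -> X) (x y : X) : Prop :=
  g 0 = x /\ g 1 = y /\
  forall s t, 0 <= s <= 1 -> 0 <= t <= 1 -> d (g s) (g t) = `|s - t| * d x y.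

Definition geodesic_space (X : Type) (d : X -> X -> R) : Prop :=
  forall x y, exists g, geod_seg d g x y.

Definition nbhd_in (X : Type) (D : X -> X -> R) (C : set X) (x : X) (U : set X) : Prop :=
  U `<=` C /\ exists r, 0 < r /\ forall y, C y -> D x y < r -> U y.

Definition edot (p q : R * R * R) : R := p.1.1 * q.1.1 + p.1.2 * q.1.2 + p.2 * q.2.
Definition ldot (p q : R * R * R) : R := - (p.1.1 * q.1.1) + p.1.2 * q.1.2 + p.2 * q.2.
Definition acosh (x : R) : R := ln (x + Num.sqrt (x ^+ 2 - 1)).

(* K > 0 : sphere of radius 1/sqrt K in R^3;  K = 0 : the plane {z = 0};
   K < 0 : upper sheet of the hyperboloid <p,p>_{1,2} = 1/K (hyperboloid model) *)
Definition M2_carrier (K : R) (p : R * R * R) : Prop :=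
  if 0 < K then edot p p = K^-1
  else if K == 0 then p.2 = 0
  else ldot p p = K^-1 /\ 0 < p.1.1.

Definition M2_dist (K : R) (p q : R * R * R) : R :=
  if 0 < K then acos (K * edot p q) / Num.sqrt K
  else if K == 0 then Num.sqrt ((p.1.1 - q.1.1) ^+ 2 + (p.1.2 - q.1.2) ^+ 2)
  else acosh (K * ldot p q) / Num.sqrt (- K).

Definition M2pt (K : R) := {p : R * R * R | M2_carrier K p}.
Definition M2d (K : R) (p q : M2pt K) : R := M2_dist K (sval p) (sval q).

Definition alex_cmp (lower : bool) (X : Type) (d : X -> X -> R) (K : R) (U : set X) : Prop :=
  forall (x y z : X) (gxy gyz gxz : R -> X),
    U x -> U y -> U z ->
    geod_seg d gxy x y -> geod_seg d gyz y z -> geod_seg d gxz x z ->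
    (0 < K -> d x y + d y z + d x z < 2 * pi / Num.sqrt K) ->
    forall (x' y' z' : M2pt K) (sxy syz sxz : R -> M2pt K),
      M2d x' y' = d x y -> M2d y' z' = d y z -> M2d x' z' = d x z ->
      geod_seg (@M2d K) sxy x' y' -> geod_seg (@M2d K) syz y' z' ->
      geod_seg (@M2d K) sxz x' z' ->
      forall (g h : R -> X) (g' h' : R -> M2pt K),
        (g = gxy /\ g' = sxy \/ g = gyz /\ g' = syz \/ g = gxz /\ g' = sxz) ->
        (h = gxy /\ h' = sxy \/ h = gyz /\ h' = syz \/ h = gxz /\ h' = sxz) ->
        forall s t, 0 <= s <= 1 -> 0 <= t <= 1 ->
          if lower then M2d (g' s) (h' t) <= d (g s) (h t)
          else d (g s) (h t) <= M2d (g' s) (h' t).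

Definition alex_curv_bound (lower : bool) (X : Type) (d : X -> X -> R) (K : R) : Prop :=
  forall x : X, exists U : set X, nbhd_in d setT x U /\ alex_cmp lower d K U.

Definition abs_cont (P : Type) (D : P -> P -> R) (g : R -> P) (a b : R) : Prop :=
  forall e, 0 < e -> exists del, 0 < del /\
    forall (n : nat) (s t : nat -> R),
      (forall i, (i < n)%N -> a <= s i /\ s i <= t i /\ t i <= b) ->
      (forall i j, (i < n)%N -> (j < n)%N -> i <> j -> t i <= s j \/ t j <= s i) ->
      \sum_(i < n) (t i - s i) < del ->
      \sum_(i < n) D (g (s i)) (g (t i)) < e.

Definition ae_on (a b : R) (P : R -> Prop) : Prop :=
  {ae (@lebesgue_measure R), forall t, `[a, b]%classic t -> P t}.

Definition has_mderiv (Z : Type) (d : Z -> Z -> R) (be : R -> Z) (t v : R) : Prop :=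
  (fun h : R => d (be (t + h)) (be t) / `|h|) @ (0 : R)^' --> v.
Definition mderiv (Z : Type) (d : Z -> Z -> R) (be : R -> Z) (t : R) : R :=
  lim ((fun h : R => d (be (t + h)) (be t) / `|h|) @ (0 : R)^').

(* Abstract Lorentzian pre-length data: a carrier, future directed       *)
(* causal / timelike curves (a curve is g : R -> pt on [a,b]) and their   *)
(* length.                                                              *)

Record lstr := LStr {
  lpt : Type;
  lcar : set lpt;
  lcausal : (R -> lpt) -> R -> R -> Prop;
  ltimelike : (R -> lpt) -> R -> R -> Prop;
  llen : (R -> lpt) -> R -> R -> \bar R
}.
Arguments lcar : clear implicits.
Arguments lcausal : clear implicits.
Arguments ltimelike : clear implicits.
Arguments llen : clear implicits.

Definition ltau (S : lstr) (x y : lpt S) : \bar R :=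
  if `[< exists g a b, lcausal S g a b /\ g a = x /\ g b = y >]
  then ereal_sup [set l | exists g a b, lcausal S g a b /\ g a = x /\ g b = y /\
                                          l = llen S g a b]
  else 0%E.

Definition lll (S : lstr) (x y : lpt S) : Prop :=
  exists g a b, ltimelike S g a b /\ g a = x /\ g b = y.

Definition ltau_len (S : lstr) (g : R -> lpt S) (a b : R) : \bar R :=
  ereal_inf [set l | exists (n : nat) (t : nat -> R),
     t 0%N = a /\ t n = b /\ (forall i, (i < n)%N -> t i < t i.+1) /\
     l = (\sum_(i < n) ltau (g (t i)) (g (t i.+1)))%E].

Definition maximal_curve (S : lstr) (g : R -> lpt S) (a b : R) (x y : lpt S) : Prop :=
  lcausal S g a b /\ g a = x /\ g b = y /\ ltau_len g a b = ltau x y.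

Definition curve_in (P : Type) (U : set P) (g : R -> P) (a b : R) : Prop :=
  forall t, a <= t <= b -> U (g t).

Definition size_ok (K' a b c : R) : Prop :=
  a + b <= c /\
  ((c = a + b /\ 0 < K') \/ (a + b < c /\ K' < 0) -> c < pi / Num.sqrt `|K'|).

(* p lies on the side g ([a,b]) of a triangle, p' lies on the corresponding
   side g' ([a',b']) of the comparison triangle, at the same tau-distance from
   the initial vertex (v resp. v') of that side *)
Definition corr (S M : lstr) (v : lpt S) (g : R -> lpt S) (a b : R)
  (v' : lpt M) (g' : R -> lpt M) (a' b' : R) (p : lpt S) (p' : lpt M) : Prop :=
  (exists s, a <= s <= b /\ p = g s) /\ (exists s', a' <= s' <= b' /\ p' = g' s') /\
  ltau v' p' = ltau v p.

Definition tl_cmp (lower : bool) (S M : lstr) (K' : R) (U : set (lpt S)) : Prop :=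
  forall (x y z : lpt S) (g1 g2 g3 : R -> lpt S) (a1 b1 a2 b2 a3 b3 : R),
    U x -> U y -> U z ->
    lll x y -> lll y z -> (ltau x z < +oo)%E ->
    maximal_curve g1 a1 b1 x y -> maximal_curve g2 a2 b2 y z -> maximal_curve g3 a3 b3 x z ->
    curve_in U g1 a1 b1 -> curve_in U g2 a2 b2 -> curve_in U g3 a3 b3 ->
    size_ok K' (fine (ltau x y)) (fine (ltau y z)) (fine (ltau x z)) ->
    forall (x' y' z' : lpt M) (h1 h2 h3 : R -> lpt M) (c1 d1 c2 d2 c3 d3 : R),
      lcar M x' -> lcar M y' -> lcar M z' ->
      ltau x' y' = ltau x y -> ltau y' z' = ltau y z ->
      ltau x' z' = ltau x z ->
      maximal_curve h1 c1 d1 x' y' -> maximal_curve h2 c2 d2 y' z' ->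
      maximal_curve h3 c3 d3 x' z' ->
      let C p p' := corr x g1 a1 b1 x' h1 c1 d1 p p' \/
                    corr y g2 a2 b2 y' h2 c2 d2 p p' \/
                    corr x g3 a3 b3 x' h3 c3 d3 p p' in
      forall p q p' q', C p p' -> C q q' ->
        if lower then (ltau p q <= ltau p' q')%E
        else (ltau p' q' <= ltau p q)%E.

(* timelike curvature bounded below (lower = true) / above (lower = false)
   by K', with comparison space M = L^2(K'); D is the metric defining the
   topology of S *)
Definition tl_curv_bound (lower : bool) (S : lstr) (D : lpt S -> lpt S -> R)
    (M : lstr) (K' : R) : Prop :=
  forall x, lcar S x -> exists U : set (lpt S),
    nbhd_in D (lcar S) x U /\
    (forall u v, U u -> U v -> (ltau u v < +oo)%E) /\
    (forall u v, U u -> U v -> forall e, 0 < e -> exists del, 0 < del /\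
       forall u' v', U u' -> U v' -> D u u' < del -> D v v' < del ->
         `|fine (ltau u' v') - fine (ltau u v)| < e) /\
    (forall u v, U u -> U v -> lll u v ->
       exists g a b, lcausal S g a b /\ g a = u /\ g b = v /\ curve_in U g a b /\
                     ltau_len g a b = ltau u v) /\
    tl_cmp lower M K' U.

Definition coneD (Z : Type) (d : Z -> Z -> R) (y y' : R * Z) : R :=
  `|y.1 - y'.1| + d y.2 y'.2.

Definition cone_curve (strict : bool) (I : set R) (f : R -> R) (Z : Type)
    (d : Z -> Z -> R) (gm : R -> R * Z) (a b : R) : Prop :=
  let al := fun t => (gm t).1 in
  let be := fun t => (gm t).2 in
  a < b /\ (forall t, a <= t <= b -> I (al t)) /\
  abs_cont (coneD d) gm a b /\
  ((forall s t, a <= s -> s < t -> t <= b -> al s < al t) \/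
   (forall s t, a <= s -> s < t -> t <= b -> al t < al s)) /\
  ae_on a b (fun t => derivable al t 1 /\ exists v, has_mderiv d be t v /\
     (if strict then - (derive1 al t) ^+ 2 + (f (al t)) ^+ 2 * v ^+ 2 < 0
      else - (derive1 al t) ^+ 2 + (f (al t)) ^+ 2 * v ^+ 2 <= 0)) /\
  ae_on a b (fun t => derivable al t 1 /\ 0 < derive1 al t).

Definition cone_len (f : R -> R) (Z : Type) (d : Z -> Z -> R)
    (gm : R -> R * Z) (a b : R) : \bar R :=
  (\int[@lebesgue_measure R]_(t in `[a, b]%classic)
     (Num.sqrt ((derive1 (fun s => (gm s).1) t) ^+ 2
                - (f (gm t).1) ^+ 2 * (mderiv d (fun s => (gm s).2) t) ^+ 2))%:E)%E.

Definition cone (I : set R) (f : R -> R) (Z : Type) (d : Z -> Z -> R) : lstr :=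
  @LStr (R * Z) [set y | I y.1] (cone_curve false I f d) (cone_curve true I f d)
        (cone_len f d).

(* The Lorentzian model spaces L^2(K') as global coordinate charts on    *)
(* R^2 with metric  - A dt^2 + B ds^2  (time function t = first coord):  *)
(*  K' = 0 : Minkowski  -dt^2 + ds^2                                    *)
(*  K' > 0 : universal cover of de Sitter S^2_1(r), r = 1/sqrt K' :      *)
(*           r^2 ( -dt^2 + cosh^2 t ds^2 )                              *)
(*  K' < 0 : universal cover of anti-de Sitter H^2_1(r), r=1/sqrt(-K') :  *)
(*           r^2 ( -cosh^2 s dt^2 + ds^2 )                              *)

Definition rcosh (x : R) : R := (expR x + expR (- x)) / 2.

Definition LA (K' : R) (p : R * R) : R :=
  if 0 < K' then K'^-1 else if K' == 0 then 1 else (rcosh p.2) ^+ 2 / (- K').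
Definition LB (K' : R) (p : R * R) : R :=
  if 0 < K' then (rcosh p.1) ^+ 2 / K' else if K' == 0 then 1 else (- K')^-1.

Definition eucl2 (p q : R * R) : R := `|p.1 - q.1| + `|p.2 - q.2|.

Definition L2_curve (strict : bool) (K' : R) (c : R -> R * R) (a b : R) : Prop :=
  let c1 := fun t => (c t).1 in
  let c2 := fun t => (c t).2 in
  a < b /\ abs_cont eucl2 c a b /\
  ae_on a b (fun t => derivable c1 t 1 /\ derivable c2 t 1 /\ 0 < derive1 c1 t /\
     (if strict then - LA K' (c t) * (derive1 c1 t) ^+ 2 + LB K' (c t) * (derive1 c2 t) ^+ 2 < 0
      else - LA K' (c t) * (derive1 c1 t) ^+ 2 + LB K' (c t) * (derive1 c2 t) ^+ 2 <= 0)).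

Definition L2_len (K' : R) (c : R -> R * R) (a b : R) : \bar R :=
  (\int[@lebesgue_measure R]_(t in `[a, b]%classic)
     (Num.sqrt (LA K' (c t) * (derive1 (fun s => (c s).1) t) ^+ 2
                - LB K' (c t) * (derive1 (fun s => (c s).2) t) ^+ 2))%:E)%E.

Definition L2 (K' : R) : lstr :=
  @LStr (R * R) setT (L2_curve false K') (L2_curve true K') (L2_len K').

Definition open_interval (I : set R) : Prop :=
  exists a b : \bar R, (a < b)%E /\ I = [set t | (a < t%:E)%E /\ (t%:E < b)%E].

End Defs.
Arguments tl_curv_bound {R} lower S D M K'.

(* Main.v *)
(* The time separation of (t, x) and (t', x') in a generalized cone depends only on t, t'
   and the fibre distance, and strictly decreases in that distance as long as the points
   are causally related: a causal curve can be replaced by one running along a fibre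
   geodesic with the fibre speed scaled by l <= 1, and by concavity of sqrt (p^2 - q^2) this
   changes the length L into at least l L + (1 - l) (t' - t), where L^2 + m^2 d^2 <= (t' - t)^2
   for any lower bound m of f. Hence maximal curves project to reparametrized minimal
   geodesics of the fibre, and the sides of a timelike triangle in I x_f X can be lifted,
   with the same side lengths, to I x_f M^2(K) over a comparison triangle of the
   projected triangle. The Alexandrov comparison of fibre distances becomes, by monotonicity, a
   comparison of time separations, to which the hypothesis on I x_f M^2(K) is applied. *)
Require Import Defs.
From mathcomp Require Import all_boot all_order all_algebra.
From mathcomp Require Import all_classical all_reals all_analysis.
From mathcomp Require Import measurable_realfun ring lra.
Set Implicit Arguments. Unset Strict Implicit. Unset Printing Implicit Defensive.
Import Order.TTheory GRing.Theory Num.Theory.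
Import numFieldNormedType.Exports.
Local Open Scope classical_set_scope.
Local Open Scope ring_scope.

(** * Absolutely continuous curves *)

(** The obstacle is that [tau] is a supremum which no curve need attain. Strict decrease in the
    fibre distance must therefore be quantitative: where [f >= m > 0], shortening the fibre
    component gains proper time by an amount that does not shrink along nearly optimal curves.
    Applied to nearly optimal curves between consecutive points of a maximal curve, this makes fibre
    distances add up along it. For each point of the cone over [X], the model cone is used only near
    a point over one fixed [p0]. Comparison triangles are therefore placed with a vertex at [p0] and
    kept small, for three reasons: geodesics of the model plane are constructed only below some
    radius, the perimeter must be admissible, and lifted sides must stay in the given neighbourhood.
    The curvature bound also demands continuity of [tau] and existence of maximal curves, so these
    are transferred as well. Maximal curves are lifted in both directions, from [X] to the model for
    the triangle sides and from the model to [X] for existence; in the second case causal convexity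
    of the chosen neighbourhood keeps the lift inside. *)

Section RealAnalysis.
Variable R : realType.
Local Notation mu := (@lebesgue_measure R).

(* Cousin's lemma *)
Lemma interval_induction (a b : R) (P : R -> R -> Prop) : a <= b ->
  (forall u v w, a <= u -> u <= v -> v <= w -> w <= b -> P u v -> P v w -> P u w) ->
  (forall t, a <= t <= b -> exists2 e, 0 < e & forall u v, a <= u -> v <= b ->
     t - e < u -> u <= t -> t <= v -> v < t + e -> P u v) ->
  P a b.
Proof.
move=> ab Padd Ploc.
pose S := [set x | a <= x <= b /\ P a x].
have Sa : S a.
  split; first by rewrite lexx.
  have [|e e0 He] := Ploc a; first by rewrite lexx.
  by apply: He => //; lra.
have Sub : ubound S b by move=> x [/andP[]].
have hS : has_sup S by split; [exists a|exists b].
have supb : sup S <= b by apply: ge_sup => //; exists a.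
have asup : a <= sup S by apply: ub_le_sup => //; exists b.
have [|e e0 He] := Ploc (sup S); first by rewrite asup.
have [x [/andP[ax xb] Px] xs] := sup_adherent e0 hS.
have xsup : x <= sup S by apply: ub_le_sup; [exists b|split => //; rewrite ax].
have H v : sup S <= v -> v <= b -> v < sup S + e -> P a v.
  move=> sv vb ve; apply: (Padd _ x) => //; first exact: le_trans sv.
  exact: He.
have [sb|sb] := ltP (sup S) b; last first.
  by apply: H => //; rewrite (@le_lt_trans _ _ (sup S))// ltrDl.
pose v := Num.min b (sup S + e / 2).
have vS : S v.
  have sv : sup S <= v by rewrite le_min ltW//=; lra.
  split; first by rewrite (le_trans asup)//= ge_min lexx.
  apply: H => //; first by rewrite ge_min lexx.
  by rewrite gt_min; apply/orP; right; lra.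
have : v <= sup S by apply: ub_le_sup => //; exists b.
by rewrite ge_min => /orP[]; lra.
Qed.

(** Unlike [ae_on], this exhibits a measurable null set that can be cut out of []a, b[], and it
    leaves out the endpoints, where two-sided increments leave the interval. [aeo_ae] shows the two
    equivalent. *)
Definition aeo (a b : R) (P : R -> Prop) := exists N : set R,
  [/\ measurable N, mu N = 0%E & forall t, a < t < b -> ~ N t -> P t].

Lemma aeo_mono a b (P Q : R -> Prop) :
  (forall t, a < t < b -> P t -> Q t) -> aeo a b P -> aeo a b Q.
Proof. by move=> PQ [N [mN N0 NP]]; exists N; split => // t ab Nt; apply: PQ => //; exact: NP. Qed.

Lemma aeo_and a b (P Q : R -> Prop) : aeo a b P -> aeo a b Q ->
  aeo a b (fun t => P t /\ Q t).
Proof.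
move=> [N [mN N0 NP]] [M [mM M0 MQ]]; exists (N `|` M); split.
- exact: measurableU.
- by rewrite measureU0.
- by move=> t tab /not_orP[? ?]; split; [exact: NP|exact: MQ].
Qed.

Lemma aeo_sub a b a' b' (P : R -> Prop) : a <= a' -> b' <= b -> aeo a b P -> aeo a' b' P.
Proof.
move=> aa bb [N [mN N0 NP]]; exists N; split => // t /andP[at' tb] Nt.
by apply: NP => //; rewrite (le_lt_trans aa)//= (lt_le_trans tb).
Qed.

Lemma aeo_ae a b (P : R -> Prop) : aeo a b P <-> ae_on a b P.
Proof.
split=> [[N [mN N0 NP]]|[N [mN N0 NP]]]; last first.
  exists N; split => // t /andP[at' tb] Nt; apply: contrapT => PN.
  apply: Nt; apply: NP => /=; apply: contra_not PN; apply.
  by rewrite /= in_itv/= !ltW.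
exists (N `|` ([set a] `|` [set b])); split.
- by apply: measurableU => //; apply: measurableU.
- have mab : mu ([set a] `|` [set b]) = 0%E.
    by rewrite measureU0//; exact: lebesgue_measure_set1.
  by rewrite measureU0//; exact: measurableU.
- move=> t /= /not_implyP[+ Pt]; rewrite in_itv/= => /andP[at' tb].
  have [->|ta] := eqVneq t a; first by right; left.
  have [->|tB] := eqVneq t b; first by right; right.
  left; apply: contrapT => Nt; apply: Pt; apply: NP => //.
  by rewrite !lt_neqAle at' tb tB eq_sym ta.
Qed.

Lemma aeo_ex a b (P : R -> Prop) : a < b -> aeo a b P -> exists2 t, a < t < b & P t.
Proof.
move=> ab [N [mN N0 NP]]; apply: contrapT => H.
have sub : `]a, b[%classic `<=` N.
  move=> t; rewrite /= in_itv/= => tab; apply: contrapT => Nt.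
  by apply: H; exists t => //; exact: NP.
have : (mu `]a, b[%classic <= mu N)%E by apply: le_measure => //; rewrite inE.
by rewrite N0 lebesgue_measure_itv/= lte_fin ab -EFinD lee_fin; lra.
Qed.

Definition distR (x y : R) : R := `|x - y|.

Lemma distR_metric : is_metric distR.
Proof.
rewrite /distR; split; [|split; [|split]].
- by move=> x y.
- move=> x y; split; last by move=> ->; rewrite subrr normr0.
  by move=> /eqP; rewrite normr_eq0 subr_eq0 => /eqP.
- by move=> x y; exact: distrC.
- by move=> x y z; exact: ler_distD.
Qed.

(** Multiplied out by [h]: no quotient appears in estimates and [h = 0] needs no exception. *)
Definition deriv_at (F : R -> R) (t p : R) := forall e, 0 < e -> exists2 c, 0 < c &
  forall h, `|h| < c -> `|F (t + h) - F t - p * h| <= e * `|h|.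

Definition mder_at X (d : X -> X -> R) (g : R -> X) (t p : R) := forall e, 0 < e ->
  exists2 c, 0 < c & forall h, `|h| < c -> `|d (g (t + h)) (g t) - p * `|h| | <= e * `|h|.

Lemma abs_cont_sub X (d : X -> X -> R) g a b a' b' : a <= a' -> b' <= b ->
  abs_cont d g a b -> abs_cont d g a' b'.
Proof.
move=> aa bb H e e0; have [c [c0 Hc]] := H _ e0; exists c; split => // n s t H1 H2 H3.
apply: Hc => // i ni; have [h1 [h2 h3]] := H1 i ni; split; [|split => //].
  exact: le_trans h1.
exact: le_trans bb.
Qed.

Lemma mder_ge0 X (d : X -> X -> R) g t p : is_metric d -> mder_at d g t p -> 0 <= p.
Proof.
move=> [d0 _] H; apply/ler_addgt0Pr => e e0; have [c c0 Hc] := H _ e0.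
have hc : `|c / 2| = c / 2 by rewrite ger0_norm//; lra.
have := Hc (c / 2); have := d0 (g (t + c / 2)) (g t).
rewrite hc ler_norml => d1 /(_ _)/andP[|_ H1]; first lra.
have : 0 <= (p + e) * (c / 2) by lra.
by rewrite pmulr_lge0//; lra.
Qed.

Lemma abs_cont_le (X Y : Type) (d : X -> X -> R) (dY : Y -> Y -> R) g h a b C :
  0 <= C ->
  (forall s t, a <= s -> s <= t -> t <= b -> dY (h s) (h t) <= C * d (g s) (g t)) ->
  abs_cont d g a b -> abs_cont dY h a b.
Proof.
move=> C0 H Ag e e0; have e1 : 0 < e / (C + 1) by rewrite divr_gt0//; lra.
have [c [c0 Hc]] := Ag _ e1; exists c; split => // n s t H1 H2 H3.
have H4 : \sum_(i < n) dY (h (s i)) (h (t i)) <= C * \sum_(i < n) d (g (s i)) (g (t i)).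
  rewrite mulr_sumr; apply: ler_sum => i _; have [h1 [h2 h3]] := H1 i (ltn_ord i).
  exact: H.
apply: le_lt_trans H4 _; have := Hc n s t H1 H2 H3; rewrite ltr_pdivlMr; last lra.
(* [d] is an arbitrary function here, so the sum may be negative. *)
set S := \sum_(i < n) _ => HS; have [S0|/ltW S0] := leP 0 S; first lra.
by apply: le_lt_trans e0; rewrite mulr_ge0_le0.
Qed.

End RealAnalysis.

Section AbsCont.
Variable R : realType.
Local Notation mu := (@lebesgue_measure R).

Lemma mder_at_near X (d : X -> X -> R) g t v : is_metric d -> mder_at d g t v ->
  forall e, 0 < e -> exists2 c, 0 < c & forall x, `|x - t| < c ->
    d (g x) (g t) <= (v + e) * `|x - t| /\ d (g t) (g x) <= (v + e) * `|x - t|.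
Proof.
move=> [_ [_ [dC _]]] H e e0; have [c c0 Hc] := H _ e0; exists c => // x xc.
have := Hc _ xc; rewrite subrKC ler_norml => /andP[_ h].
by rewrite (dC (g t)); split; lra.
Qed.

Lemma abs_cont_unif X (d : X -> X -> R) g a b : abs_cont d g a b -> forall e, 0 < e ->
  exists2 c, 0 < c & forall s t, a <= s -> s <= t -> t <= b -> t - s < c -> d (g s) (g t) < e.
Proof.
move=> H e e0; have [c [c0 Hc]] := H _ e0; exists c => // s t as_ st tb ts.
have := Hc 1%N (fun=> s) (fun=> t); rewrite !big_ord1; apply => //.
by move=> [|//] [|//].
Qed.

(* Around a point outside the exceptional null set the increment of g is controlled
   by that of G; the remaining intervals lie in an open set of small measure,
   where absolute continuity takes over. *)
Lemma ac_dist_le X (d : X -> X -> R) (g : R -> X) (G : R -> R) (a b : R) :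
  is_metric d -> a <= b -> abs_cont d g a b ->
  (forall s t, a <= s -> s <= t -> t <= b -> G s <= G t) ->
  aeo a b (fun t => exists v w, [/\ mder_at d g t v, deriv_at G t w & v <= w]) ->
  d (g a) (g b) <= G b - G a.
Proof.
move=> dm ab acg Gnd [N0 [mN0 N00 HN]].
have [_ [d00 [dC dT]]] := dm.
have dxx x : d x x = 0 by apply/d00.
pose N := N0 `|` ([set a] `|` [set b]).
have mN : measurable N by do 2! apply: measurableU => //.
have N0' : mu N = 0%E.
  have mab : mu ([set a] `|` [set b]) = 0%E.
    by rewrite measureU0//; exact: lebesgue_measure_set1.
  by rewrite measureU0//; exact: measurableU.
apply/ler_addgt0Pr => e e0.
have e20 : 0 < e / 2 by lra.
have [c [c0 Hc]] := acg _ e20.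
(* Outer regularity: disjoint intervals inside [V] have total length below the modulus [c] of
   absolute continuity. *)
have [V [oV NV muV]] : exists V, [/\ open V, N `<=` V & (mu V < c%:E)%E].
  have muN : (mu N < +oo)%E by rewrite N0'.
  have [V [oV NV h]] := @lebesgue_regularity_outer R N c mN muN c0.
  exists V; split => //.
  have -> : V = (V `\` N) `|` N.
    apply/seteqP; split => x; last by move=> [[]//|/NV].
    by move=> Ox; have [|] := pselect (N x); [right|left].
  rewrite measureU0//; apply: measurableD => //; exact: open_measurable.
have mV : measurable V by exact: open_measurable.
pose eta := e / (2 * (b - a + 1)).
have eta0 : 0 < eta by rewrite divr_gt0//; lra.
have etae : eta * (b - a) <= e / 2.
  rewrite /eta invfM mulrA -[leRHS]mulr1 -mulrA ler_wpM2l//; first lra.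
  by rewrite mulrC ler_pdivrMr; lra.
(* Up to the slope error [eta], the increment of [g] exceeds that of [G] only by its increments over
   finitely many ordered intervals, whose length is charged to [V]. The half-open [[u, v[] makes the
   charge additive when adjacent intervals are joined. *)
pose P u v := exists n (s t : nat -> R), [/\
  forall i, (i < n)%N -> u <= s i /\ s i <= t i /\ t i <= v,
  forall i j, (i < j)%N -> (j < n)%N -> t i <= s j,
  ((\sum_(i < n) (t i - s i))%:E <= mu (V `&` `[u, v[))%E &
  d (g u) (g v) <= G v - G u + eta * (v - u) + \sum_(i < n) d (g (s i)) (g (t i))].
suff [n [s [t [H1 H2 H3 H4]]]] : P a b.
  have : \sum_(i < n) d (g (s i)) (g (t i)) < e / 2.
    apply: Hc => // [i j ni nj ij|].
      by have [ltij|ltij|//] := ltngtP i j; [left; exact: H2|right; exact: H2].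
    rewrite -lte_fin; apply: le_lt_trans H3 _; apply: le_lt_trans muV.
    by apply: le_measure; rewrite ?inE//; exact: measurableI.
  by lra.
apply: interval_induction => //.
- move=> u v w au uv vw wb [n1 [s1 [t1 [A1 A2 A3 A4]]]] [n2 [s2 [t2 [B1 B2 B3 B4]]]].
  pose s i := if (i < n1)%N then s1 i else s2 (i - n1)%N.
  pose t i := if (i < n1)%N then t1 i else t2 (i - n1)%N.
  have lo i : (i < n1)%N -> s i = s1 i /\ t i = t1 i by rewrite /s /t => ->.
  have hi i : (n1 <= i)%N -> s i = s2 (i - n1)%N /\ t i = t2 (i - n1)%N.
    by rewrite /s /t ltnNge => ->.
  have S (F : R -> R -> R) : \sum_(i < n1 + n2) F (s i) (t i) =
      \sum_(i < n1) F (s1 i) (t1 i) + \sum_(i < n2) F (s2 i) (t2 i).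
    rewrite big_split_ord/=; congr (_ + _); apply: eq_bigr => i _.
      by have [-> ->] := lo i (ltn_ord i).
    by have [-> ->] := hi (n1 + i)%N (leq_addr _ _); rewrite addKn.
  exists (n1 + n2)%N, s, t; split.
  + move=> i ni; case: (ltnP i n1) => hin.
      by have [-> ->] := lo _ hin; have [? [? ?]] := A1 _ hin; split => //; split => //; lra.
    have [-> ->] := hi _ hin; have [|? [? ?]] := B1 (i - n1)%N; first by rewrite ltn_subLR.
    by split => //; lra.
  + move=> i j ij nj; case: (ltnP j n1) => hj.
      have hin := ltn_trans ij hj.
      by have [-> _] := lo _ hj; have [_ ->] := lo _ hin; exact: A2.
    have hj2 : (j - n1 < n2)%N by rewrite ltn_subLR.
    have [-> _] := hi _ hj; have [? _] := B1 _ hj2.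
    case: (ltnP i n1) => hin.
      by have [_ ->] := lo _ hin; have [_ [_ ?]] := A1 _ hin; lra.
    by have [_ ->] := hi _ hin; apply: B2 => //; exact: ltn_sub2r (leq_ltn_trans hin ij) ij.
  + rewrite (S (fun x y => y - x)) EFinD.
    rewrite (@itv_bndbnd_setU _ _ _ (BLeft v))//=.
    rewrite setIUr measureU ?leeD//; try exact: measurableI.
    rewrite -setIIr; apply/seteqP; split => // x [_ []]/=; rewrite !in_itv/= => /andP[_ xv] /andP[vx _].
    by lra.
  + rewrite (S (fun x y => d (g x) (g y))); have := dT (g u) (g v) (g w); lra.
move=> t /andP[at' tb].
have [Nt|Nt] := pselect (N t).
  have /nbhs_ballP[r /= r0 rV] : nbhs t V by apply: open_nbhs_nbhs; split => //; exact: NV.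
  exists r => // u v au vb u1 ut tv v1.
  exists 1%N, (fun=> u), (fun=> v); split.
  + by move=> i _; split => //; split => //; lra.
  + by move=> i [|//].
  + rewrite big_ord1; rewrite (_ : V `&` _ = `[u, v[%classic).
      rewrite lebesgue_measure_itv/= lte_fin; case: ifPn; first by rewrite EFinD EFinN.
      by rewrite -leNgt => vu; rewrite lee_fin; lra.
    apply/setIidr => x/=; rewrite in_itv/= => /andP[ux xv]; apply: rV.
    by rewrite /ball/= ltr_norml; apply/andP; split; lra.
  + by rewrite big_ord1; have := Gnd u v; have : 0 <= eta * (v - u); [apply: mulr_ge0; lra|lra].
have [atb Nt0] : a < t < b /\ ~ N0 t.
  split; last by move=> ?; apply: Nt; left.
  rewrite !lt_neqAle at' tb !andbT; apply/andP; split; apply/eqP => h.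
    by apply: Nt; right; left; rewrite h.
  by apply: Nt; right; right; rewrite h.
have [v [w [gv Gw vw]]] := HN t atb Nt0.
have e40 : 0 < eta / 2 by lra.
have [c1 c10 Hc1] := mder_at_near dm gv e40.
have [c2 c20 Hc2] := Gw _ e40.
have H0 : 0 < Num.min c1 c2 by rewrite lt_min c10.
exists (Num.min c1 c2) => // u z au zb u1 ut tz z1.
have [m1 m2] : Num.min c1 c2 <= c1 /\ Num.min c1 c2 <= c2.
  by rewrite !ge_min !lexx orbT.
exists 0%N, (fun=> u), (fun=> z); split => //.
  by rewrite big_ord0 measure_ge0.
rewrite big_ord0.
have hu : `|u - t| = t - u by rewrite distrC ger0_norm// subr_ge0.
have hz : `|z - t| = z - t by rewrite ger0_norm// subr_ge0.
have [|_ h2] := Hc1 z; first by rewrite hz; lra.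
have [|h1 _] := Hc1 u; first by rewrite hu; lra.
have := Hc2 (u - t); have := Hc2 (z - t).
rewrite !subrKC hu hz !ler_norml => k1 k2.
have zc : z - t < c2 by lra.
have uc : t - u < c2 by lra.
have /andP[_ {}k2] := k2 uc; have /andP[{}k1 _] := k1 zc.
rewrite hz in h2; rewrite hu in h1.
have := dT (g u) (g t) (g z).
have : v * (t - u) <= w * (t - u) by rewrite ler_wpM2r//; lra.
have : v * (z - t) <= w * (z - t) by rewrite ler_wpM2r//; lra.
lra.
Qed.

End AbsCont.

(** * Derivatives almost everywhere and indefinite integrals *)

Section Primitive.
Variable R : realType.
Local Notation mu := (@lebesgue_measure R).

Lemma dnbhs0P (P : R -> Prop) :
  (\forall h \near (0 : R)^', P h) <->
  exists2 c, 0 < c & forall h, h != 0 -> `|h| < c -> P h.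
Proof.
split=> [/nbhs_ballP[c /= c0 H]|[c c0 H]].
  by exists c => // h h0 hc; apply: H => //; rewrite /ball/= sub0r normrN.
apply/nbhs_ballP; exists c => //= h; rewrite /ball/= sub0r normrN => hc h0.
exact: H.
Qed.

Lemma deriv_atP (F : R -> R) t p :
  deriv_at F t p <-> h^-1 *: (F (h + t) - F t) @[h --> (0 : R)^'] --> p.
Proof.
split=> [H|/cvgrPdist_le H].
  apply/cvgrPdist_le => e e0; apply/dnbhs0P; have [c c0 Hc] := H _ e0; exists c => // h h0 hc.
  rewrite /GRing.scale/= -(ler_pM2r (_ : 0 < `|h|)) ?normr_gt0// -normrM mulrBl.
  by rewrite mulrAC mulVf// mul1r distrC (addrC h); exact: Hc.
move=> e e0; have /dnbhs0P[c c0 Hc] := H _ e0; exists c => // h hc.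
have [->|h0] := eqVneq h 0; first by rewrite addr0 subrr mulr0 subrr normr0 mulr0.
have := Hc h h0 hc; rewrite /GRing.scale/= -(ler_pM2r (_ : 0 < `|h|)) ?normr_gt0// -normrM mulrBl.
by rewrite mulrAC mulVf// mul1r distrC (addrC h).
Qed.

Lemma deriv_at_derive1 (F : R -> R) t p : derivable F t 1 /\ derive1 F t = p <-> deriv_at F t p.
Proof.
have E : (fun h : R => h^-1 *: (F (h *: (1 : R) + t) - F t)) =
         (fun h => h^-1 *: (F (h + t) - F t)).
  by apply/funext => h; rewrite [h *: 1]mulr1.
split=> [[dF Fp]|/deriv_atP H]; last first.
  split; last by apply/cvg_lim => //; exact: H.
  by apply/cvg_ex; exists p => /=; rewrite E.
apply/deriv_atP; rewrite -Fp; rewrite derive1E /derive.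
move: dF => /cvg_ex[/= q]; rewrite E => Hq.
by have -> := cvg_lim _ Hq.
Qed.

Lemma mder_atP X (d : X -> X -> R) g t p : is_metric d -> mder_at d g t p <-> has_mderiv d g t p.
Proof.
move=> [_ [d00 _]]; split=> [H|/cvgrPdist_le H].
  apply/cvgrPdist_le => e e0; apply/dnbhs0P; have [c c0 Hc] := H _ e0; exists c => // h h0 hc.
  have h1 : 0 < `|h| by rewrite normr_gt0.
  have := Hc _ hc; rewrite distrC => h2.
  rewrite -(ler_pM2r h1); apply: le_trans h2; rewrite -[X in _ * X](normr_id h) -normrM mulrBl.
  by rewrite divfK// gt_eqF.
move=> e e0; have /dnbhs0P[c c0 Hc] := H _ e0; exists c => // h hc.
have [->|h0] := eqVneq h 0.
  by rewrite addr0 normr0 !mulr0 subr0; have -> := (d00 (g t) (g t)).2 erefl; rewrite normr0.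
have h1 : 0 < `|h| by rewrite normr_gt0.
have := Hc h h0 hc; rewrite -(ler_pM2r h1); apply: le_trans.
by rewrite -[X in _ <= _ * X](normr_id h) -normrM mulrBl divfK ?gt_eqF// distrC.
Qed.

Lemma mderivE X (d : X -> X -> R) g t p : is_metric d -> mder_at d g t p -> mderiv d g t = p.
Proof. by move=> dm /(mder_atP _ _ _ dm) H; apply/cvg_lim. Qed.

Lemma deriv_at_mder (F : R -> R) t p : 0 <= p -> deriv_at F t p -> mder_at (@distR R) F t p.
Proof.
move=> p0 H e e0; have [c c0 Hc] := H _ e0; exists c => // h hc.
apply: le_trans (Hc _ hc); rewrite /distR -[in X in `|_ - X|](ger0_norm p0) -normrM.
by apply: ler_dist_dist.
Qed.

Section prim.
Variable f : R -> R.
Hypothesis f0 : forall x, 0 <= f x.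
Hypothesis fi : mu.-integrable setT (EFin \o f).
Let F x := (\int[mu]_(t in `]-oo, x]) f t)%R.

Let fiS A : measurable A -> mu.-integrable A (EFin \o f).
Proof. by move=> mA; exact: integrableS fi. Qed.

Lemma prim_sub s t : s <= t -> (F t - F s)%:E = (\int[mu]_(x in `]s, t]) (f x)%:E)%E.
Proof.
move=> st; rewrite /F (@itv_bndbnd_setU _ _ _ (BRight s))//=.
rewrite Rintegral_setU//=; last 2 first.
- by apply: fiS; exact: measurableU.
- apply/disj_setPLR => x/=; rewrite !in_itv/= => xs; apply/negP; rewrite negb_and -leNgt xs//.
rewrite addrAC subrr add0r /Rintegral fineK//; apply: integrable_fin_num => //; exact: fiS.
Qed.

(** Lebesgue's differentiation theorem. *)
Lemma prim_deriv a b : aeo a b (fun t => deriv_at F t (f t)).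
Proof.
apply/aeo_ae; have := @FTC1Ny R f _ _.
have h1 y : mu.-integrable `]-oo, y] (EFin \o f) by exact: fiS.
have h2 : locally_integrable [set: R] f.
  by have := integrable_locally measurableT fi; rewrite patch_setT.
move=> /(_ h1 h2); apply: filterS; first exact: (ae_filter_ringOfSetsType mu).
by move=> x H _; apply/deriv_at_derive1.
Qed.

End prim.

End Primitive.

Section AcPrimitive.
Variable R : realType.
Local Notation mu := (@lebesgue_measure R).

Lemma abs_cont_id (a b : R) : abs_cont (@distR R) id a b.
Proof.
move=> e e0; exists e; split => // n s t H1 _; apply: le_lt_trans.
apply: ler_sum => i _; have [_ [st _]] := H1 i (ltn_ord i).
by rewrite /distR/= distrC ger0_norm// subr_ge0.
Qed.

Lemma deriv_atZ (F : R -> R) t p C : deriv_at F t p -> deriv_at (fun x => C * F x) t (C * p).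
Proof.
move=> H e e0; have [|c c0 Hc] := H (e / (`|C| + 1)); first by rewrite divr_gt0// ltr_wpDl.
exists c => // h hc; rewrite -mulrA -!mulrBr normrM.
apply: (@le_trans _ _ (`|C| * (e / (`|C| + 1) * `|h|))).
  by apply: ler_wpM2l => //; exact: Hc.
rewrite !mulrA ler_wpM2r// ler_pdivrMr ?ltr_wpDl//.
by rewrite mulrC ler_wpM2l ?ltW//; lra.
Qed.

Lemma deriv_atD (F G : R -> R) t p q : deriv_at F t p -> deriv_at G t q ->
  deriv_at (fun x => F x + G x) t (p + q).
Proof.
move=> HF HG e e0; have e20 : 0 < e / 2 by lra.
have [c c0 Hc] := HF _ e20; have [c' c0' Hc'] := HG _ e20.
exists (Num.min c c'); first by rewrite lt_min c0.
move=> h; rewrite lt_min => /andP[/Hc h1 /Hc' h2].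
have -> : F (t + h) + G (t + h) - (F t + G t) - (p + q) * h =
  (F (t + h) - F t - p * h) + (G (t + h) - G t - q * h) by ring.
by apply: le_trans (ler_normD _ _) _; lra.
Qed.

Section ac_primitive.
Variables (a b C : R) (al v : R -> R) (E : set R).
Hypotheses (ab : a < b) (C0 : 0 <= C) (acal : abs_cont (@distR R) al a b)
  (ndal : forall s t, a <= s -> s <= t -> t <= b -> al s <= al t)
  (mE : measurable E) (Eab : forall t, E t -> a < t < b) (aeE : aeo a b E)
  (mv : measurable_fun E v) (v0 : forall t, E t -> 0 <= v t)
  (vle : forall t, E t -> exists2 p, deriv_at al t p & v t <= C * p).

Let A (n : nat) := E `&` [set t | v t <= n%:R].

Let mA n : measurable (A n).
Proof.
have := mv mE (measurable_itv `]-oo, (n%:R : R)]).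
by congr measurable; apply/seteqP; split => t [Et]; rewrite /= in_itv.
Qed.

Let finE (B : set R) : measurable B -> B `<=` E -> (mu B < +oo)%E.
Proof.
move=> mB BE; apply: (@le_lt_trans _ _ (mu `]a, b[%classic)).
  by apply: le_measure; rewrite ?inE// => t /BE/Eab; rewrite /= in_itv.
by rewrite lebesgue_measure_itv/= lte_fin ab -EFinB ltry.
Qed.

Let w n := v \_ (A n).

Let w0 n x : 0 <= w n x.
Proof. by rewrite /w patchE; case: ifPn => // /set_mem[/v0]. Qed.

Let wn n x : w n x <= n%:R.
Proof. by rewrite /w patchE; case: ifPn => // /set_mem[]. Qed.

Let mw n : measurable_fun setT (w n).
Proof.
have h : measurable_fun (A n) v by apply: (measurable_funS mE _ mv) => // x [].
exact: (measurable_restrictT v (mA n)).1 h.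
Qed.

Let wint n : mu.-integrable setT (EFin \o w n).
Proof.
rewrite /w -restrict_EFin -integrable_mkcond; last exact: mA.
have mAn := mA n; apply: measurable_bounded_integrable => //.
- by have h : (mu (A n) < +oo)%E by apply: finE => // x [].
- by apply: (measurable_funS mE _ mv) => // x [].
- exists n%:R; split; first exact: num_real.
  move=> M nM x [Ex xn]; rewrite /= ger0_norm ?v0//; exact: le_trans xn (ltW nM).
Qed.

(** The truncated integrand is at most [n], so its primitive is [n]-Lipschitz, hence absolutely
    continuous, and [ac_dist_le] compares it with [C * al] through derivatives. The resulting bound
    is free of [n]. *)
Let int_w n s t : a <= s -> s <= t -> t <= b ->
  (\int[mu]_(x in `]s, t]) (w n x)%:E <= (C * (al t - al s))%:E)%E.
Proof.
move=> as_ st tb; rewrite -(prim_sub (wint n) st).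
pose F x := (\int[mu]_(t in `]-oo, x]) w n t)%R.
have FL x y : x <= y -> F x <= F y /\ F y - F x <= n%:R * (y - x).
  move=> xy; have := prim_sub (wint n) xy; rewrite -/(F _) -/(F y) => Fxy; split.
    by rewrite -subr_ge0 -lee_fin Fxy; apply: integral_ge0 => z _; rewrite lee_fin.
  rewrite -lee_fin Fxy; apply: (@le_trans _ _ (\int[mu]_(_ in `]x, y]) n%:R%:E)%E).
    apply: ge0_le_integral => //=.
    - by move=> z _; rewrite lee_fin.
    - by apply/measurable_EFinP; exact: measurable_funTS (mw n).
    - by move=> z _; rewrite lee_fin.
  rewrite integral_cst//= lebesgue_measure_itv/= lte_fin.
  case: ifPn; first by rewrite -EFinB -EFinM.
  by rewrite mule0 lee_fin => _; apply: mulr_ge0 => //; lra.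
rewrite lee_fin -/(F t) -/(F s).
have -> : F t - F s = distR (F s) (F t).
  by rewrite /distR distrC ger0_norm// subr_ge0; exact: (FL s t st).1.
rewrite mulrBr.
apply: (ac_dist_le (G := fun x => C * al x)) => //.
- exact: distR_metric.
- apply: abs_cont_le (@abs_cont_id s t); first exact: ler0n n.
  move=> x y _ xy _; have [h1 h2] := FL _ _ xy.
  by rewrite /distR !(distrC x) !(distrC (F x)) !ger0_norm ?subr_ge0.
- by move=> x y sx xy yt; rewrite ler_wpM2l// ndal//; [exact: le_trans sx|exact: le_trans tb].
- have h := aeo_and (aeo_sub as_ tb aeE) (prim_deriv (wint n) s t).
  apply: aeo_mono h => x _ [Ex Fx]; have [p alp vp] := vle Ex.
  exists (w n x), (C * p); split.
  + exact: deriv_at_mder.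
  + exact: deriv_atZ.
  + rewrite /w patchE; case: ifPn => // _; exact: le_trans (v0 Ex) vp.
Qed.

Let W := v \_ E.

Let W0 x : 0 <= W x.
Proof. by rewrite /W patchE; case: ifPn => // /set_mem/v0. Qed.

(** Monotone convergence along the sets [A n], which exhaust [E], removes the truncation. *)
Let int_W s t : a <= s -> s <= t -> t <= b ->
  (\int[mu]_(x in `]s, t]) (W x)%:E <= (C * (al t - al s))%:E)%E.
Proof.
move=> as_ st tb.
have e1 (B : set R) : (\int[mu]_(x in `]s, t]) ((v \_ B) x)%:E =
    \int[mu]_(x in `]s, t] `&` B) (v x)%:E)%E.
  rewrite integral_mkcondr; apply: eq_integral => x _.
  by rewrite !patchE; case: ifPn.
rewrite e1.
have -> : `]s, t] `&` E = \bigcup_n (`]s, t] `&` A n).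
  rewrite -setI_bigcupr; congr (_ `&` _); apply/seteqP; split => [x Ex|x [n _ []]//].
  have [n _ H] : exists2 n, True & v x <= n%:R.
    by exists (Num.bound (v x)) => //; apply: ltW; exact: archi_boundP (v0 Ex).
  by exists n.
have ndS : {homo (fun n => `]s, t]%classic `&` A n) : n m / (n <= m)%N >-> (n <= m)%O}.
  move=> n m nm; apply/subsetPset => x [H1 [H2 H3]]; split => //; split => //.
  by apply: le_trans H3 _; rewrite ler_nat.
have H : (\int[mu]_(x in `]s, t] `&` A n) (v x)%:E)%E @[n --> \oo] -->
         (\int[mu]_(x in \bigcup_n (`]s, t] `&` A n)) (v x)%:E)%E.
  apply: ge0_nondecreasing_set_cvg_integral => //.
  - by move=> n; apply: measurableI => //; exact: mA.
  - move=> n; apply/measurable_EFinP; apply: (measurable_funS mE _ mv).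
    by move=> x [_ []].
  - by move=> n x [_ [Ex _]]; rewrite lee_fin v0.
rewrite -(cvg_lim _ H)//.
apply: lime_le; first by apply/cvg_ex; eexists; exact: H.
by apply: nearW => n; rewrite -e1; exact: int_w.
Qed.

(** Integrability of [v] is not given but follows from [int_W]. The same bound on increments makes
    the primitive absolutely continuous, because [al] is. *)
Lemma ac_primitive : exists phi : R -> R, [/\ abs_cont (@distR R) phi a b,
  forall s t, a <= s -> s <= t -> t <= b -> phi s <= phi t,
  aeo a b (fun t => deriv_at phi t (v t)) &
  (\int[mu]_(x in E) (v x)%:E)%E = (phi b - phi a)%:E].
Proof.
have mW : measurable_fun setT W by exact: (measurable_restrictT v mE).1 mv.
have intE : (\int[mu]_(x in E) (v x)%:E = \int[mu]_(x in `]a, b]) (W x)%:E)%E.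
  rewrite (_ : E = `]a, b] `&` E); last first.
    apply/esym/setIidr => x /Eab; rewrite /= in_itv/= => /andP[-> xb].
    exact: ltW.
  rewrite integral_mkcondr; apply: eq_integral => x _; rewrite /W !patchE.
  by case: ifPn.
have Wint : mu.-integrable setT (EFin \o W).
  rewrite /W -restrict_EFin -integrable_mkcond//.
  apply/integrableP; split; first exact/measurable_EFinP.
  have H : (\int[mu]_(x in E) `|(EFin \o v) x| < +oo)%E.
    have -> : (\int[mu]_(x in E) `|(EFin \o v) x| = \int[mu]_(x in E) (v x)%:E)%E.
      by apply: eq_integral => x /set_mem Ex; rewrite /= ger0_norm// v0.
    rewrite intE; apply: le_lt_trans (int_W _ _ _) _ => //; first exact: ltW.
    by rewrite ltry.
  exact: H.
pose phi x := (\int[mu]_(t in `]-oo, x]) W t)%R.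
have P s t : a <= s -> s <= t -> t <= b -> phi s <= phi t /\ phi t - phi s <= C * (al t - al s).
  move=> as_ st tb; have := prim_sub Wint st; rewrite -/(phi _) -/(phi t) => Pxy; split.
    by rewrite -subr_ge0 -lee_fin Pxy; apply: integral_ge0 => z _; rewrite lee_fin.
  by rewrite -lee_fin Pxy int_W.
exists phi; split.
- apply: abs_cont_le C0 _ acal => s t as_ st tb; have [h1 h2] := P _ _ as_ st tb.
  rewrite /distR !(distrC (phi s)) (distrC (al s)) !ger0_norm ?subr_ge0//.
  exact: ndal.
- by move=> s t as_ st tb; exact: (P s t as_ st tb).1.
- have h := aeo_and aeE (prim_deriv Wint a b).
  by apply: aeo_mono h => t _ [Et]; rewrite /W patchE mem_set.
- by rewrite intE -(prim_sub Wint (ltW ab)).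
Qed.

End ac_primitive.
End AcPrimitive.

(** * Integrals over full-measure sets and measurability of metric derivatives *)

Section Measurability.
Variable R : realType.
Local Notation mu := (@lebesgue_measure R).

Lemma integral_mono (f g : R -> \bar R) : (forall x, 0 <= f x)%E -> (forall x, f x <= g x)%E ->
  (\int[mu]_x f x <= \int[mu]_x g x)%E.
Proof.
move=> f0 fg; have g0 x : (0 <= g x)%E by exact: le_trans (f0 x) (fg x).
rewrite !ge0_integralTE//; apply: ereal_sup_le => _ [h hf <-]; exists h => // x.
exact: le_trans (hf x) (fg x).
Qed.

(* No measurability of g off E is assumed: the integral of a nonnegative
   function is defined as a supremum over simple functions below it. *)
Lemma integral_full (a b : R) (E : set R) (g : R -> R) : measurable E ->
  (forall t, E t -> a < t < b) -> aeo a b E -> measurable_fun E g -> (forall x, 0 <= g x) ->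
  (\int[mu]_(x in `[a, b]) (g x)%:E = \int[mu]_(x in E) (g x)%:E)%E.
Proof.
move=> mE Eab [N [mN N0 HN]] mg g0.
have EI : E `<=` `[a, b]%classic by move=> x /Eab; rewrite /= in_itv/= => /andP[/ltW-> /ltW->].
have g0e x : (0 <= (g x)%:E)%E by rewrite lee_fin.
apply/eqP; rewrite eq_le; apply/andP; split; last first.
  rewrite integral_mkcond [leRHS]integral_mkcond; apply: integral_mono => x.
    by rewrite patchE; case: ifPn.
  rewrite !patchE; case: ifPn => [/set_mem/EI xI|_]; first by rewrite mem_set.
  by case: ifPn.
pose M : set R := `[a, b] `\` E.
have mM : measurable M by exact: measurableD.
have M0 : mu M = 0%E.
  have mab : mu ([set a] `|` [set b]) = 0%E.
    by rewrite measureU0//; exact: lebesgue_measure_set1.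
  have mNab : mu (N `|` ([set a] `|` [set b])) = 0%E.
    by rewrite measureU0//; exact: measurableU.
  apply: (subset_measure0 _ _ _ mNab) => //; first by do 2! apply: measurableU => //.
  move=> x [/=]; rewrite in_itv/= => /andP[ax xb] Ex.
  have [->|xa] := eqVneq x a; first by right; left.
  have [->|xB] := eqVneq x b; first by right; right.
  left; apply: contrapT => Nx; apply: Ex; apply: HN => //.
  by rewrite !lt_neqAle ax xb xB eq_sym xa.
(* A measurable majorant of [g] on the interval: nothing is known of [g] on the null set [M], so [h]
   is infinite there. *)
pose h (x : R) : \bar R := if x \in E then (g x)%:E else if x \in M then +oo%E else 0%E.
have h0 x : (0 <= h x)%E by rewrite /h; case: ifPn => // _; case: ifPn.
have mh : measurable_fun setT h.
  have -> : h = (fun x => ((EFin \o g) \_ E) x + (cst +oo \_ M) x)%E.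
    apply/funext => x; rewrite /h !patchE; case: ifPn => xE; last by rewrite add0e.
    rewrite ifF ?adde0//; apply/negbTE; rewrite notin_setE => -[_]; apply.
    exact: set_mem.
  have mg1 : measurable_fun E (EFin \o g) by exact/measurable_EFinP.
  have mc : measurable_fun M (cst +oo%E : R -> \bar R) by exact: measurable_cst.
  have H1 := (measurable_restrictT (EFin \o g) mE).1 mg1.
  have H2 := (measurable_restrictT (cst +oo%E : R -> \bar R) mM).1 mc.
  exact: emeasurable_funD H1 H2.
apply: (@le_trans _ _ (\int[mu]_x h x)%E).
  rewrite integral_mkcond; apply: integral_mono => x.
    by rewrite patchE; case: ifPn.
  rewrite patchE; case: ifPn => xI; last exact: h0.
  rewrite /h.
  case: ifPn => // xE; case: ifPn => [_|]; first exact: leey.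
  rewrite notin_setE => xM; exfalso; apply: xM; split; first exact: set_mem.
  by move: xE; rewrite notin_setE.
have H : (\int[mu]_x h x = \int[mu]_(x in setT `\` M) h x)%E.
  by apply: ge0_negligible_integral => //; exact: M0.
rewrite H integral_mkcond [leRHS]integral_mkcond; apply: integral_mono => x.
  by rewrite patchE; case: ifPn.
rewrite !patchE /h; case: ifPn => [|_]; last by case: ifPn.
by rewrite inE => -[_ xM]; case: ifPn => // _; rewrite ifF//; apply/negbTE; rewrite notin_setE.
Qed.

(** Clamping the parameter turns a curve controlled only on [[a, b]] into one continuous on the
    whole line. *)
Definition clip (a b x : R) := Num.max a (Num.min x b).

Lemma clip_itv a b x : a <= b -> a <= clip a b x <= b.
Proof. by move=> ab; rewrite /clip le_max lexx ge_max ab ge_min lexx orbT. Qed.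

Lemma clip_id a b x : a <= x -> x <= b -> clip a b x = x.
Proof. by move=> ax xb; rewrite /clip min_l// max_r. Qed.

Lemma clip_lip a b x y : a <= b -> x <= y -> clip a b x <= clip a b y <= clip a b x + (y - x).
Proof.
move=> ab xy; rewrite /clip.
rewrite !maxEle !minEle; do ! case: ifPn; rewrite -?ltNge => *;
  by apply/andP; split; lra.
Qed.

Lemma clip_cont X (d : X -> X -> R) g a b : is_metric d -> a <= b -> abs_cont d g a b ->
  forall t e, 0 < e -> exists2 c, 0 < c & forall x, `|x - t| < c ->
    d (g (clip a b x)) (g (clip a b t)) < e.
Proof.
move=> [_ [_ [dC _]]] ab acg t e e0; have [c c0 Hc] := abs_cont_unif acg e0; exists c => // x xt.
have [h1|/ltW h1] := leP x t.
  have /andP[h2 h3] := clip_lip ab h1; have /andP[h4 _] := clip_itv x ab.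
  have /andP[_ h5] := clip_itv t ab; apply: Hc => //.
  by move: xt; rewrite distrC ger0_norm; lra.
have /andP[h2 h3] := clip_lip ab h1; have /andP[h4 _] := clip_itv t ab.
have /andP[_ h5] := clip_itv x ab; rewrite dC; apply: Hc => //.
by move: xt; rewrite ger0_norm; lra.
Qed.

Lemma quot_dist_le (x y h e : R) : 0 < h -> `|x - y * h| <= e * h -> `|x / h - y| <= e.
Proof.
move=> h0 H; rewrite -(ler_pM2r h0); apply: le_trans H.
by rewrite -[X in _ * X](ger0_norm (ltW h0)) -normrM mulrBl divfK ?gt_eqF.
Qed.

(** On [E] the metric derivative is the pointwise limit of the difference quotients of the clipped
    curve with step [1 / (n + 1)], and these are continuous in [t]. *)
Lemma measurable_mder X (d : X -> X -> R) g a b (E : set R) (v : R -> R) :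
  is_metric d -> a < b -> abs_cont d g a b -> measurable E ->
  (forall t, E t -> a < t < b) -> (forall t, E t -> mder_at d g t (v t)) ->
  measurable_fun E v.
Proof.
move=> dm ab acg mE Eab Ev; have [d0 [d00 [dC dT]]] := dm.
pose G x := g (clip a b x).
pose k (n : nat) t := d (G (t + n.+1%:R^-1)) (G t) / n.+1%:R^-1.
apply: (@measurable_fun_cvg _ _ _ _ k).
  move=> n; apply: measurable_funTS; apply: measurable_funM => //.
  apply: continuous_measurable_fun => t; apply/cvgrPdist_lt => e e0.
  have e20 : 0 < e / 2 by lra.
  have [c1 c10 H1] := clip_cont dm (ltW ab) acg (t + n.+1%:R^-1) e20.
  have [c2 c20 H2] := clip_cont dm (ltW ab) acg t e20.
  apply/nbhs_ballP; exists (Num.min c1 c2); first by rewrite /= lt_min c10.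
  move=> x; rewrite /ball/= lt_min => /andP[x1 x2].
  have h1 := H1 (x + n.+1%:R^-1); have h2 := H2 x.
  have {}h1 : d (G (x + n.+1%:R^-1)) (G (t + n.+1%:R^-1)) < e / 2.
    by apply: h1; rewrite opprD addrACA subrr addr0 distrC.
  have {}h2 : d (G x) (G t) < e / 2 by apply: h2; rewrite distrC.
  have := dT (G (x + n.+1%:R^-1)) (G (t + n.+1%:R^-1)) (G x).
  have := dT (G (t + n.+1%:R^-1)) (G t) (G x).
  have := dT (G (t + n.+1%:R^-1)) (G (x + n.+1%:R^-1)) (G t).
  have := dT (G (x + n.+1%:R^-1)) (G x) (G t).
  rewrite (dC (G t) (G x)) (dC (G (t + _)) (G (x + _))) ltr_norml => *; apply/andP; split; lra.
move=> t Et; apply/cvgrPdist_le => e e0.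
have [c c0 Hc] := Ev t Et _ e0; have /andP[at' tb] := Eab _ Et.
(* A step below [b - t] stays in the interval, where clipping is the identity. *)
have m0 : 0 < Num.min c (b - t) by rewrite lt_min c0 subr_gt0.
near=> n.
have nm : n.+1%:R^-1 < Num.min c (b - t).
  by near: n; exact: near_infty_natSinv_lt (PosNum m0).
have n0 : 0 < n.+1%:R^-1 :> R by rewrite invr_gt0 ltr0n.
move: nm; rewrite lt_min => /andP[n1 n2].
have h1 : a <= t + n.+1%:R^-1 by rewrite ler_wpDr// ltW.
have h2 : t + n.+1%:R^-1 <= b by rewrite -lerBrDl ltW.
have [h3 h4] := (ltW at', ltW tb).
rewrite /k /G !clip_id//.
rewrite distrC. apply: quot_dist_le => //.
by have := Hc n.+1%:R^-1; rewrite ger0_norm; [apply|exact: ltW].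
Unshelve. all: by end_near. Qed.

End Measurability.

(** * Causal curves and their profiles *)

Section Profile.
Variable R : realType.
Local Notation mu := (@lebesgue_measure R).
Local Notation distR := (@distR R).

(** Having [I x] in the conclusion packs openness of [I] and continuity of [f] together. *)
Definition cont_on (I : set R) (f : R -> R) := forall t, I t -> forall e, 0 < e ->
  exists2 c, 0 < c & forall x, `|x - t| < c -> I x /\ `|f x - f t| < e.

Lemma cont_onP (I : set R) (f : R -> R) :
  open_interval I -> {within I, continuous f} -> cont_on I f.
Proof.
move=> [a [b [_ IE]]] fI t It e e0.
have oI : open I.
  have -> : I = [set t | (a < t%:E)%E] `&` [set t | (t%:E < b)%E] by rewrite IE.
  by apply: openI; [exact: open_ereal_gt|exact: open_ereal_lt].
have /cvgrPdist_lt/(_ _ e0) H1 : f x @[x --> t] --> f t.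
  move: fI; rewrite continuous_open_subspace// => /(_ t); apply.
  by rewrite inE.
have H2 : \forall x \near t, I x by apply: open_nbhs_nbhs.
have : \forall x \near t, I x /\ `|f t - f x| < e by exact: filterI.
move=> /nbhs_ballP[c /= c0 Hc].
exists c => // x xt; have [|h1 h2] := Hc x; first by rewrite /ball/= distrC.
by split => //; rewrite distrC.
Qed.

(* A causal curve (al, be) is recorded by its time function al, an arc length ph
   dominating the fibre component be and an accumulated proper time La: causality and
   length become La'^2 + f(al)^2 ph'^2 <= al'^2, with no integral left. *)
Definition profile (strict : bool) (I : set R) (f al ph La : R -> R) (a b : R) : Prop :=
  [/\ a < b, forall t, a <= t <= b -> I (al t),
    [/\ abs_cont distR al a b, abs_cont distR ph a b & abs_cont distR La a b],
    [/\ forall s t, a <= s -> s < t -> t <= b -> al s < al t,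
        forall s t, a <= s -> s <= t -> t <= b -> ph s <= ph t &
        forall s t, a <= s -> s <= t -> t <= b -> La s <= La t] &
    aeo a b (fun t => exists p q r,
      [/\ deriv_at al t p, deriv_at ph t q, deriv_at La t r, [/\ 0 < p, 0 <= q & 0 <= r] &
          r ^+ 2 + (f (al t) * q) ^+ 2 <= p ^+ 2 /\ (strict -> f (al t) * q < p)])].

Section of_curve.
Variables (strict : bool) (I : set R) (f : R -> R) (X : Type) (d : X -> X -> R)
  (gm : R -> R * X) (a b : R).
Hypotheses (dm : is_metric d) (fc : cont_on I f) (f0 : forall t, I t -> 0 < f t)
  (gc : cone_curve strict I f d gm a b).
Let al t := (gm t).1.
Let be t := (gm t).2.

Lemma cone_curve_ac : abs_cont distR al a b /\ abs_cont d be a b.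
Proof.
have [ab [_ [ac _]]] := gc; have [d0 _] := dm.
split; apply: abs_cont_le ler01 _ ac => s t _ _ _; rewrite mul1r /coneD.
  by rewrite /distR lerDl.
by rewrite lerDr.
Qed.

(** The definition allows either direction of monotonicity; one point with positive derivative,
    supplied by the almost-everywhere condition, excludes the decreasing one. *)
Lemma cone_curve_mono s t : a <= s -> s < t -> t <= b -> al s < al t.
Proof.
have [ab [_ [_ [mono [_ /aeo_ae/(aeo_ex ab)]]]]] := gc.
case: mono => [H _|H]; first exact: H.
move=> [x /andP[ax xb] [dal p0]] as_ st tb; exfalso.
have : deriv_at al x (derive1 al x) by apply/deriv_at_derive1.
set p := derive1 al x in p0 *.
have p20 : 0 < p / 2 by lra.
move=> /(_ _ p20)[c c0 Hc].
pose h := Num.min (c / 2) (b - x).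
have h0 : 0 < h by rewrite lt_min subr_gt0 xb andbT; lra.
have hc : h < c by rewrite gt_min; apply/orP; left; lra.
have hb : h <= b - x by rewrite ge_min lexx orbT.
have := Hc h; rewrite (gtr0_norm h0) => /(_ hc).
have : al (x + h) < al x by apply: H => //; [exact: ltW|rewrite ltrDl|lra].
rewrite ler_norml => h1 /andP[h2 _]; have : 0 < p / 2 * h by rewrite mulr_gt0.
lra.
Qed.

(** [ph] and [La] are the primitives of the fibre speed and of the integrand of the length. Both are
    dominated by the derivative of [al], the fibre speed with constant [1 / m] for [m] the minimum
    of [f] along the curve, so [ac_primitive] yields them. *)
Lemma cone_curve_profile : exists ph La, [/\ profile strict I f al ph La a b,
  forall s t, a <= s -> s <= t -> t <= b -> d (be s) (be t) <= ph t - ph s,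
  aeo a b (fun t => deriv_at La t
    (Num.sqrt (derive1 al t ^+ 2 - f (al t) ^+ 2 * mderiv d be t ^+ 2))) &
  cone_len f d gm a b = (La b - La a)%:E].
Proof.
have [ab [gI [_ [_ [/aeo_ae ae1 /aeo_ae ae2]]]]] := gc.
have [acal acbe] := cone_curve_ac.
have alle s t : a <= s -> s <= t -> t <= b -> al s <= al t.
  move=> as_; rewrite le_eqVlt => /predU1P[->//|st] tb; apply: ltW.
  exact: cone_curve_mono.
have [N [mN N0 HN]] := aeo_and ae1 ae2.
pose E : set R := `]a, b[ `\` N.
have mE : measurable E by exact: measurableD.
have Eab t : E t -> a < t < b by move=> []; rewrite /= in_itv.
have aeE : aeo a b E by exists N; split => // t tab Nt; split => //=; rewrite in_itv.
pose p t := derive1 al t; pose v t := mderiv d be t.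
have EP t : E t -> [/\ deriv_at al t (p t), mder_at d be t (v t), 0 < p t, 0 <= v t &
    f (al t) ^+ 2 * v t ^+ 2 <= p t ^+ 2 /\ (strict -> f (al t) ^+ 2 * v t ^+ 2 < p t ^+ 2)].
  move=> [tab Nt]; have [|[dal [w [/(mder_atP _ _ _ dm) wP Hw]]] [_ p0]] := HN t _ Nt.
    by move: tab; rewrite /= in_itv.
  have wE : v t = w by exact: mderivE.
  split => //.
  - exact/deriv_at_derive1.
  - by rewrite wE.
  - by rewrite wE; exact: mder_ge0 wP.
  - by rewrite wE; move: Hw; case: strict => Hw; split => //; rewrite /p /al; lra.
have mp : measurable_fun E p.
  apply: (measurable_mder (@distR_metric R) ab acal mE Eab) => t /EP[h1 _ h2 _ _].
  by apply: deriv_at_mder => //; exact: ltW.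
have mv : measurable_fun E v.
  by apply: (measurable_mder dm ab acbe mE Eab) => t /EP[].
pose fa x := f (al (clip a b x)).
have cfa : continuous fa.
  move=> t; apply/cvgrPdist_lt => e e0.
  have [c c0 Hc] := fc (gI _ (clip_itv t (ltW ab))) e0.
  have [c' c'0 Hc'] := clip_cont (@distR_metric R) (ltW ab) acal t c0.
  apply/nbhs_ballP; exists c' => //= x; rewrite /ball/= distrC => /Hc' xc.
  by rewrite distrC; exact: (Hc _ xc).2.
have mf : measurable_fun E (fun t => f (al t)).
  apply: (@eq_measurable_fun _ _ _ _ _ fa).
    by move=> t /set_mem/Eab/andP[/ltW h1 /ltW h2]; rewrite /fa clip_id.
  by apply: measurable_funTS; exact: continuous_measurable_fun.
have [m m0 Hm] : exists2 m, 0 < m & forall t, E t -> m <= f (al t).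
  have [|c cab Hc] := EVT_min (ltW ab) (f := fa).
    exact: continuous_subspaceT.
  exists (fa c); first by apply: f0; apply: gI; exact: clip_itv (ltW ab).
  move=> t /Eab/andP[/ltW h1 /ltW h2]; have := Hc t; rewrite in_itv/= h1 h2 => /(_ isT).
  by rewrite {2}/fa clip_id.
pose g t := Num.sqrt (p t ^+ 2 - f (al t) ^+ 2 * v t ^+ 2).
have mg : measurable_fun E g.
  apply: (@measurableT_comp _ _ _ _ _ _ (@Num.sqrt R)).
    by apply: continuous_measurable_fun; exact: sqrt_continuous.
  apply: measurable_funB; first exact: measurable_funX.
  by apply: measurable_funM; exact: measurable_funX.
have g0 t : 0 <= g t by exact: sqrtr_ge0.
have g2 t : E t -> g t ^+ 2 = p t ^+ 2 - f (al t) ^+ 2 * v t ^+ 2.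
  by move=> /EP[_ _ _ _ [h _]]; rewrite sqr_sqrtr// subr_ge0.
have gp t : E t -> g t <= p t.
  move=> Et; have [_ _ p0 _ _] := EP t Et.
  rewrite -(ler_pXn2r (n := 2)) ?nnegrE//; last exact: ltW.
  by rewrite g2// gerBl mulr_ge0// sqr_ge0.
have [|||ph [acph ndph dph _]] := @ac_primitive R a b m^-1 al v E ab _ acal alle mE Eab aeE mv.
- by rewrite invr_ge0 ltW.
- by move=> t /EP[].
- move=> t Et; have [h1 h2 p0 v0 [h3 _]] := EP t Et; exists (p t) => //.
  rewrite mulrC ler_pdivlMr//.
  have mle := Hm _ Et; have [/ltW m1 /ltW p1] := (m0, p0).
  rewrite -(ler_pXn2r (n := 2)) ?nnegrE ?mulr_ge0// exprMn mulrC.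
  apply: le_trans h3; rewrite ler_wpM2r ?sqr_ge0//.
  by rewrite ler_pXn2r// nnegrE; exact: le_trans mle.
have [||La [acLa ndLa dLa iLa]] := @ac_primitive R a b 1 al g E ab ler01 acal alle mE Eab aeE mg.
- by move=> t _.
- by move=> t Et; have [h1 _ _ _ _] := EP t Et; exists (p t) => //; rewrite mul1r gp.
exists ph, La; split.
- split => //; first by split => //; exact: cone_curve_mono.
  have H := aeo_and aeE (aeo_and dph dLa); apply: aeo_mono H => t _ [Et [h1 h2]].
  have [h3 h4 p0 v0 [h5 h6]] := EP t Et.
  exists (p t), (v t), (g t); split => //; rewrite g2// exprMn; split; first lra.
  have p1 := ltW p0; move=> /h6; rewrite -exprMn ltr_pXn2r// ?nnegrE//.
  by apply: mulr_ge0 => //; apply: ltW; apply: lt_le_trans (Hm _ Et).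
- move=> s t as_ st tb; apply: ac_dist_le => //.
  + exact: abs_cont_sub acbe.
  + by move=> x y sx xy yt; apply: ndph => //; [exact: le_trans sx|exact: le_trans tb].
  + have H := aeo_sub as_ tb (aeo_and aeE dph); apply: aeo_mono H => x _ [Ex h].
    by have [_ h1 _ _ _] := EP x Ex; exists (v x), (v x).
- exact: dLa.
- by rewrite -iLa /cone_len; exact: integral_full.
Qed.

End of_curve.
End Profile.

(** * Curves built from profiles, and scaling of profiles *)

Section ProfileOps.
Variable R : realType.
Local Notation mu := (@lebesgue_measure R).
Local Notation distR := (@distR R).

Lemma abs_contD (X Y Z : Type) (dX : X -> X -> R) (dY : Y -> Y -> R) (dZ : Z -> Z -> R) g h k a b :
  (forall s t, a <= s -> s <= t -> t <= b -> dZ (k s) (k t) <= dX (g s) (g t) + dY (h s) (h t)) ->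
  abs_cont dX g a b -> abs_cont dY h a b -> abs_cont dZ k a b.
Proof.
move=> H Hg Hh e e0; have e20 : 0 < e / 2 by lra.
have [c [c0 Hc]] := Hg _ e20; have [c' [c'0 Hc']] := Hh _ e20.
exists (Num.min c c'); split; first by rewrite lt_min c0.
move=> n s t H1 H2; rewrite lt_min => /andP[/(Hc _ _ _ H1 H2) h1 /(Hc' _ _ _ H1 H2) h2].
apply: (@le_lt_trans _ _ (\sum_(i < n) (dX (g (s i)) (g (t i)) + dY (h (s i)) (h (t i))))).
  by apply: ler_sum => i _; have [? [? ?]] := H1 i (ltn_ord i); exact: H.
by rewrite big_split/=; lra.
Qed.

Lemma mder_local X Y (d : X -> X -> R) (d' : Y -> Y -> R) g g' a b t v : a < t < b ->
  (forall s, a <= s <= b -> d' (g' s) (g' t) = d (g s) (g t)) ->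
  mder_at d g t v -> mder_at d' g' t v.
Proof.
move=> /andP[ta tb] H Hv e e0; have [c c0 Hc] := Hv _ e0.
exists (Num.min c (Num.min (t - a) (b - t))).
  by rewrite !lt_min c0 !subr_gt0 ta.
move=> h; rewrite !lt_min => /and3P[hc h1 h2]; rewrite H; first exact: Hc.
by move: h1 h2; rewrite !ltr_norml => /andP[h1 _] /andP[_ h2]; apply/andP; split; lra.
Qed.

Lemma ac_nd_le (F G : R -> R) a b : a <= b -> abs_cont distR F a b ->
  (forall s t, a <= s -> s <= t -> t <= b -> G s <= G t) ->
  aeo a b (fun t => exists p q, [/\ deriv_at F t p, deriv_at G t q & 0 <= p <= q]) ->
  F b - F a <= G b - G a.
Proof.
move=> ab acF ndG H; apply: le_trans (ler_norm _) _; rewrite distrC.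
apply: (@ac_dist_le R _ distR F G) => //; first exact: distR_metric.
apply: aeo_mono H => t _ [p [q [h1 h2 /andP[p0 pq]]]]; exists p, q; split => //.
exact: deriv_at_mder.
Qed.

Section to_curve.
Variables (strict : bool) (I : set R) (f al ph La : R -> R) (a b : R).
Variables (W : Type) (dW : W -> W -> R) (sg : R -> W) (w w' : W).
Hypotheses (dm : is_metric dW) (fc : cont_on I f) (f0 : forall t, I t -> 0 < f t)
  (pr : profile strict I f al ph La a b) (gs : geod_seg dW sg w w')
  (dww : dW w w' = ph b - ph a).
(** The fibre geodesic, run so that [ph] measures its arc length. If [w = w'] the quotient is 0 by
    the convention on division by zero, and [be] is constant. *)
Let be t := sg ((ph t - ph a) / dW w w').
Let gm t := (al t, be t).

Let dbe s t : a <= s <= b -> a <= t <= b -> dW (be s) (be t) = `|ph s - ph t|.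
Proof.
have [ab _ _ [_ ndph _] _] := pr.
have ba : a <= b by exact: ltW.
have B s1 : a <= s1 <= b -> ph a <= ph s1 <= ph b.
  by move=> /andP[h1 h2]; rewrite !ndph// lexx.
move=> /B/andP[s1 s2] /B/andP[t1 t2]; rewrite /be.
have [D0|D0] := eqVneq (ph b) (ph a).
  have -> : ph s = ph a by lra.
  have -> : ph t = ph a by lra.
  rewrite subrr mul0r normr0 gs.2.2 ?lexx ?ler01//.
  by rewrite subrr normr0 mul0r.
have Dp : 0 < ph b - ph a by rewrite subr_gt0 lt_neqAle eq_sym D0; lra.
rewrite gs.2.2 dww; last 2 first.
- by rewrite divr_ge0 ?ler_pdivrMr//; lra.
- by rewrite divr_ge0 ?ler_pdivrMr//; lra.
rewrite -mulrBl normrM [`|_^-1|]gtr0_norm ?invr_gt0// divfK ?gt_eqF//.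
by rewrite opprB addrA subrK.
Qed.

Lemma profile_curve_ends : gm a = (al a, w) /\ gm b = (al b, w').
Proof.
rewrite /gm /be subrr mul0r gs.1; split => //; rewrite -dww.
have [D0|D0] := eqVneq (dW w w') 0; last by rewrite divff// gs.2.1.
by rewrite D0 mul0r gs.1; congr pair; apply/dm.2.1.
Qed.

Let mde t q : a < t < b -> 0 <= q -> deriv_at ph t q -> mder_at dW be t q.
Proof.
move=> tab q0 /(deriv_at_mder q0); apply: (mder_local tab) => s sab.
by apply: dbe => //; move/andP: tab => [/ltW-> /ltW->].
Qed.

Lemma profile_curve : cone_curve strict I f dW gm a b /\
  ((La b - La a)%:E <= cone_len f dW gm a b)%E.
Proof.
have [ab alI [acal acph acLa] [ial ndph ndLa] ae] := pr.
have C : cone_curve strict I f dW gm a b.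
  split => //; split => //; split.
    apply: abs_contD acal acph => s t as_ st tb; rewrite /coneD/= dbe//; apply/andP; split => //.
      exact: le_trans tb.
    exact: le_trans st.
  split; first by left.
  split; apply/aeo_ae; apply: aeo_mono ae => t tab [p [q [r [hp hq hr [p0 q0 r0] [h1 h2]]]]].
    have [dal alp] := (deriv_at_derive1 al t p).2 hp.
    split => //; exists q; split; first by apply/(mder_atP _ _ _ dm); exact: mde.
    rewrite alp/= -exprMn.
    have fq : 0 <= f (al t) * q.
      by apply: mulr_ge0 => //; apply/ltW/f0/alI; case/andP: tab => /ltW-> /ltW->.
    have := sqr_ge0 r; case: strict h2 => [/(_ isT) h2|_] r2; last lra.
    have : (f (al t) * q) ^+ 2 < p ^+ 2 by rewrite ltr_pXn2r// nnegrE// ltW.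
    lra.
  by have [dal alp] := (deriv_at_derive1 al t p).2 hp; rewrite alp.
split => //.
(* The length of the new curve is itself the increment of a primitive [La'], so it is compared with
   [La] through derivatives. Only an inequality results, since a profile only bounds [La] from
   above. *)
have [ph' [La' [[_ _ [_ _ acLa'] [_ _ ndLa'] _] _ dLa' ->]]] := cone_curve_profile dm fc f0 C.
rewrite lee_fin; apply: ac_nd_le => //; first exact: ltW.
apply: aeo_mono (aeo_and ae dLa') => t tab [[p [q [r [hp hq hr [p0 q0 r0] [h1 _]]]]] h2].
exists r; eexists; split; [exact: hr|exact: h2|].
rewrite r0/=.
have [_ ->] := (deriv_at_derive1 al t p).2 hp.
rewrite (mderivE dm (mde tab q0 hq)) -[leLHS](ger0_norm r0) -sqrtr_sqr ler_wsqrtr//.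
by rewrite -exprMn; lra.
Qed.

End to_curve.

(** Pointwise, [(r, f q)] and [(p, 0)] lie in the disc of radius [p], hence so does their convex
    combination with weights [l] and [1 - l]. *)
Lemma profile_scale strict (I : set R) (f al ph La : R -> R) (a b l : R) :
  (forall t, I t -> 0 < f t) ->
  profile strict I f al ph La a b -> 0 <= l <= 1 ->
  profile strict I f al (fun t => l * ph t) (fun t => l * La t + (1 - l) * al t) a b.
Proof.
move=> f0 [ab alI [acal acph acLa] [ial ndph ndLa] ae] /andP[l0 l1].
have l2 : 0 <= 1 - l by lra.
have acs F c : 0 <= c -> abs_cont distR F a b -> abs_cont distR (fun t => c * F t) a b.
  move=> c0; apply: (abs_cont_le c0) => s t _ _ _.
  by rewrite /distR -mulrBr normrM (ger0_norm c0).
split => //.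
- split => //; first exact: acs.
  apply: abs_contD (acs _ _ l0 acLa) (acs _ _ l2 acal) => s t _ _ _.
  by rewrite /distR opprD addrACA ler_normD.
- split => // s t as_ st tb; first by rewrite ler_wpM2l// ndph.
  apply: lerD; rewrite ler_wpM2l ?ndLa//.
  by move: st; rewrite le_eqVlt => /predU1P[->//|st]; apply: ltW; exact: ial.
- apply: aeo_mono ae => t tab [p [q [r [hp hq hr [p0 q0 r0] [h1 h2]]]]].
  have fp : 0 < f (al t) by apply/f0/alI; case/andP: tab => /ltW-> /ltW->.
  have fq : 0 <= f (al t) * q by rewrite mulr_ge0// ltW.
  exists p, (l * q), (l * r + (1 - l) * p); split => //.
  + exact: deriv_atZ.
  + by apply: deriv_atD; exact: deriv_atZ.
  + by split => //; [exact: mulr_ge0|apply: addr_ge0; apply: mulr_ge0 => //; exact: ltW].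
  + have rp : r <= p.
      rewrite -(ler_pXn2r (n := 2)) ?nnegrE ?(ltW p0)//.
      by have := sqr_ge0 (f (al t) * q); lra.
    have E : (f (al t) * (l * q)) = l * (f (al t) * q) by ring.
    rewrite E; split; last first.
      move=> /h2 h3; have : l * (f (al t) * q) <= 1 * (f (al t) * q) by rewrite ler_wpM2r.
      lra.
    have h3 : l ^+ 2 * (r ^+ 2 + (f (al t) * q) ^+ 2) <= l ^+ 2 * p ^+ 2.
      by rewrite ler_wpM2l// sqr_ge0.
    have h4 : 2 * (l * (1 - l)) * p * r <= 2 * (l * (1 - l)) * p * p.
      by rewrite ler_wpM2l//; apply: mulr_ge0; [apply: mulr_ge0 => //; apply: mulr_ge0|exact: ltW].
    have -> : (l * r + (1 - l) * p) ^+ 2 + (l * (f (al t) * q)) ^+ 2 =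
      l ^+ 2 * (r ^+ 2 + (f (al t) * q) ^+ 2) + 2 * (l * (1 - l)) * p * r + (1 - l) ^+ 2 * p ^+ 2.
      by ring.
    have E2 : p ^+ 2 = l ^+ 2 * p ^+ 2 + 2 * (l * (1 - l)) * p * p + (1 - l) ^+ 2 * p ^+ 2.
      by ring.
    by rewrite [leRHS]E2 lerD2r lerD.
Qed.

(* Cauchy-Schwarz in the form c La' + s m ph' <= al' with (c, s) the unit vector
   in the direction of (La b - La a, m (ph b - ph a)). *)
Lemma profile_bound strict (I : set R) (f al ph La : R -> R) (a b m : R) :
  0 <= m -> (forall t, a <= t <= b -> m <= f (al t)) ->
  profile strict I f al ph La a b ->
  (La b - La a) ^+ 2 + (m * (ph b - ph a)) ^+ 2 <= (al b - al a) ^+ 2.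
Proof.
move=> m0 mf [ab alI [acal acph acLa] [ial ndph ndLa] ae].
have ba : a <= b by exact: ltW.
set A := al b - al a; set B := ph b - ph a; set C := La b - La a.
have A0 : 0 <= A by rewrite subr_ge0 ltW// ial.
have B0 : 0 <= B by rewrite subr_ge0 ndph.
have C0 : 0 <= C by rewrite subr_ge0 ndLa.
have mB0 : 0 <= m * B by exact: mulr_ge0.
set H := C ^+ 2 + (m * B) ^+ 2.
have H0 : 0 <= H by apply: addr_ge0; exact: sqr_ge0.
have nd0 c F : 0 <= c -> (forall s t, a <= s -> s <= t -> t <= b -> F s <= F t) ->
    forall s t, a <= s -> s <= t -> t <= b -> c * F s <= c * F t.
  by move=> c0 h s t *; rewrite ler_wpM2l// h.
have acs F c : 0 <= c -> abs_cont distR F a b -> abs_cont distR (fun t => c * F t) a b.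
  move=> c0; apply: (abs_cont_le c0) => s t _ _ _.
  by rewrite /distR -mulrBr normrM (ger0_norm c0).
(* The direction vector is kept unnormalized, with length [S] and [S ^+ 2 = H], so the estimate
   comes out multiplied by [H]. *)
suff : H ^+ 2 <= H * A ^+ 2.
  have [->|Hn] := eqVneq H 0; first by rewrite sqr_ge0.
  by rewrite expr2 ler_pM2l// lt_neqAle eq_sym Hn.
pose S := Num.sqrt H.
have S0 : 0 <= S by exact: sqrtr_ge0.
have S2 : S ^+ 2 = H by rewrite sqr_sqrtr.
have K0 : 0 <= m * (m * B) by exact: mulr_ge0.
have : H <= S * A.
  have -> : H = (C * La b + m * (m * B) * ph b) - (C * La a + m * (m * B) * ph a).
    by rewrite /H /C /B; ring.
  have -> : S * A = S * al b - S * al a by rewrite mulrBr.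
  apply: (@ac_nd_le (fun t => C * La t + m * (m * B) * ph t) (fun t => S * al t)) => //.
  - apply: abs_contD (acs _ _ C0 acLa) (acs _ _ K0 acph) => s t _ _ _.
    by rewrite /distR opprD addrACA ler_normD.
  - apply: nd0 => // s t as_; rewrite le_eqVlt => /predU1P[->//|st tb]; apply: ltW; exact: ial.
  - apply: aeo_mono ae => t tab [p [q [r [hp hq hr [p0 q0 r0] [h1 _]]]]].
    exists (C * r + m * (m * B) * q), (S * p); split.
    + by apply: deriv_atD; exact: deriv_atZ.
    + exact: deriv_atZ.
    + rewrite addr_ge0 ?mulr_ge0//=.
      have mq : (m * q) ^+ 2 <= (f (al t) * q) ^+ 2.
        have mfq : m * q <= f (al t) * q.
          by rewrite ler_wpM2r// mf//; case/andP: tab => /ltW-> /ltW->.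
        have mq0 : 0 <= m * q by exact: mulr_ge0.
        by rewrite ler_pXn2r// nnegrE; exact: le_trans mfq.
      rewrite -(ler_pXn2r (n := 2)) ?nnegrE ?addr_ge0 ?mulr_ge0 ?(ltW p0)//.
      rewrite exprMn S2.
      apply: (@le_trans _ _ (H * (r ^+ 2 + (m * q) ^+ 2))); last first.
        by rewrite ler_wpM2l//; lra.
      (* Lagrange's identity for the defect in the Cauchy-Schwarz inequality. *)
      rewrite -subr_ge0 (_ : _ - _ = (C * (m * q) - m * B * r) ^+ 2) ?sqr_ge0//.
      by rewrite /H; ring.
move=> h; have SA : 0 <= S * A by exact: mulr_ge0.
have : H ^+ 2 <= (S * A) ^+ 2 by rewrite ler_pXn2r// nnegrE.
by rewrite exprMn S2.
Qed.

End ProfileOps.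

(** * Concatenation of profiles and restriction of curves *)

Section Concat.
Variable R : realType.
Local Notation mu := (@lebesgue_measure R).
Local Notation distR := (@distR R).

Lemma abs_cont_comp X (d : X -> X -> R) g (u : R -> R) a b a' b' :
  (forall x, a' <= x <= b' -> a <= u x <= b) ->
  (forall x y, x <= y -> u x <= u y <= u x + (y - x)) ->
  abs_cont d g a b -> abs_cont d (g \o u) a' b'.
Proof.
move=> ui ul ac e e0; have [c [c0 Hc]] := ac _ e0; exists c; split => // n s t H1 H2 H3.
apply: (Hc n (u \o s) (u \o t)) => /=.
- move=> i ni; have [h1 [h2 h3]] := H1 i ni.
  have /andP[k1 _] := ul _ _ h2.
  have /andP[k2 _] : a <= u (s i) <= b by apply: ui; rewrite h1 (le_trans h2).
  by have /andP[_ k3] : a <= u (t i) <= b by apply: ui; rewrite h3 (le_trans h1).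
- move=> i j ni nj ij; have [h|h] := H2 i j ni nj ij; [left|right].
    by have /andP[] := ul _ _ h.
  by have /andP[] := ul _ _ h.
- apply: le_lt_trans H3; apply: ler_sum => i _; have [_ [h _]] := H1 i (ltn_ord i).
  by have /andP[_] := ul _ _ h; lra.
Qed.

(** Translation invariance of Lebesgue measure, from its uniqueness given the lengths of half-open
    intervals. *)
Lemma null_translate (N : set R) (c : R) : measurable N -> mu N = 0%E ->
  measurable [set x | N (x - c)] /\ mu [set x | N (x - c)] = 0%E.
Proof.
move=> mN N0.
have mphi : measurable_fun setT (fun x : R => x - c).
  by apply: measurable_funB => //; exact: measurable_cst.
have mN' : measurable [set x | N (x - c)].
  by have := mphi measurableT N mN; rewrite setTI.
split=> //.
suff : pushforward mu (fun x => x - c : measurableTypeR R) N = mu N by rewrite N0.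
apply/esym/lebesgue_measure_unique => //= _ [[s t]] _ <-.
rewrite /pushforward (_ : _ @^-1` _ = `]s + c, t + c]%classic); last first.
  by apply/seteqP; split => x /=; rewrite !in_itv/= ltrBrDr lerBlDr.
by rewrite !lebesgue_measure_itv/= !lte_fin ltrD2r -!EFinB opprD addrACA subrr addr0.
Qed.

(** [F2] is moved to start at parameter [b1] and shifted by a constant to continue [F1]. As a sum of
    clipped functions, the result inherits absolute continuity and monotonicity term by term. *)
Definition glue (a1 b1 a2 b2 : R) (F1 F2 : R -> R) (t : R) : R :=
  F1 (clip a1 b1 t) + (F2 (clip a2 b2 (t - (b1 - a2))) - F2 a2).

Lemma glueS a1 b1 a2 b2 F1 F2 : a1 <= b1 -> a2 <= b2 ->
  glue a1 b1 a2 b2 F1 F2 a1 = F1 a1 /\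
  glue a1 b1 a2 b2 F1 F2 (b1 + (b2 - a2)) = F1 b1 + (F2 b2 - F2 a2).
Proof.
move=> h1 h2; rewrite /glue /clip.
have -> : b1 + (b2 - a2) - (b1 - a2) = b2 by ring.
rewrite minxx (min_l h1) maxxx (max_r h2); split.
  rewrite min_l; last lra.
  by rewrite max_l; [rewrite subrr addr0|lra].
by rewrite min_r; [rewrite (max_r h1)|lra].
Qed.

Lemma glue_ac a1 b1 a2 b2 F1 F2 a b : a1 <= b1 -> a2 <= b2 ->
  abs_cont distR F1 a1 b1 -> abs_cont distR F2 a2 b2 ->
  abs_cont distR (glue a1 b1 a2 b2 F1 F2) a b.
Proof.
move=> h1 h2 ac1 ac2.
have ac1' : abs_cont distR (F1 \o clip a1 b1) a b.
  by apply: abs_cont_comp ac1 => *; [exact: clip_itv|exact: clip_lip].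
have ac2' : abs_cont distR (F2 \o (fun t => clip a2 b2 (t - (b1 - a2)))) a b.
  apply: abs_cont_comp ac2 => [x _|x y xy]; first exact: clip_itv.
  have := @clip_lip _ a2 b2 (x - (b1 - a2)) (y - (b1 - a2)) h2.
  rewrite lerD2r => /(_ xy) /andP[-> /= h]; apply: le_trans h _.
  by rewrite lerD2l; lra.
have H (u v u' v' w : R) :
    `|u + (v - w) - (u' + (v' - w))| <= `|u - u'| + `|v - v'|.
  have -> : u + (v - w) - (u' + (v' - w)) = (u - u') + (v - v') by ring.
  exact: ler_normD.
by apply: abs_contD ac1' ac2' => s t _ _ _; exact: H.
Qed.

Lemma glue_nd a1 b1 a2 b2 (F1 F2 : R -> R) : a1 <= b1 -> a2 <= b2 ->
  (forall s t, a1 <= s -> s <= t -> t <= b1 -> F1 s <= F1 t) ->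
  (forall s t, a2 <= s -> s <= t -> t <= b2 -> F2 s <= F2 t) ->
  forall s t, s <= t -> glue a1 b1 a2 b2 F1 F2 s <= glue a1 b1 a2 b2 F1 F2 t.
Proof.
move=> h1 h2 nd1 nd2 s t st.
have /andP[l1 _] := clip_lip h1 st.
have /andP[l2 _] : clip a2 b2 (s - (b1 - a2)) <= clip a2 b2 (t - (b1 - a2)) <=
    clip a2 b2 (s - (b1 - a2)) + (t - (b1 - a2) - (s - (b1 - a2))).
  by apply: clip_lip => //; rewrite lerD2r.
have /andP[k1 _] := clip_itv s h1; have /andP[_ k2] := clip_itv t h1.
have /andP[k3 _] := clip_itv (s - (b1 - a2)) h2; have /andP[_ k4] := clip_itv (t - (b1 - a2)) h2.
by apply: lerD; [exact: nd1|rewrite lerD2r; exact: nd2].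
Qed.

Lemma deriv_at_local (F G : R -> R) t a b k p : a < t < b ->
  (forall x, a < x < b -> G x = F x + k) -> deriv_at F t p -> deriv_at G t p.
Proof.
move=> tab H Hv e e0; have [c c0 Hc] := Hv _ e0; have /andP[ta tb] := tab.
exists (Num.min c (Num.min (t - a) (b - t))).
  by rewrite !lt_min c0 !subr_gt0 ta.
move=> h; rewrite !lt_min => /and3P[hc h1 h2]; rewrite (H t)// H; last first.
  by move: h1 h2; rewrite !ltr_norml => /andP[h1 _] /andP[_ h2]; apply/andP; split; lra.
have -> : F (t + h) + k - (F t + k) - p * h = F (t + h) - F t - p * h by ring.
exact: Hc.
Qed.

Lemma deriv_at_shift (F : R -> R) t c p :
  deriv_at F (t - c) p -> deriv_at (fun x => F (x - c)) t p.
Proof.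
move=> H e e0; have [c0 c00 Hc] := H _ e0; exists c0 => // h /Hc.
by rewrite (addrAC t (- c) h).
Qed.

Lemma glue_lt a1 b1 a2 b2 F1 F2 x : a1 <= b1 -> a2 <= b2 -> a1 < x < b1 ->
  glue a1 b1 a2 b2 F1 F2 x = F1 x + 0.
Proof.
move=> h1 h2 /andP[/ltW x1 /ltW x2]; rewrite /glue clip_id// /clip min_l; last lra.
by rewrite max_l; [rewrite subrr addr0|lra].
Qed.

Lemma glue_gt a1 b1 a2 b2 F1 F2 x : a1 <= b1 -> a2 <= b2 -> b1 < x < b1 + (b2 - a2) ->
  glue a1 b1 a2 b2 F1 F2 x = F2 (x - (b1 - a2)) + (F1 b1 - F2 a2).
Proof.
move=> h1 h2 /andP[/ltW x1 /ltW x2]; rewrite /glue (@clip_id _ a2 b2); try lra.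
rewrite /clip min_r; last lra.
by rewrite max_r//; ring.
Qed.

Lemma profile_concat strict (I : set R) (f al1 ph1 La1 al2 ph2 La2 : R -> R) (a1 b1 a2 b2 : R) :
  profile strict I f al1 ph1 La1 a1 b1 -> profile strict I f al2 ph2 La2 a2 b2 ->
  al1 b1 = al2 a2 ->
  let gl := glue a1 b1 a2 b2 in
  profile strict I f (gl al1 al2) (gl ph1 ph2) (gl La1 La2) a1 (b1 + (b2 - a2)).
Proof.
move=> [ab1 alI1 [acal1 acph1 acLa1] [ial1 ndph1 ndLa1] ae1].
move=> [ab2 alI2 [acal2 acph2 acLa2] [ial2 ndph2 ndLa2] ae2] E gl.
have [ba1 ba2] := (ltW ab1, ltW ab2).
have ndal1 s t : a1 <= s -> s <= t -> t <= b1 -> al1 s <= al1 t.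
  by move=> ?; rewrite le_eqVlt => /predU1P[->//|? ?]; apply: ltW; exact: ial1.
have ndal2 s t : a2 <= s -> s <= t -> t <= b2 -> al2 s <= al2 t.
  by move=> ?; rewrite le_eqVlt => /predU1P[->//|? ?]; apply: ltW; exact: ial2.
split.
- by lra.
- move=> t /andP[ta tb]; rewrite /gl /glue -E; have [tb1|/ltW tb1] := leP t b1.
    rewrite clip_id// /clip (_ : Num.max _ _ = a2); last first.
      by rewrite min_l; [rewrite max_l//; lra|lra].
    by rewrite E subrr addr0; apply: alI1; rewrite ta.
  rewrite (@clip_id _ a2 b2); try lra.
  rewrite /clip min_r// max_r// addrC subrK; apply: alI2; lra.
- by split; apply: glue_ac.
- split; [|by move=> s t _ st _; exact: glue_nd|by move=> s t _ st _; exact: glue_nd].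
  move=> s t as_ st tb; have st' := ltW st.
  have [sb|sb] := ltP s b1.
    apply: ltr_leD.
      have /andP[_ h] := clip_itv t ba1.
      apply: ial1 => //; rewrite clip_id// ?ltW//.
      by rewrite /clip lt_max lt_min st sb orbT.
    rewrite lerB//; apply: ndal2.
    + by have /andP[] := clip_itv (s - (b1 - a2)) ba2.
    + have := @clip_lip _ a2 b2 (s - (b1 - a2)) (t - (b1 - a2)) ba2.
      by rewrite lerD2r => /(_ st')/andP[].
    + by have /andP[] := clip_itv (t - (b1 - a2)) ba2.
  have tb1 : b1 <= t by exact: le_trans st'.
  rewrite /gl /glue /clip !(@min_r _ _ _ b1)// ltrD2l ltrD2r.
  rewrite -!/(clip _ _ _) !clip_id; try lra.
  by apply: ial2; lra.
- have [N1 [mN1 N10 H1]] := ae1; have [N2 [mN2 N20 H2]] := ae2.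
  have [mN3 N30] := null_translate (b1 - a2) mN2 N20.
  (* The junction [b1], where one-sided slopes may differ, joins the exceptional set. *)
  exists (N1 `|` ([set x | N2 (x - (b1 - a2))] `|` [set b1])); split.
  + by apply: measurableU => //; apply: measurableU.
  + have h : mu ([set x | N2 (x - (b1 - a2))] `|` [set b1]) = 0%E.
      by rewrite measureU0//; exact: lebesgue_measure_set1.
    by rewrite measureU0//; exact: measurableU.
  + move=> t /andP[ta tb] /not_orP[n1 /not_orP[n2 /eqP n3]].
    have [tb1|tb1|tb1] := ltgtP t b1; last by rewrite tb1 eqxx in n3.
      have tab : a1 < t < b1 by rewrite ta.
      have [p [q [r [hp hq hr h3 h4]]]] := H1 t tab n1.
      exists p, q, r; split => //.
      * by apply: deriv_at_local tab _ hp => x; exact: glue_lt.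
      * by apply: deriv_at_local tab _ hq => x; exact: glue_lt.
      * by apply: deriv_at_local tab _ hr => x; exact: glue_lt.
      * by rewrite /gl glue_lt// addr0.
    have tab : b1 < t < b1 + (b2 - a2) by rewrite tb1.
    have tab2 : a2 < t - (b1 - a2) < b2 by lra.
    have [p [q [r [hp hq hr h3 h4]]]] := H2 _ tab2 n2.
    exists p, q, r; split => //.
    * by apply: deriv_at_local tab _ (deriv_at_shift hp) => x; exact: glue_gt.
    * by apply: deriv_at_local tab _ (deriv_at_shift hq) => x; exact: glue_gt.
    * by apply: deriv_at_local tab _ (deriv_at_shift hr) => x; exact: glue_gt.
    * by rewrite /gl glue_gt// E subrr addr0.
Qed.

Lemma cone_curve_sub strict (I : set R) (f : R -> R) X (d : X -> X -> R) gm a b s t :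
  a <= s -> s < t -> t <= b ->
  cone_curve strict I f d gm a b -> cone_curve strict I f d gm s t.
Proof.
move=> as_ st tb [ab [gI [ac [mono [/aeo_ae ae1 /aeo_ae ae2]]]]].
split => //; split.
  by move=> x /andP[sx xt]; apply: gI; rewrite (le_trans as_)//= (le_trans xt).
split; first exact: abs_cont_sub ac.
split.
  by case: mono => H; [left|right] => x y sx xy yt; apply: H => //;
    [exact: le_trans sx|exact: le_trans tb|exact: le_trans sx|exact: le_trans tb].
by split; apply/aeo_ae; [exact: aeo_sub ae1|exact: aeo_sub ae2].
Qed.

End Concat.

(** * Time separation in generalized cones *)

Section Tau.
Variable R : realType.
Local Notation distR := (@distR R).

Lemma ltau_ge (S : lstr R) g a b (x y : lpt S) : @lcausal R S g a b -> g a = x -> g b = y ->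
  (@llen R S g a b <= ltau x y)%E.
Proof.
move=> cg ga gb; rewrite /ltau ifT; last by apply/asboolP; exists g, a, b.
by apply: ereal_sup_ubound; exists g, a, b.
Qed.

Lemma ltau_le (S : lstr R) (x y : lpt S) c : (0 <= c)%E ->
  (forall g a b, @lcausal R S g a b -> g a = x -> g b = y -> (@llen R S g a b <= c)%E) ->
  (ltau x y <= c)%E.
Proof.
move=> c0 H; rewrite /ltau; case: ifPn => // _; apply: ge_ereal_sup => l.
by move=> [g [a [b [h1 [h2 [h3 ->]]]]]]; exact: H.
Qed.

Variables (I : set R) (f : R -> R).
Hypotheses (fc : cont_on I f) (f0 : forall t, I t -> 0 < f t).

Lemma ltau_cone_ge0 X (d : X -> X -> R) (x y : R * X) :
  (0 <= ltau (S := cone I f d) x y)%E.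
Proof.
rewrite /ltau; case: ifPn => // /asboolP[g [a [b [h1 [h2 h3]]]]].
apply: le_trans (ereal_sup_ubound _); last by exists g, a, b.
by rewrite /= /cone_len; apply: integral_ge0 => t _; rewrite lee_fin sqrtr_ge0.
Qed.

Section transfer.
Variables (Z W : Type) (dZ : Z -> Z -> R) (dW : W -> W -> R).
Hypotheses (mZ : is_metric dZ) (mW : is_metric dW).

(** Only the arc length of the fibre component enters a profile, so it can be scaled to the length
    of [sg] and run along [sg], even in another fibre. No proper time is lost, because proper time
    never exceeds elapsed time. *)
Lemma curve_transfer strict gm a b (w w' : W) sg : cone_curve strict I f dZ gm a b ->
  geod_seg dW sg w w' -> dW w w' <= dZ (gm a).2 (gm b).2 ->
  exists gm', [/\ cone_curve strict I f dW gm' a b, gm' a = ((gm a).1, w), gm' b = ((gm b).1, w') &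
    (cone_len f dZ gm a b <= cone_len f dW gm' a b)%E].
Proof.
move=> gc gs dle.
have [ph [La [pr dph _ ->]]] := cone_curve_profile mZ fc f0 gc.
have ab : a <= b by case: pr => /ltW.
have W0 : 0 <= dW w w' by case: mW.
have hL := dph a b (lexx _) ab (lexx _).
(* If [ph] is constant, [l] is 0 by convention, which is right because then [dW w w' = 0]. *)
pose l := dW w w' / (ph b - ph a).
have [l01 lE] : 0 <= l <= 1 /\ l * (ph b - ph a) = dW w w'.
  rewrite /l; have [L0|L0] := eqVneq (ph b - ph a) 0.
    by rewrite L0 invr0 mulr0 mul0r lexx ler01; split => //; lra.
  have Lp : 0 < ph b - ph a by rewrite lt_neqAle eq_sym L0; lra.
  by rewrite divr_ge0 ?ler_pdivrMr ?divfK//; lra.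
have pr' := profile_scale f0 pr l01.
have E : dW w w' = l * ph b - l * ph a by rewrite -mulrBr lE.
have [C len] := profile_curve mW fc f0 pr' gs E.
have [e1 e2] := profile_curve_ends (ph := fun t => l * ph t) (fun t => (gm t).1) mW gs E.
eexists; split; [exact: C|exact: e1|exact: e2|].
apply: le_trans len; rewrite lee_fin.
have [h1 h2 _ [h3 _ h4] _] := pr.
(* With [m = 0] the bound says that proper time is at most elapsed time. *)
have := @profile_bound _ _ _ _ _ _ _ _ _ 0 (lexx _) _ pr.
rewrite mul0r expr0n addr0 => B.
have {}B : La b - La a <= (gm b).1 - (gm a).1.
  rewrite -(ler_pXn2r (n := 2)) ?nnegrE ?subr_ge0 ?h4//; last by apply: ltW; exact: h3.
  by apply: B => t tab; apply/ltW/f0/h2.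
have : (1 - l) * (La b - La a) <= (1 - l) * ((gm b).1 - (gm a).1) by rewrite ler_wpM2l//; lra.
lra.
Qed.

Lemma ltau_mono t t' (z z' : Z) (w w' : W) sg : geod_seg dW sg w w' -> dW w w' <= dZ z z' ->
  (ltau (S := cone I f dZ) (t, z) (t', z') <= ltau (S := cone I f dW) (t, w) (t', w'))%E.
Proof.
move=> gs dle; apply: ltau_le; first exact: ltau_cone_ge0.
move=> g a b gc0 ga gb; have gc : cone_curve false I f dZ g a b := gc0.
have dle' : dW w w' <= dZ (g a).2 (g b).2 by rewrite ga gb.
have [g' [C' ga' gb' len]] := curve_transfer gc gs dle'.
apply: le_trans len _; apply: (@ltau_ge (cone I f dW)) => //.
  by rewrite ga' ga.
by rewrite gb' gb.
Qed.

Lemma lll_mono t t' (z z' : Z) (w w' : W) sg : geod_seg dW sg w w' -> dW w w' <= dZ z z' ->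
  lll (S := cone I f dZ) (t, z) (t', z') -> lll (S := cone I f dW) (t, w) (t', w').
Proof.
move=> gs dle [g [a [b [gc0 [ga gb]]]]].
have gc : cone_curve true I f dZ g a b := gc0.
have dle' : dW w w' <= dZ (g a).2 (g b).2 by rewrite ga gb.
have [g' [C' ga' gb' len]] := curve_transfer gc gs dle'.
exists g', a, b; split => //; split; first by rewrite ga' ga.
by rewrite gb' gb.
Qed.

End transfer.

Lemma ltau_transfer Z W (dZ : Z -> Z -> R) (dW : W -> W -> R) t t' (z z' : Z) (w w' : W) sg sg' :
  is_metric dZ -> is_metric dW ->
  geod_seg dZ sg z z' -> geod_seg dW sg' w w' -> dW w w' = dZ z z' ->
  ltau (S := cone I f dZ) (t, z) (t', z') = ltau (S := cone I f dW) (t, w) (t', w').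
Proof.
move=> mZ mW gZ gW E; apply/eqP; rewrite eq_le; apply/andP; split.
  by apply: (ltau_mono mZ mW _ _ gW); rewrite E.
by apply: (ltau_mono mW mZ _ _ gZ); rewrite E.
Qed.

Section segments.
Variables (Z : Type) (dZ : Z -> Z -> R).
Hypothesis mZ : is_metric dZ.

Lemma cone_curve_lt strict gm a b s t : cone_curve strict I f dZ gm a b ->
  a <= s -> s < t -> t <= b -> (gm s).1 < (gm t).1.
Proof. by move=> gc; exact: (cone_curve_mono gc). Qed.

Lemma cone_curve_le strict gm a b s t : cone_curve strict I f dZ gm a b ->
  a <= s -> s <= t -> t <= b -> (gm s).1 <= (gm t).1.
Proof.
move=> gc ?; rewrite le_eqVlt => /predU1P[->//|? ?]; apply: ltW.
exact: (cone_curve_lt gc).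
Qed.

Lemma cone_curve_dist strict gm a b m s t : cone_curve strict I f dZ gm a b -> 0 <= m ->
  (forall x, (gm a).1 <= x <= (gm b).1 -> m <= f x) ->
  a <= s -> s <= t -> t <= b -> m * dZ (gm s).2 (gm t).2 <= (gm t).1 - (gm s).1.
Proof.
move=> gc m0 mf as_; rewrite le_eqVlt => /predU1P[<- _|st tb].
  by have -> : dZ (gm s).2 (gm s).2 = 0 by [apply/mZ.2.1]; rewrite mulr0 subrr.
have gc' := cone_curve_sub as_ st tb gc.
have [ph [La [pr dph _ _]]] := cone_curve_profile mZ fc f0 gc'.
have B : forall x, s <= x <= t -> m <= f (gm x).1.
  move=> x /andP[sx xt]; apply: mf; apply/andP; split; apply: (cone_curve_le gc) => //; lra.
have := profile_bound m0 B pr.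
have dl := dph s t (lexx _) (ltW st) (lexx _).
have st1 := cone_curve_lt gc as_ st tb.
have mph : m * dZ (gm s).2 (gm t).2 <= m * (ph t - ph s) by rewrite ler_wpM2l.
have d0 : 0 <= dZ (gm s).2 (gm t).2 by case: mZ.
have := sqr_ge0 (La t - La s) => h1 h2.
apply: le_trans mph _; rewrite -(ler_pXn2r (n := 2)) ?nnegrE ?subr_ge0 ?(ltW st1)//; first lra.
by apply: mulr_ge0 => //; apply: le_trans dl.
Qed.

(** Stands in for a curve of fibre length at least [D] that realizes the proper time [T], which may
    exist only in the limit. The fibre points are forgotten, so pieces can be joined as soon as
    their times match. *)
Definition Seg (t0 t1 D T : R) := forall e, 0 < e -> exists al ph La a b,
  [/\ profile false I f al ph La a b, al a = t0, al b = t1,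
      D <= ph b - ph a & T - e <= La b - La a].

Lemma Seg_concat t0 t1 t2 D1 D2 T1 T2 : Seg t0 t1 D1 T1 -> Seg t1 t2 D2 T2 ->
  Seg t0 t2 (D1 + D2) (T1 + T2).
Proof.
move=> H1 H2 e e0; have e20 : 0 < e / 2 by lra.
have [al1 [ph1 [La1 [a1 [b1 [pr1 h1 h2 h3 h4]]]]]] := H1 _ e20.
have [al2 [ph2 [La2 [a2 [b2 [pr2 k1 k2 k3 k4]]]]]] := H2 _ e20.
have E : al1 b1 = al2 a2 by rewrite h2 k1.
have ab1 : a1 <= b1 by case: pr1 => /ltW.
have ab2 : a2 <= b2 by case: pr2 => /ltW.
have gl F1 F2 := @glueS _ a1 b1 a2 b2 F1 F2 ab1 ab2.
do 5 eexists; split; first exact: (profile_concat pr1 pr2 E).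
- by rewrite (gl _ _).1.
- by rewrite (gl _ _).2 E; lra.
- by rewrite (gl _ _).1 (gl _ _).2; lra.
- by rewrite (gl _ _).1 (gl _ _).2; lra.
Qed.

Lemma cone_len_le gm a b : cone_curve false I f dZ gm a b ->
  (cone_len f dZ gm a b <= ((gm b).1 - (gm a).1)%:E)%E.
Proof.
move=> gc; have [ph [La [pr _ _ ->]]] := cone_curve_profile mZ fc f0 gc.
have [ab h2 _ [h3 _ h4] _] := pr.
have := @profile_bound _ _ _ _ _ _ _ _ _ 0 (lexx _) _ pr.
rewrite mul0r expr0n addr0 lee_fin => B.
have A0 : (gm a).1 < (gm b).1 by exact: h3.
rewrite -(ler_pXn2r (n := 2)) ?nnegrE ?subr_ge0 ?(ltW A0) ?h4 ?(ltW ab)//.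
by apply: B => t tab; apply/ltW/f0/h2.
Qed.

Lemma ltau_lty (x y : R * Z) : (ltau (S := cone I f dZ) x y < +oo)%E.
Proof.
apply: (@le_lt_trans _ _ (`|y.1 - x.1|%:E)); last exact: ltry.
apply: ltau_le => [|g a b gc ga gb]; first by rewrite lee_fin.
apply: le_trans (cone_len_le gc) _; rewrite ga gb lee_fin; exact: ler_norm.
Qed.

Lemma ltau_fin (x y : R * Z) : (fine (ltau (S := cone I f dZ) x y))%:E = ltau (S := cone I f dZ) x y.
Proof. by apply: fineK; rewrite ge0_fin_numE ?ltau_lty ?ltau_cone_ge0. Qed.

End segments.

Section segment_curve.
Variables (Z : Type) (dZ : Z -> Z -> R).
Hypothesis mZ : is_metric dZ.

(** The witnesses are nearly optimal causal curves from [gm s] to [gm t], not restrictions of [gm],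
    which serves only to show that the two points are causally related. *)
Lemma Seg_curve gm a b s t : cone_curve false I f dZ gm a b -> a <= s -> s < t -> t <= b ->
  Seg (gm s).1 (gm t).1 (dZ (gm s).2 (gm t).2) (fine (ltau (S := cone I f dZ) (gm s) (gm t))).
Proof.
move=> gc as_ st tb e e0.
have gc' := cone_curve_sub as_ st tb gc.
set T := fine _.
have : ((T - e)%:E < ltau (S := cone I f dZ) (gm s) (gm t))%E.
  by rewrite -(ltau_fin mZ) lte_fin -/T; lra.
rewrite /ltau ifT; last by apply/asboolP; exists gm, s, t.
move=> /ereal_sup_gt[_ [g [c [c' [h10 [h2 [h3 ->]]]]]]] hT.
have h1 : cone_curve false I f dZ g c c' := h10.
have [ph [La [pr dph _ E]]] := cone_curve_profile mZ fc f0 h1.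
exists (fun t => (g t).1), ph, La, c, c'; split => //; rewrite ?h2 ?h3//.
  by rewrite -h2 -h3; apply: dph => //; case: pr => /ltW.
by move: hT; rewrite /= E lte_fin => /ltW.
Qed.

(** Scaling an approximate curve down to [sg] gives at least [l0 (T - e) + (1 - l0) A] with
    [l0 = dW w w' / D < 1]. The bound [m] forces [T < A], so the gain [(1 - l0) (A - T)] survives as
    [e] tends to 0. *)
Lemma Seg_lt W (dW : W -> W -> R) (w w' : W) sg t0 t1 D T m : is_metric dW ->
  geod_seg dW sg w w' -> dW w w' < D -> 0 < m -> (forall x, t0 <= x <= t1 -> m <= f x) ->
  Seg t0 t1 D T -> (T%:E < ltau (S := cone I f dW) (t0%R, w) (t1%R, w'))%E.
Proof.
move=> mW gs dD m0 mf H.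
have W0 : 0 <= dW w w' by case: mW.
set A := t1 - t0; have D0 : 0 < D by lra.
have P e : 0 < e -> [/\ 0 < A, (T - e <= A), (0 <= T - e -> (T - e) ^+ 2 + (m * D) ^+ 2 <= A ^+ 2) &
   ((dW w w' / D * (T - e) + (1 - dW w w' / D) * A)%:E <= ltau (S := cone I f dW) (t0, w) (t1, w'))%E].
  move=> e0; have [al [ph [La [a [b [pr h1 h2 h3 h4]]]]]] := H _ e0.
  have [ab alI _ [ial ndph ndLa] _] := pr.
  have A0 : 0 < A by rewrite /A -h1 -h2 subr_gt0 ial.
  have B : forall x, a <= x <= b -> m <= f (al x).
    move=> x /andP[ax xb]; apply: mf; rewrite -h1 -h2.
    have h s t : a <= s -> s <= t -> t <= b -> al s <= al t.
      by move=> ?; rewrite le_eqVlt => /predU1P[->//|? ?]; apply: ltW; exact: ial.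
    by rewrite !h.
  have := profile_bound (ltW m0) B pr; rewrite h1 h2 -/A => B1.
  have La0 : 0 <= La b - La a by rewrite subr_ge0 ndLa// ltW.
  have LA : La b - La a <= A.
    rewrite -(ler_pXn2r (n := 2)) ?nnegrE ?(ltW A0)//.
    by have := sqr_ge0 (m * (ph b - ph a)); lra.
  have mD : (m * D) ^+ 2 <= (m * (ph b - ph a)) ^+ 2.
    have mD1 : m * D <= m * (ph b - ph a) by rewrite ler_pM2l.
    have mD0 : 0 <= m * D by rewrite mulr_ge0// ltW.
    by rewrite ler_pXn2r// nnegrE; exact: le_trans mD1.
  split => //; first lra.
    move=> Te; have : (T - e) ^+ 2 <= (La b - La a) ^+ 2 by rewrite ler_pXn2r// nnegrE.
    by lra.
  pose l := dW w w' / (ph b - ph a).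
  have Lp : 0 < ph b - ph a by lra.
  have l01 : 0 <= l <= 1 by rewrite divr_ge0 ?ler_pdivrMr//; lra.
  have pr' := profile_scale f0 pr l01.
  have E : dW w w' = l * ph b - l * ph a by rewrite -mulrBr divfK// gt_eqF.
  have [C len] := profile_curve mW fc f0 pr' gs E.
  have [e1 e2] := profile_curve_ends (ph := fun t => l * ph t) al mW gs E.
  apply: le_trans (ltau_ge (S := cone I f dW) C _ _); rewrite ?e1 ?e2 ?h1 ?h2//.
  apply: le_trans len; rewrite lee_fin h1 h2.
  (* Proper time is at most [A], so replacing [l] by the larger [l0], which is independent of the
     curve, only weakens the bound. *)
  have ll : l <= dW w w' / D by rewrite ler_wpM2l// lef_pV2.
  set l0 := dW w w' / D in ll *.
  have l00 : 0 <= l0 by rewrite divr_ge0// ltW.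
  have : l0 * (T - e) <= l0 * (La b - La a) by rewrite ler_wpM2l.
  have : (l0 - l) * (La b - La a) <= (l0 - l) * A by rewrite ler_wpM2l//; lra.
  rewrite /A; lra.
have [A0 _ _ _] := P 1 ltr01.
have TA : T < A.
  have [T0|T0] := leP T 0; first lra.
  have mD0 : 0 < m * D by exact: mulr_gt0.
  (* The first bound keeps [T - e] nonnegative. By the second, expanding [(T - e) ^+ 2] loses at
     most half of [(m * D) ^+ 2], and the other half makes [T < A] strict. *)
  pose e := Num.min (T / 2) ((m * D) ^+ 2 / (4 * T)).
  have e0 : 0 < e by rewrite lt_min !divr_gt0 ?exprn_gt0//; lra.
  have e1 : e <= T / 2 by rewrite ge_min lexx.
  have e2 : e * (4 * T) <= (m * D) ^+ 2.
    by rewrite -ler_pdivlMr ?ge_min ?lexx ?orbT//; lra.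
  have [_ _ h _] := P e e0.
  have {}h := h ltac:(lra).
  have mD2 : 0 < (m * D) ^+ 2 by rewrite exprn_gt0.
  rewrite -(ltr_pXn2r (n := 2)) ?nnegrE ?(ltW A0) ?(ltW T0)//.
  have E : (T - e) ^+ 2 = T ^+ 2 - e * (4 * T) / 2 + e ^+ 2 by field.
  have := sqr_ge0 e; lra.
set l0 := dW w w' / D in P.
have l1 : l0 < 1 by rewrite ltr_pdivrMr// mul1r.
have l00 : 0 <= l0 by rewrite divr_ge0// ltW.
apply: (@lt_le_trans _ _ ((l0 * T + (1 - l0) * A)%:E)).
  have : (1 - l0) * T < (1 - l0) * A by rewrite ltr_pM2l//; lra.
  by rewrite lte_fin; lra.
rewrite -(ltau_fin mW) lee_fin; apply/ler_addgt0Pr => e e0.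
have [_ _ _] := P e e0; rewrite -(ltau_fin mW) lee_fin.
have : l0 * e <= 1 * e by rewrite ler_wpM2r// ltW.
lra.
Qed.

End segment_curve.

End Tau.

(** * Maximal curves and fibre geodesics *)

Section Maximal.
Variable R : realType.
Local Notation distR := (@distR R).
Variables (I : set R) (f : R -> R).
Hypotheses (fc : cont_on I f) (f0 : forall t, I t -> 0 < f t).

Lemma partition_in (a b : R) n (t : nat -> R) : t 0%N = a -> t n = b ->
  (forall i, (i < n)%N -> t i < t i.+1) -> forall i, (i <= n)%N -> a <= t i <= b.
Proof.
move=> t0 tn tm i ni.
have mono k j : (k <= j)%N -> (j <= n)%N -> t k <= t j.
  elim: j => [|j IH]; first by rewrite leqn0 => /eqP->.
  rewrite leq_eqVlt => /predU1P[->//|kj] jn.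
  by apply: le_trans (IH kj (ltnW jn)) _; apply: ltW; exact: tm.
by rewrite -t0 -tn !mono.
Qed.

Section additive.
Variables (Z : Type) (dZ : Z -> Z -> R) (gm : R -> R * Z) (a b : R) (x y : R * Z).
Hypotheses (mZ : is_metric dZ) (mx : maximal_curve (S := cone I f dZ) gm a b x y).
Hypothesis gxy : exists sg, geod_seg dZ sg x.2 y.2.
Hypothesis fm : exists2 m, 0 < m & forall t, x.1 <= t <= y.1 -> m <= f t.
Local Notation be t := (gm t).2.

Let C : cone_curve false I f dZ gm a b.
Proof. by case: mx. Qed.

Let ends : gm a = x /\ gm b = y.
Proof. by case: mx => _ [? [? _]]. Qed.

Let ab : a < b.
Proof. by case: C. Qed.

Let tau s t := fine (ltau (S := cone I f dZ) (gm s) (gm t)).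

Let seg s t := @Seg_curve R I f fc f0 Z dZ mZ gm a b s t C.

(** Were [D] larger, shortening the fibre component to a geodesic from [x.2] to [y.2] would beat
    [tau x y]. *)
Let le_of_Seg D T : Seg I f x.1 y.1 D T -> (tau a b <= T) -> D <= dZ x.2 y.2.
Proof.
move=> S; rewrite /tau ends.1 ends.2 -lee_fin (ltau_fin fc f0 mZ) => leT.
rewrite leNgt; apply/negP => lt; have [sg gs] := gxy; have [m m0 mf] := fm.
have := Seg_lt fc f0 mZ gs lt m0 mf S.
by rewrite -!surjective_pairing ltNge leT.
Qed.

(** The [tau]-length is an infimum over partitions, so maximality puts every partition sum above
    [tau x y]. *)
Let tau_le n (t : nat -> R) : t 0%N = a -> t n = b -> (forall i, (i < n)%N -> t i < t i.+1) ->
  tau a b <= \sum_(i < n) tau (t i) (t i.+1).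
Proof.
move=> t0 tn tm; rewrite -lee_fin -sumEFin /tau (ltau_fin fc f0 mZ) ends.1 ends.2.
case: mx => _ [_ [_ <-]]; apply: ereal_inf_lbound; exists n, t; split => //; split => //.
by split => //; apply: eq_bigr => i _; rewrite (ltau_fin fc f0 mZ).
Qed.

Let add2 s : a < s -> s < b -> dZ x.2 (be s) + dZ (be s) y.2 <= dZ x.2 y.2.
Proof.
move=> as_ sb.
have S := Seg_concat (seg (lexx a) as_ (ltW sb)) (seg (ltW as_) sb (lexx b)).
rewrite ends.1 ends.2 in S; apply: le_of_Seg S _; rewrite -ends.1 -ends.2.
have := @tau_le 2 (fun i => if i is i'.+1 then if i' is _.+1 then b else s else a).
rewrite !big_ord_recl big_ord0/= addr0; apply => //.
by move=> [|[|]].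
Qed.

Let add3 s t : a < s -> s < t -> t < b ->
  dZ x.2 (be s) + dZ (be s) (be t) + dZ (be t) y.2 <= dZ x.2 y.2.
Proof.
move=> as_ st tb; have sb := lt_trans st tb; have at' := lt_trans as_ st.
have S := Seg_concat (Seg_concat (seg (lexx a) as_ (ltW sb)) (seg (ltW as_) st (ltW tb)))
  (seg (ltW at') tb (lexx b)).
rewrite ends.1 ends.2 in S; apply: le_of_Seg S _; rewrite -ends.1 -ends.2.
have := @tau_le 3 (fun i => if i is i'.+1 then if i' is i''.+1 then
  if i'' is _.+1 then b else t else s else a).
rewrite !big_ord_recl big_ord0/= addr0 addrA; apply => //.
by move=> [|[|[|]]].
Qed.

Lemma maximal_additive s t : a <= s -> s <= t -> t <= b ->
  dZ x.2 (be s) + dZ (be s) (be t) + dZ (be t) y.2 <= dZ x.2 y.2.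
Proof.
have dxx z : dZ z z = 0 by apply/mZ.2.1.
have bea : be a = x.2 by rewrite ends.1.
have beb : be b = y.2 by rewrite ends.2.
have mid u : a <= u -> u <= b -> dZ x.2 (be u) + dZ (be u) y.2 <= dZ x.2 y.2.
  rewrite le_eqVlt => /predU1P[<- _|au]; first by rewrite bea dxx add0r.
  rewrite le_eqVlt => /predU1P[->|ub]; first by rewrite beb dxx addr0.
  exact: add2.
move=> as_ st tb.
(* Causal curves have nondegenerate parameter intervals, so coinciding parameters are treated
   apart. *)
move: (st); rewrite le_eqVlt => /predU1P[<-|st'].
  by rewrite dxx addr0; apply: mid => //; exact: le_trans tb.
move: (as_); rewrite le_eqVlt => /predU1P[<-|as'].
  by rewrite bea dxx add0r; apply: mid => //; exact: le_trans st.
move: (tb); rewrite le_eqVlt => /predU1P[->|tb']; last exact: add3.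
by rewrite beb dxx addr0; apply: mid => //; exact: le_trans tb.
Qed.

Lemma maximal_dist s t : a <= s -> s <= t -> t <= b ->
  dZ (be s) (be t) = dZ x.2 (be t) - dZ x.2 (be s).
Proof.
move=> as_ st tb; have H := maximal_additive as_ st tb.
have [_ [_ [_ T]]] := mZ.
have := T x.2 (be s) (be t); have := T x.2 (be t) y.2; lra.
Qed.

(** Along the curve the distance [psi] from [x.2] is continuous and takes every value [r * D]. Any
    choice of preimages gives the geodesic, because by [dpsi] the fibre point depends on [psi]
    alone. For [D = 0] the quotients are 0 by convention. *)
Lemma maximal_geodesic : exists g, geod_seg dZ g x.2 y.2 /\
  forall s, a <= s <= b -> be s = g (dZ x.2 (be s) / dZ x.2 y.2) /\
    0 <= dZ x.2 (be s) / dZ x.2 y.2 <= 1.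
Proof.
have [d0 [d00 [dC dT]]] := mZ.
have dxx z : dZ z z = 0 by apply/d00.
have bea : be a = x.2 by rewrite ends.1.
have beb : be b = y.2 by rewrite ends.2.
have ba : a <= b by exact: ltW.
pose psi s := dZ x.2 (be s); set D := dZ x.2 y.2.
have psia : psi a = 0 by rewrite /psi bea.
have psib : psi b = D by rewrite /psi beb.
have dpsi s t : a <= s <= b -> a <= t <= b -> dZ (be s) (be t) = `|psi s - psi t|.
  move=> /andP[s1 s2] /andP[t1 t2]; have [st|/ltW ts] := leP s t.
    have E := maximal_dist s1 st t2; rewrite E distrC ger0_norm//.
    by rewrite -/(psi _) -/(psi _) in E; rewrite -E.
  have E := maximal_dist t1 ts s2; rewrite dC E ger0_norm//.
  by rewrite -/(psi _) -/(psi _) in E; rewrite -E.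
have psiD s : a <= s <= b -> 0 <= psi s <= D.
  move=> sab; rewrite d0/=; have /andP[s1 s2] := sab.
  have := maximal_dist s1 s2 (lexx b); rewrite -/(psi _) -/(psi _) psib.
  by have := d0 (be s) (be b); lra.
have ex r : exists c, 0 <= r <= 1 -> a <= c <= b /\ psi c = r * D.
  have [/andP[r0 r1]|nr] := boolP (0 <= r <= 1); last by exists a.
  have D0 : 0 <= D by exact: d0.
  have [_ acbe] := cone_curve_ac mZ C.
  have cp : continuous (fun s => psi (clip a b s)).
    move=> s; apply/cvgrPdist_lt => e e0.
    have [c c0 Hc] := clip_cont mZ ba acbe s e0.
    apply/nbhs_ballP; exists c => //= u; rewrite /ball/= distrC => /Hc.
    by rewrite (dpsi _ _ (clip_itv _ ba) (clip_itv _ ba)) distrC.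
  have [||c] := @IVT R (fun s => psi (clip a b s)) a b (r * D) ba.
  - exact: continuous_subspaceT.
  - rewrite !clip_id// psia psib min_l// max_r// mulr_ge0//=.
    by rewrite -[leRHS]mul1r ler_wpM2r.
  - by rewrite in_itv/= => cab; have /andP[c1 c2] := cab; rewrite clip_id// => E; exists c.
have [c Hc] := boolp.choice ex.
have psi_inj s t : a <= s <= b -> a <= t <= b -> psi s = psi t -> be s = be t.
  by move=> sab tab E; apply/d00; rewrite dpsi// E subrr normr0.
exists (fun r => be (c r)); split; last first.
  move=> s sab; have /andP[p0 pD] := psiD _ sab.
  have r01 : 0 <= psi s / D <= 1.
    have [D0|D0] := eqVneq D 0; first by rewrite D0 invr0 mulr0 lexx ler01.
    have Dp : 0 < D by rewrite lt_neqAle eq_sym D0; exact: d0.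
    by rewrite divr_ge0 ?ler_pdivrMr ?mul1r// ltW.
  split; last exact: r01.
  have [cab E] := Hc _ r01; apply: psi_inj => //; rewrite E.
  have [D0|D0] := eqVneq D 0; last by rewrite divfK.
  by rewrite D0 mulr0; rewrite D0 in pD; lra.
split; first have [] := Hc 0; first by rewrite lexx ler01.
  move=> cab E; rewrite /= -bea; apply: psi_inj => //; first by rewrite lexx.
  by rewrite E mul0r psia.
split; first have [] := Hc 1; first by rewrite lexx ler01.
  move=> cab E; rewrite /= -beb; apply: psi_inj => //; first by rewrite lexx ba.
  by rewrite E mul1r psib.
move=> s t s01 t01; have [cs Es] := Hc _ s01; have [ct Et] := Hc _ t01.
by rewrite /= dpsi// Es Et -mulrBl normrM (ger0_norm (d0 _ _)).
Qed.

End additive.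

Section lift.
Variables (Z W : Type) (dZ : Z -> Z -> R) (dW : W -> W -> R).
Variables (gm : R -> R * Z) (a b : R) (x y : R * Z) (be' : R -> W).
Hypotheses (mZ : is_metric dZ) (mW : is_metric dW).
Hypothesis dbe : forall s t, a <= s <= b -> a <= t <= b ->
  dW (be' s) (be' t) = dZ (gm s).2 (gm t).2.
Let gm' t := ((gm t).1, be' t).

Lemma lift_curve strict : cone_curve strict I f dZ gm a b -> cone_curve strict I f dW gm' a b.
Proof.
move=> [ab [gI [ac [mono [/aeo_ae ae1 /aeo_ae ae2]]]]].
split => //; split => //; split.
  apply: abs_cont_le ler01 _ ac => s t as_ st tb; rewrite mul1r /coneD/= dbe//; apply/andP; split => //.
    exact: le_trans tb.
  exact: le_trans st.
split => //; split; apply/aeo_ae => //.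
apply: aeo_mono ae1 => t tab [dal [v [hv H]]]; split => //; exists v; split => //.
apply/(mder_atP _ _ _ mW); move/(mder_atP _ _ _ mZ) : hv; apply: (mder_local tab).
by move=> s sab; apply: dbe => //; move/andP: tab => [/ltW-> /ltW->].
Qed.

Hypothesis gZ : forall s t, a <= s <= b -> a <= t <= b ->
  exists sg, geod_seg dZ sg (gm s).2 (gm t).2.
Hypothesis gW : forall s t, a <= s <= b -> a <= t <= b ->
  exists sg, geod_seg dW sg (be' s) (be' t).

Lemma lift_ltau s t : a <= s <= b -> a <= t <= b ->
  ltau (S := cone I f dW) (gm' s) (gm' t) = ltau (S := cone I f dZ) (gm s) (gm t).
Proof.
move=> sab tab; have [s1 g1] := gZ sab tab; have [s2 g2] := gW sab tab.
rewrite [gm s]surjective_pairing [gm t]surjective_pairing.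
by apply/esym/(ltau_transfer fc f0 _ _ mZ mW g1 g2); exact: dbe.
Qed.

Lemma lift_maximal : maximal_curve (S := cone I f dZ) gm a b x y ->
  maximal_curve (S := cone I f dW) gm' a b (x.1, be' a) (y.1, be' b).
Proof.
move=> [C0 [ga [gb mx]]]; have C : cone_curve false I f dZ gm a b := C0.
have ab : a <= b by case: C => /ltW.
have C' := lift_curve C; split; first exact: C'.
split; first by rewrite /gm' ga.
split; first by rewrite /gm' gb.
have -> : (x.1, be' a) = gm' a by rewrite /gm' ga.
have -> : (y.1, be' b) = gm' b by rewrite /gm' gb.
have aI : a <= a <= b by rewrite lexx ab.
have bI : a <= b <= b by rewrite lexx ab.
transitivity (ltau_len (S := cone I f dZ) gm a b); last first.
  by rewrite mx -ga -gb; exact: esym (lift_ltau aI bI).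
(* The [tau]-length is built from values of [tau] only, so it transfers partition by partition. *)
refine (f_equal (@ereal_inf R) _).
have E n t : t 0%N = a -> t n = b -> (forall i, (i < n)%N -> t i < t i.+1) ->
    (\sum_(i < n) ltau (S := cone I f dW) (gm' (t i)) (gm' (t i.+1)) =
     \sum_(i < n) ltau (S := cone I f dZ) (gm (t i)) (gm (t i.+1)))%E.
  move=> t0 tn tm; apply: eq_bigr => i _.
  by apply: lift_ltau; apply: (partition_in t0 tn tm) => //; exact: ltnW.
apply/seteqP; split => l [n [t [t0 [tn [tm ->]]]]]; exists n, t.
  exact (conj t0 (conj tn (conj tm (E n t t0 tn tm)))).
exact (conj t0 (conj tn (conj tm (esym (E n t t0 tn tm))))).
Qed.

End lift.
End Maximal.

(** * Model planes *)

Section ConstantCurvature.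
Variable R : realType.
Local Notation pt := (R * R * R)%type.

(** What the transfer uses of the model plane: short geodesics, and small comparison triangles with
    a vertex at [p0]. *)
Definition good_model (M : Type) (d : M -> M -> R) (p0 : M) (r : R) : Prop :=
  [/\ is_metric d, 0 < r, forall p q, d p q < r -> exists g, geod_seg d g p q &
    forall a b c, 0 <= a < r -> 0 <= b < r -> 0 <= c < r -> a <= b + c -> b <= a + c ->
      c <= a + b -> exists y z, [/\ d p0 y = a, d y z = b & d p0 z = c]].

Lemma sqr_le1E (x : R) : (x ^+ 2 <= 1) = (-1 <= x <= 1).
Proof. by rewrite -ler_norml -real_normK ?num_real// expr_le1. Qed.

(* With A = |K| and ka the sign of K, this is K times the ambient form. *)
Definition bform (A ka : R) (p q : pt) : R :=
  A * (p.1.1 * q.1.1 + ka * (p.1.2 * q.1.2 + p.2 * q.2)).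

Definition bcar (A ka : R) (p : pt) : Prop := bform A ka p p = 1 /\ (ka = -1 -> 0 < p.1.1).

(** * Sphere ([ka = 1]) and hyperbolic plane ([ka = -1]) at once, with [C], [S] their cosine and
    sine *)

Section curved.
Variables (A ka : R) (C S arc : R -> R).
Hypotheses (A0 : 0 < A) (ka1 : ka = 1 \/ ka = -1).
Let dom (x : R) := 0 <= x /\ (ka = 1 -> x <= pi).
Let val (b : R) := (ka = 1 -> -1 <= b <= 1) /\ (ka = -1 -> 1 <= b).
Hypotheses (CS : forall x, C x ^+ 2 + ka * S x ^+ 2 = 1)
  (CB : forall x y, C (x - y) = C x * C y + ka * S x * S y)
  (SB : forall x y, S (x - y) = S x * C y - C x * S y)
  (S_gt0 : forall x, 0 < x -> (ka = 1 -> x < pi) -> 0 < S x)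
  (S_pi : ka = 1 -> S pi = 0)
  (C_dec : forall x y, dom x -> dom y -> x < y -> ka * C y < ka * C x)
  (arcK : forall x, dom x -> arc (C x) = x)
  (Carc : forall b, val b -> C (arc b) = b) (arc_dom : forall b, val b -> dom (arc b)).

Local Notation bf := (bform A ka).
Local Notation car := (bcar A ka).
Let dl p q := arc (bf p q).

Let ka2 : ka ^+ 2 = 1.
Proof. by case: ka1 => ->; rewrite ?sqrrN expr1n. Qed.

Let bfC p q : bf p q = bf q p.
Proof. by rewrite /bform; ring. Qed.

Let C0 : C 0 = 1.
Proof. by have := CB 0 0; rewrite subrr => ->; rewrite -[RHS](CS 0); ring. Qed.

Let S0 : S 0 = 0.
Proof. by have := SB 0 0; rewrite subrr => ->; ring. Qed.

Let CN x : C (- x) = C x.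
Proof. by have := CB 0 x; rewrite sub0r C0 S0 => ->; ring. Qed.

Let SN x : S (- x) = - S x.
Proof. by have := SB 0 x; rewrite sub0r C0 S0 => ->; ring. Qed.

Let dom0 : dom 0.
Proof. by split => // _; exact: pi_ge0. Qed.

Let S_ge0 x : dom x -> 0 <= S x.
Proof.
move=> [x0 xpi]; move: x0; rewrite le_eqVlt => /predU1P[<-|x0]; first by rewrite S0.
have [->|xp] := eqVneq x pi.
  have [k1|k1] := ka1; first by rewrite S_pi.
  apply/ltW/S_gt0; first exact: pi_gt0.
  by rewrite k1 => k; exfalso; lra.
by apply/ltW/S_gt0 => // k; rewrite lt_neqAle xp xpi.
Qed.

Let C_le x y : dom x -> dom y -> (ka * C y <= ka * C x) -> x <= y.
Proof. by move=> dx dy h; rewrite leNgt; apply/negP => /(C_dec dy dx); lra. Qed.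

Let C_dec' x y : dom x -> dom y -> x <= y -> ka * C y <= ka * C x.
Proof. by move=> dx dy; rewrite le_eqVlt => /predU1P[->//|/(C_dec dx dy)/ltW]. Qed.

Let C_norm x : C `|x| = C x.
Proof. by have [h|h] := ger0P x; rewrite ?CN. Qed.

(** Cauchy-Schwarz on the sphere; the reversed Cauchy-Schwarz inequality on the upper sheet of the
    hyperboloid. *)
Let bf_val p q : car p -> car q -> val (bf p q).
Proof.
move=> [pp p0] [qq q0]; split => k; move: pp qq; rewrite /bform k.
  rewrite !mul1r => pp qq; have E : (A * (p.1.1 * q.1.1 + (p.1.2 * q.1.2 + p.2 * q.2))) ^+ 2 =
    (A * (p.1.1 * p.1.1 + (p.1.2 * p.1.2 + p.2 * p.2))) * (A * (q.1.1 * q.1.1 + (q.1.2 * q.1.2 + q.2 * q.2)))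
    - A ^+ 2 * ((p.1.1 * q.1.2 - p.1.2 * q.1.1) ^+ 2 + (p.1.1 * q.2 - p.2 * q.1.1) ^+ 2 +
      (p.1.2 * q.2 - p.2 * q.1.2) ^+ 2) by ring.
  have : (A * (p.1.1 * q.1.1 + (p.1.2 * q.1.2 + p.2 * q.2))) ^+ 2 <= 1.
    by rewrite E pp qq mulr1 gerBl mulr_ge0 ?sqr_ge0// !addr_ge0// sqr_ge0.
  by rewrite sqr_le1E.
move=> pp qq.
set P := A * (p.1.2 * p.1.2 + p.2 * p.2).
set Q := A * (q.1.2 * q.1.2 + q.2 * q.2).
set D := A * (p.1.2 * q.1.2 + p.2 * q.2).
have p2 : A * (p.1.1 * p.1.1) = 1 + P by rewrite /P; lra.
have q2 : A * (q.1.1 * q.1.1) = 1 + Q by rewrite /Q; lra.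
suff : 1 + D <= A * (p.1.1 * q.1.1) by rewrite /D; lra.
have pq : 0 < A * (p.1.1 * q.1.1) by rewrite !mulr_gt0// ?p0 ?q0.
have [h|h] := leP (1 + D) 0; first lra.
rewrite -(ler_pXn2r (n := 2)) ?nnegrE ?(ltW pq) ?(ltW h)//.
have -> : (A * (p.1.1 * q.1.1)) ^+ 2 = (1 + P) * (1 + Q) by rewrite -p2 -q2; ring.
have h1 : 0 <= P + Q - 2 * D.
  have -> : P + Q - 2 * D = A * ((p.1.2 - q.1.2) ^+ 2 + (p.2 - q.2) ^+ 2) by rewrite /P /Q /D; ring.
  by rewrite mulr_ge0 ?(ltW A0)// addr_ge0// sqr_ge0.
have h2 : 0 <= P * Q - D ^+ 2.
  have -> : P * Q - D ^+ 2 = A ^+ 2 * (p.1.2 * q.2 - p.2 * q.1.2) ^+ 2 by rewrite /P /Q /D; ring.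
  by rewrite mulr_ge0// sqr_ge0.
rewrite -subr_ge0.
have -> : (1 + P) * (1 + Q) - (1 + D) ^+ 2 = (P + Q - 2 * D) + (P * Q - D ^+ 2) by ring.
exact: addr_ge0.
Qed.

(** The equality case of [bf_val]: a sum of squares vanishes. On the hyperboloid this settles the
    last two coordinates, and positivity of the first settles the remaining sign. *)
Let bf_eq1 p q : car p -> car q -> bf p q = 1 -> p = q.
Proof.
move=> [pp p0] [qq q0] pq; have A0' : A != 0 by rewrite gt_eqF.
case: ka1 => k; rewrite /bform k in pp qq pq.
  have : A * ((p.1.1 - q.1.1) ^+ 2 + (p.1.2 - q.1.2) ^+ 2 + (p.2 - q.2) ^+ 2) = 0.
    have -> : A * ((p.1.1 - q.1.1) ^+ 2 + (p.1.2 - q.1.2) ^+ 2 + (p.2 - q.2) ^+ 2) =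
     A * (p.1.1 * p.1.1 + 1 * (p.1.2 * p.1.2 + p.2 * p.2)) + A * (q.1.1 * q.1.1 + 1 * (q.1.2 * q.1.2 + q.2 * q.2))
     - 2 * (A * (p.1.1 * q.1.1 + 1 * (p.1.2 * q.1.2 + p.2 * q.2))) by ring.
    by rewrite pp qq pq; ring.
  move=> /eqP; rewrite mulf_eq0 (negbTE A0')/= !paddr_eq0 ?addr_ge0 ?sqr_ge0//.
  rewrite !sqrf_eq0 !subr_eq0 => /andP[/andP[/eqP h1 /eqP h2] /eqP h3].
  by rewrite [p]surjective_pairing [p.1]surjective_pairing h1 h2 h3 -!surjective_pairing.
have h : A * ((p.1.2 - q.1.2) ^+ 2 + (p.2 - q.2) ^+ 2) + (A * (p.1.2 * q.2 - p.2 * q.1.2)) ^+ 2 = 0.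
  have e1 : A * p.1.1 * p.1.1 = 1 + A * (p.1.2 * p.1.2 + p.2 * p.2) by lra.
  have e2 : A * q.1.1 * q.1.1 = 1 + A * (q.1.2 * q.1.2 + q.2 * q.2) by lra.
  have e3 : A * p.1.1 * q.1.1 = 1 + A * (p.1.2 * q.1.2 + p.2 * q.2) by lra.
  have : (A * p.1.1 * p.1.1) * (A * q.1.1 * q.1.1) - (A * p.1.1 * q.1.1) ^+ 2 = 0 by ring.
  by rewrite e1 e2 e3 => <-; ring.
have h1 : 0 <= A * ((p.1.2 - q.1.2) ^+ 2 + (p.2 - q.2) ^+ 2).
  by rewrite mulr_ge0 ?(ltW A0)// addr_ge0// sqr_ge0.
move/eqP: h; rewrite paddr_eq0// ?sqr_ge0// mulf_eq0 (negbTE A0')/= paddr_eq0 ?sqr_ge0//.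
rewrite !sqrf_eq0 !subr_eq0 => /andP[/andP[/eqP h2 /eqP h3] _].
have h4 : p.1.1 = q.1.1.
  have : A * ((p.1.1 - q.1.1) * (p.1.1 + q.1.1)) = 0.
    have -> : A * ((p.1.1 - q.1.1) * (p.1.1 + q.1.1)) =
      A * (p.1.1 * p.1.1 + -1 * (p.1.2 * p.1.2 + p.2 * p.2)) -
      A * (q.1.1 * q.1.1 + -1 * (q.1.2 * q.1.2 + q.2 * q.2)) by rewrite h2 h3; ring.
    by rewrite pp qq subrr.
  move=> /eqP; rewrite mulf_eq0 (negbTE A0')/= mulf_eq0 subr_eq0 => /orP[/eqP//|].
  by rewrite gt_eqF// addr_gt0// ?p0 ?q0.
by rewrite [p]surjective_pairing [p.1]surjective_pairing h4 h2 h3 -!surjective_pairing.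
Qed.

(* The triangle inequality is the nonnegativity of a Gram determinant. *)
Let dl_triangle p q r : car p -> car q -> car r -> dl p r <= dl p q + dl q r.
Proof.
move=> cp cq cr.
have [[vpq vqr] vpr] := (bf_val cp cq, bf_val cq cr, bf_val cp cr).
have d1 : dom (dl p q) := arc_dom vpq.
have d2 : dom (dl q r) := arc_dom vqr.
have d3 : dom (dl p r) := arc_dom vpr.
rewrite leNgt; apply/negP => h.
have dd : dom (dl p q + dl q r).
  split; first by apply: addr_ge0; [case: d1|case: d2].
  by move=> k; have := d3.2 k; lra.
suff : ka * C (dl p q + dl q r) <= ka * C (dl p r).
  by move/(C_le d3 dd); rewrite leNgt h.
have -> : C (dl p q + dl q r) = C (dl p q) * C (dl q r) - ka * S (dl p q) * S (dl q r).
  by rewrite -[dl q r]opprK CB CN SN opprK; ring.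
have SS2 : (S (dl p q) * S (dl q r)) ^+ 2 = (1 - bf p q ^+ 2) * (1 - bf q r ^+ 2).
  rewrite -{1}(Carc vpq) -{1}(Carc vqr) -/(dl _ _) -/(dl _ _).
  have E1 x : 1 - C x ^+ 2 = ka * S x ^+ 2 by rewrite -(CS x); ring.
  rewrite !E1 mulrACA -expr2 ka2 mul1r; ring.
have E0 : ka * (ka * S (dl p q) * S (dl q r)) = S (dl p q) * S (dl q r).
  by rewrite !mulrA -expr2 ka2 mul1r.
rewrite mulrBr E0.
have -> : C (dl p q) = bf p q by exact: Carc.
have -> : C (dl q r) = bf q r by exact: Carc.
have -> : C (dl p r) = bf p r by exact: Carc.
have SS0 : 0 <= S (dl p q) * S (dl q r) by rewrite mulr_ge0// S_ge0.
set X := bf p q in SS2 *; set Y := bf q r in SS2 *; set Z := bf p r.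
have gram : (Z - X * Y) ^+ 2 <= (S (dl p q) * S (dl q r)) ^+ 2.
  rewrite SS2 -subr_ge0.
  have -> : (1 - X ^+ 2) * (1 - Y ^+ 2) - (Z - X * Y) ^+ 2 =
    1 * 1 * 1 + 2 * X * Y * Z - 1 * Y ^+ 2 - 1 * Z ^+ 2 - 1 * X ^+ 2 by ring.
  pose det := p.1.1 * (q.1.2 * r.2 - q.2 * r.1.2) - p.1.2 * (q.1.1 * r.2 - q.2 * r.1.1) +
    p.2 * (q.1.1 * r.1.2 - q.1.2 * r.1.1).
  (* The Gram determinant is the squared determinant of the three vectors times that of the form,
     [A ^+ 3 * ka ^+ 2], which is positive for either sign of [ka]. *)
  have G : bf p p * bf q q * bf r r + 2 * X * Y * Z - bf p p * Y ^+ 2 - bf q q * Z ^+ 2 -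
      bf r r * X ^+ 2 = A ^+ 3 * ka ^+ 2 * det ^+ 2 by rewrite /X /Y /Z /bform /det; ring.
  rewrite cp.1 cq.1 cr.1 ka2 in G; rewrite G.
  by rewrite mulr_ge0 ?sqr_ge0// mulr1 exprn_ge0// ltW.
have [h1 h2] : - (S (dl p q) * S (dl q r)) <= Z - X * Y /\ Z - X * Y <= S (dl p q) * S (dl q r).
  by apply/andP; rewrite -ler_norml -(ler_pXn2r (n := 2)) ?nnegrE// real_normK ?num_real.
by case: ka1 => ->; lra.
Qed.

Let comb (u v : R) (p q : pt) : pt :=
  (u * p.1.1 + v * q.1.1, u * p.1.2 + v * q.1.2, u * p.2 + v * q.2).

Let bf_comb u v u' v' p q : car p -> car q ->
  bf (comb u v p q) (comb u' v' p q) = u * u' + v * v' + (u * v' + v * u') * bf p q.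
Proof.
move=> cp cq; transitivity (u * u' * bf p p + v * v' * bf q q + (u * v' + v * u') * bf p q).
  by rewrite /bform /comb/=; ring.
by rewrite cp.1 cq.1 !mulr1.
Qed.

(** Spherical linear interpolation and its hyperbolic analogue; excluding antipodal points makes the
    denominator [S D] positive. *)
Lemma curved_geodesic p q : car p -> car q -> 0 < dl p q -> (ka = 1 -> dl p q < pi) ->
  exists g : R -> pt, [/\ forall s, 0 <= s <= 1 -> car (g s), g 0 = p, g 1 = q &
    forall s t, 0 <= s <= 1 -> 0 <= t <= 1 -> dl (g s) (g t) = `|s - t| * dl p q].
Proof.
move=> cp cq d0 dpi; have vpq := bf_val cp cq.
set D := dl p q in d0 dpi *.
have SD : 0 < S D by exact: S_gt0.
have CD : bf p q = C D by rewrite /D /dl Carc.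
pose g s := comb (S (D - s * D) / S D) (S (s * D) / S D) p q.
have gE s t : bf (g s) (g t) = C (s * D - t * D).
  have SDn : S D != 0 by rewrite gt_eqF.
  rewrite bf_comb// CD CB.
  apply: (mulfI (_ : S D ^+ 2 != 0)); first by rewrite expf_neq0.
  set x := s * D; set y := t * D.
  transitivity (S (D - x) * S (D - y) + S x * S y + (S (D - x) * S y + S x * S (D - y)) * C D).
    by field.
  rewrite !SB.
  have -> : (S D * C x - C D * S x) * (S D * C y - C D * S y) + S x * S y +
    ((S D * C x - C D * S x) * S y + S x * (S D * C y - C D * S y)) * C D =
    S D ^+ 2 * (C x * C y) + S x * S y * (1 - C D ^+ 2) by ring.
  have -> : 1 - C D ^+ 2 = ka * S D ^+ 2 by rewrite -(CS D); ring.
  by ring.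
have cg s : 0 <= s <= 1 -> car (g s).
  move=> /andP[s0 s1]; split; first by rewrite gE subrr C0.
  move=> k; have p0 := cp.2 k; have q0 := cq.2 k.
  have Spos x : 0 < x -> 0 < S x by move=> x0; apply: S_gt0 => // k'; exfalso; lra.
  rewrite /g /comb/=; have [s00|s00] := eqVneq s 0.
    by rewrite s00 mul0r subr0 S0 mul0r mul0r addr0 divff ?gt_eqF// mul1r.
  have sp : 0 < s by rewrite lt_neqAle eq_sym s00.
  rewrite ltr_wpDl ?mulr_gt0 ?invr_gt0 ?Spos// ?mulr_gt0//.
  rewrite mulr_ge0 ?(ltW p0)// divr_ge0 ?(ltW SD)//.
  have [h|h] := eqVneq (D - s * D) 0; first by rewrite h S0.
  apply/ltW/Spos; rewrite lt_neqAle eq_sym h subr_ge0/=.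
  by rewrite -[leRHS]mul1r ler_wpM2r// ltW.
exists g; split => //.
- rewrite /g mul0r subr0 S0 mul0r divff ?gt_eqF// /comb !mul1r !mul0r !addr0.
  by rewrite -!surjective_pairing.
- rewrite /g mul1r subrr S0 mul0r divff ?gt_eqF// /comb !mul1r !mul0r !add0r.
  by rewrite -!surjective_pairing.
- move=> s t /andP[s0 s1] /andP[t0 t1]; rewrite /dl gE -mulrBl -C_norm normrM (gtr0_norm d0).
  have st : `|s - t| <= 1 by rewrite ler_norml; apply/andP; split; lra.
  rewrite arcK//; split; first by rewrite mulr_ge0// ltW.
  move=> k; apply: (@le_trans _ _ D); last exact/ltW/dpi.
  by rewrite -[leRHS]mul1r ler_wpM2r// ltW.
Qed.

Let base : pt := ((Num.sqrt A)^-1, 0, 0).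

Let sqA : A * ((Num.sqrt A)^-1 * (Num.sqrt A)^-1) = 1.
Proof.
by rewrite -invfM -expr2 sqr_sqrtr ?ltW// divff// gt_eqF.
Qed.

Lemma curved_base : car base.
Proof.
split; last by rewrite /= invr_gt0 sqrtr_gt0.
by rewrite /bform /base/= !mulr0 addr0 mulr0 addr0 sqA.
Qed.

Let polar (x u v : R) : pt :=
  (C x / Num.sqrt A, S x * u / Num.sqrt A, S x * v / Num.sqrt A).

Let bf_polar x u v y u' v' : bf (polar x u v) (polar y u' v') =
  C x * C y + ka * (S x * S y * (u * u' + v * v')).
Proof.
transitivity ((A * ((Num.sqrt A)^-1 * (Num.sqrt A)^-1)) *
  (C x * C y + ka * (S x * S y * (u * u' + v * v')))); first by rewrite /bform /polar/=; ring.
by rewrite sqA mul1r.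
Qed.

Let C_gt0 : ka = -1 -> forall x, 0 <= x -> 1 <= C x.
Proof.
move=> k x x0; have := @C_dec' 0 x dom0; rewrite C0 k !mulN1r lerN2; apply => //.
by split => // k'; exfalso; lra.
Qed.

Let car_polar x u v : 0 <= x -> u ^+ 2 + v ^+ 2 = 1 -> car (polar x u v).
Proof.
move=> x0 uv; split; first by rewrite bf_polar -!expr2 uv mulr1 -[RHS](CS x).
move=> k; rewrite /polar/= divr_gt0 ?sqrtr_gt0//.
by apply: lt_le_trans (C_gt0 k x0).
Qed.

Let polar0 u v : polar 0 u v = base.
Proof. by rewrite /polar /base C0 S0 !mul0r div1r. Qed.

(** In polar coordinates around [base], the law of cosines prescribes the cosine [u] of the angle at
    [base], and the triangle inequalities amount to [|u| <= 1]. *)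
Lemma curved_triangle a b c : 0 <= a -> 0 <= b -> 0 <= c -> a <= b + c -> b <= a + c ->
  c <= a + b -> a + c <= pi -> exists q r, [/\ car q, car r, dl base q = a, dl q r = b &
    dl base r = c].
Proof.
move=> a0 b0 c0 abc bac cab acpi.
have [da dc] : dom a /\ dom c by do 2 split => //; lra.
have db : dom b by split => // _; lra.
have one : (1 : R) ^+ 2 + 0 ^+ 2 = 1 by rewrite expr1n expr0n addr0.
have uv0 u v : u ^+ 2 + v ^+ 2 = 1 -> forall x, dom x -> dl base (polar x u v) = x.
  move=> uv x dx; rewrite -(polar0 u v) /dl bf_polar C0 S0 !mul0r mulr0 addr0 mul1r.
  exact: arcK.
have polardom x u v : dom x -> u ^+ 2 + v ^+ 2 = 1 -> car (polar x u v).
  by move=> dx; apply: car_polar; case: dx.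
have [u [v [uv E]]] : exists u v, u ^+ 2 + v ^+ 2 = 1 /\
    C a * C c + ka * (S a * S c * u) = C b.
  have SS0 : 0 <= S a * S c by rewrite mulr_ge0 ?S_ge0.
  have Cm : C (a - c) = C a * C c + ka * S a * S c by exact: CB.
  have Cp : C (a + c) = C a * C c - ka * S a * S c.
    by rewrite -[c in LHS]opprK CB CN SN; ring.
  have dac : dom (a + c) by split; [lra|move=> _; lra].
  have dac' : dom `|a - c|.
    split => // _; rewrite ler_norml; apply/andP; split; lra.
  have h1 : ka * C b <= ka * C (a - c).
    rewrite -(C_norm (a - c)); apply: C_dec' => //; rewrite ler_norml; apply/andP; split; lra.
  have h2 : ka * C (a + c) <= ka * C b by exact: C_dec'.
  have kk x : ka * (ka * x) = x by rewrite mulrA -expr2 ka2 mul1r.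
  set w := ka * (C b - C a * C c).
  have w1 : - (S a * S c) <= w.
    have -> : - (S a * S c) = ka * (C (a + c) - C a * C c).
      by rewrite Cp -[in LHS](kk (S a * S c)); ring.
    by rewrite /w !mulrBr lerD2r.
  have w2 : w <= S a * S c.
    have -> : S a * S c = ka * (C (a - c) - C a * C c).
      by rewrite Cm -[in LHS](kk (S a * S c)); ring.
    by rewrite /w !mulrBr lerD2r.
  (* In the degenerate case the two bounds on [w] collapse to [w = 0], and any angle solves the
     equation. *)
  have [SS|SS] := eqVneq (S a * S c) 0.
    exists 1, 0; split; first exact: one.
    rewrite SS mul0r mulr0 addr0.
    have w0 : w = 0 by lra.
    have : ka * w = 0 by rewrite w0 mulr0.
    by rewrite /w kk; lra.
  have SSp : 0 < S a * S c by rewrite lt_neqAle eq_sym SS.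
  pose u := w / (S a * S c).
  have u2 : u ^+ 2 <= 1.
    by rewrite sqr_le1E ler_pdivlMr// ler_pdivrMr// mulN1r mul1r w1.
  exists u, (Num.sqrt (1 - u ^+ 2)); rewrite sqr_sqrtr ?subr_ge0// subrKC; split => //.
  by rewrite /u mulrC [_ * (w / _)]mulrC divfK// mulrC /w kk; ring.
exists (polar a 1 0), (polar c u v); split.
- exact: polardom.
- exact: polardom.
- exact: uv0.
- by rewrite /dl bf_polar mul1r mul0r addr0 E arcK.
- exact: uv0.
Qed.

Lemma curved_metric (M : Type) (d : M -> M -> R) (emb : M -> pt) (k : R) : 0 < k ->
  injective emb -> (forall x, car (emb x)) ->
  (forall x y, d x y = arc (bf (emb x) (emb y)) / k) -> is_metric d.
Proof.
move=> k0 inj ce dE; have dle x y : 0 <= dl (emb x) (emb y).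
  by have [] := arc_dom (bf_val (ce x) (ce y)).
split; [|split; [|split]].
- by move=> x y; rewrite dE; apply: divr_ge0; [exact: dle|exact: ltW].
- move=> x y; rewrite dE; split; last by move=> ->; rewrite (ce y).1 -C0 arcK// mul0r.
  move=> /eqP; rewrite mulf_eq0 invr_eq0 (gt_eqF k0) orbF => /eqP d0.
  apply: inj; apply: bf_eq1 => //.
  by rewrite -[LHS](Carc (bf_val (ce x) (ce y))) d0.
- by move=> x y; rewrite !dE bfC.
- by move=> x y z; rewrite !dE -mulrDl ler_wpM2r ?invr_ge0 ?(ltW k0)//; exact: dl_triangle.
Qed.

(** The radius is a quarter of a great circle, so two rescaled sides add up to at most [pi], as
    [curved_triangle] asks. The hyperbolic plane shares it to keep a single proof. *)
Lemma curved_good (M : Type) (d : M -> M -> R) (emb : M -> pt) :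
  injective emb -> (forall x, car (emb x)) -> (forall p, car p -> exists x, emb x = p) ->
  (forall x y, d x y = arc (bf (emb x) (emb y)) / Num.sqrt A) ->
  exists p0, good_model d p0 (pi / (2 * Num.sqrt A)).
Proof.
move=> inj ce surj dE.
have k0 : 0 < Num.sqrt A by rewrite sqrtr_gt0.
have [p0 ep0] := surj _ curved_base.
have dm := curved_metric k0 inj ce dE.
have pi0 := @pi_gt0 R.
exists p0; split => //.
- by rewrite divr_gt0// mulr_gt0.
- move=> p q pq; have [d0 [d00 _]] := dm.
  have [pqE|pq0] := eqVneq (d p q) 0.
    exists (fun=> p); have -> : q = p by apply/esym/d00.
    by do 2 split => //; move=> s t _ _; rewrite !(d00 p p).2// mulr0.
  have dpq : 0 < d p q by rewrite lt_neqAle eq_sym pq0 d0.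
  have dlE : dl (emb p) (emb q) = d p q * Num.sqrt A by rewrite dE divfK// gt_eqF.
  have dl0 : 0 < dl (emb p) (emb q) by rewrite dlE mulr_gt0.
  have dlpi : ka = 1 -> dl (emb p) (emb q) < pi.
    move=> _; rewrite dlE -ltr_pdivlMr//; apply: lt_le_trans pq _.
    by rewrite invfM mulrA ler_pM2r ?invr_gt0// ler_pdivrMr; lra.
  have [g [cg g0 g1 gd]] := curved_geodesic (ce p) (ce q) dl0 dlpi.
  have h01 : 0 <= (0 : R) <= 1 by rewrite lexx ler01.
  have h11 : 0 <= (1 : R) <= 1 by rewrite lexx ler01.
  have H s : exists m : M, 0 <= s <= 1 -> emb m = g s.
    have [h|h] := boolP (0 <= s <= 1); last by exists p.
    by have [m Em] := surj _ (cg s h); exists m.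
  have [g' Hg'] := boolp.choice H; exists g'; split; last split.
  + by apply: inj; rewrite Hg'.
  + by apply: inj; rewrite Hg'.
  + by move=> s t s01 t01; rewrite !dE !Hg'// mulrA; congr (_ / _); exact: gd.
- move=> a b c /andP[a0 ar] /andP[b0 br] /andP[c0 cr] abc bac cab.
  have k0' : 0 <= Num.sqrt A by exact: ltW.
  have lt_half x : x < pi / (2 * Num.sqrt A) -> x * Num.sqrt A < pi / 2.
    by rewrite invfM mulrA ltr_pdivlMr.
  have le_k x y z : x <= y + z -> x * Num.sqrt A <= y * Num.sqrt A + z * Num.sqrt A.
    by move=> h; rewrite -mulrDl ler_wpM2r.
  have acpi : a * Num.sqrt A + c * Num.sqrt A <= pi.
    by have := lt_half _ ar; have := lt_half _ cr; lra.
  have [q [r [cq cr' e1 e2 e3]]] := curved_triangle (mulr_ge0 a0 k0') (mulr_ge0 b0 k0')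
    (mulr_ge0 c0 k0') (le_k _ _ _ abc) (le_k _ _ _ bac) (le_k _ _ _ cab) acpi.
  have [y ey] := surj _ cq; have [z ez] := surj _ cr'.
  by exists y, z; rewrite !dE ep0 ey ez; split; rewrite ?[arc _]e1 ?[arc _]e2 ?[arc _]e3 mulfK// gt_eqF.
Qed.

End curved.
End ConstantCurvature.

(** * The three signs of the curvature *)

Section ModelPlane.
Variable R : realType.
Local Notation pt := (R * R * R)%type.

Lemma sval_M2_inj (K : R) : injective (fun x : M2pt K => sval x).
Proof. by move=> [x xc] [y yc] /= E; subst y; congr exist; exact: Prop_irrelevance. Qed.

Lemma M2_lift (K : R) (g : R -> pt) : (forall s, 0 <= s <= 1 -> M2_carrier K (g s)) ->
  exists g' : R -> M2pt K, forall s, 0 <= s <= 1 -> sval (g' s) = g s.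
Proof.
move=> cg; have h01 : 0 <= (0 : R) <= 1 by rewrite lexx ler01.
have H s : exists m : M2pt K, 0 <= s <= 1 -> sval m = g s.
  have [h|h] := boolP (0 <= s <= 1); first by exists (exist _ (g s) (cg s h)).
  by exists (exist _ (g 0) (cg 0 h01)).
by have [g' Hg'] := boolp.choice H; exists g'.
Qed.

Definition rsinh (x : R) : R := (expR x - expR (- x)) / 2.

Lemma rcosh_sinh (x : R) : rcosh x ^+ 2 - rsinh x ^+ 2 = 1.
Proof.
have E : expR x * expR (- x) = 1 by rewrite -expRD subrr expR0.
have -> : rcosh x ^+ 2 - rsinh x ^+ 2 = expR x * expR (- x).
  by rewrite /rcosh /rsinh; field.
exact: E.
Qed.

Lemma rsinh_gt0 (x : R) : 0 < x -> 0 < rsinh x.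
Proof. by move=> x0; rewrite divr_gt0// subr_gt0 ltr_expR; lra. Qed.

Lemma rcosh_ge1 (x : R) : 1 <= rcosh x.
Proof.
have := expR_gt0 x => e0.
have E : expR x * expR (- x) = 1 by rewrite -expRD subrr expR0.
rewrite -subr_ge0.
have -> : rcosh x - 1 = (expR x - 1) ^+ 2 * (2 * expR x)^-1.
  have -> : rcosh x = (expR x + (expR x)^-1) / 2 by rewrite /rcosh expRN.
  by field; rewrite gt_eqF.
by rewrite mulr_ge0 ?sqr_ge0// invr_ge0 mulr_ge0// ltW.
Qed.

Lemma acosh_rcosh (x : R) : 0 <= x -> acosh (rcosh x) = x.
Proof.
move=> x0; have s0 : 0 <= rsinh x.
  by move: x0; rewrite le_eqVlt => /predU1P[<-|/rsinh_gt0/ltW//]; rewrite /rsinh oppr0 subrr mul0r.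
have E : rcosh x ^+ 2 - 1 = rsinh x ^+ 2 by have := rcosh_sinh x; lra.
rewrite /acosh E sqrtr_sqr ger0_norm// -[RHS]expRK; congr ln.
by rewrite /rcosh /rsinh; field.
Qed.

Lemma rcosh_acosh (b : R) : 1 <= b -> rcosh (acosh b) = b /\ 0 <= acosh b.
Proof.
move=> b1; have b2 : 0 <= b ^+ 2 - 1 by rewrite subr_ge0 -(expr1n _ 2) ler_pXn2r// nnegrE; lra.
set y := b + Num.sqrt (b ^+ 2 - 1).
have s0 := sqrtr_ge0 (b ^+ 2 - 1).
have y1 : 1 <= y by rewrite /y; lra.
have y0 : 0 < y by lra.
split; last by rewrite /acosh ln_ge0.
rewrite /rcosh /acosh -/y expRN lnK//.
have E : y * (b - Num.sqrt (b ^+ 2 - 1)) = 1.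
  have -> : y * (b - Num.sqrt (b ^+ 2 - 1)) = b ^+ 2 - Num.sqrt (b ^+ 2 - 1) ^+ 2 by rewrite /y; ring.
  by rewrite sqr_sqrtr//; ring.
have -> : y^-1 = b - Num.sqrt (b ^+ 2 - 1).
  have yn : y != 0 by rewrite gt_eqF.
  by apply: (mulfI yn); rewrite E divff.
by rewrite /y; field.
Qed.

Lemma M2_sphere (K : R) : 0 < K -> exists p0, good_model (@M2d R K) p0 (pi / (2 * Num.sqrt K)).
Proof.
move=> K0; have n1 : (1 : R) <> -1 by move=> h; lra.
apply: (@curved_good R K 1 cos sin acos K0 (or_introl erefl) _ _ _ _ _ _ _ _ _
  (M2pt K) (@M2d R K) (fun x => sval x)).
- by move=> x; rewrite mul1r cos2Dsin2.
- by move=> x y; rewrite mul1r cosB.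
- by move=> x y; rewrite sinB.
- by move=> x x0 /(_ erefl) xpi; rewrite sin_gt0_pi// x0.
- by move=> _; exact: sinpi.
- move=> x y [x0 /(_ erefl) xpi] [y0 /(_ erefl) ypi] xy; rewrite !mul1r ltr_cos// in_itv/=.
    by rewrite x0.
  by rewrite y0.
- by move=> x [x0 /(_ erefl) xpi]; rewrite cosK// in_itv/= x0.
- by move=> b [/(_ erefl) hb _]; rewrite acosK// in_itv.
- by move=> b [/(_ erefl) hb _]; split; [exact: acos_ge0|move=> _; exact: acos_lepi].
- exact: sval_M2_inj.
- move=> [p cp]; split => //; move: cp; rewrite /M2_carrier K0 /edot /bform/= => cp.
  by rewrite mul1r addrA cp divff// gt_eqF.
- move=> p [cp _]; have H : M2_carrier K p.
    rewrite /M2_carrier K0 /edot; apply: (mulfI (lt0r_neq0 K0)).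
    by rewrite divff ?gt_eqF// -cp /bform; ring.
  by exists (exist _ p H).
- by move=> x y; rewrite /M2d /M2_dist K0; congr (acos _ / _); rewrite /edot /bform; ring.
Qed.

Lemma M2_hyperbolic (K : R) : K < 0 ->
  exists p0, good_model (@M2d R K) p0 (pi / (2 * Num.sqrt (- K))).
Proof.
move=> K0; have n1 : (-1 : R) <> 1 by move=> h; lra.
have nK0 : 0 < - K by rewrite oppr_gt0.
have K0' : (0 < K) = false by apply/negbTE; rewrite -leNgt ltW.
have K0'' : (K == 0) = false by rewrite lt_eqF.
have rc2 (x : R) : rcosh x ^+ 2 + -1 * rsinh x ^+ 2 = 1 by rewrite mulN1r rcosh_sinh.
have eB (x y : R) : expR (x - y) = expR x * expR (- y) by rewrite expRD.
have eB' (x y : R) : expR (- (x - y)) = expR (- x) * expR y by rewrite opprB addrC expRD.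
apply: (@curved_good R (- K) (-1) (@rcosh R) rsinh (@acosh R) nK0 (or_intror erefl) _ _ _ _ _ _ _ _ _
  (M2pt K) (@M2d R K) (fun x => sval x)) => //.
- by move=> x y; rewrite /rcosh /rsinh eB eB'; field.
- by move=> x y; rewrite /rcosh /rsinh eB eB'; field.
- by move=> x x0 _; exact: rsinh_gt0.
- move=> x y [x0 _] [y0 _] xy; rewrite !mulN1r ltrN2.
  have s2 : rsinh x ^+ 2 < rsinh y ^+ 2.
    have sx : 0 <= rsinh x.
      move: x0; rewrite le_eqVlt => /predU1P[<-|/rsinh_gt0/ltW//].
      by rewrite /rsinh oppr0 subrr mul0r.
    have sxy : rsinh x < rsinh y.
      rewrite /rsinh ltr_pM2r ?invr_gt0//; apply: ltrB; first by rewrite ltr_expR.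
      by rewrite ltr_expR ltrN2.
    by rewrite ltr_pXn2r// nnegrE; lra.
  have c1 := rcosh_ge1 x; have c2 := rcosh_ge1 y.
  by rewrite -(ltr_pXn2r (n := 2)) ?nnegrE//; [have := rc2 x; have := rc2 y|..]; lra.
- by move=> x [x0 _]; exact: acosh_rcosh.
- by move=> b [_ /(_ erefl)/rcosh_acosh[]].
- by move=> b [_ /(_ erefl)/rcosh_acosh[_ ?]]; split.
- exact: sval_M2_inj.
- move=> [p cp]; move: cp; rewrite /M2_carrier K0' K0'' /ldot => -[cp p0]; split => //=.
  transitivity (K * K^-1); last by rewrite divff// lt_eqF.
  by rewrite -cp /bform; ring.
- move=> p [cp /(_ erefl) p0]; have H : M2_carrier K p.
    rewrite /M2_carrier K0' K0'' /ldot; split => //.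
    have Kn : K != 0 by rewrite lt_eqF.
    by apply: (mulfI Kn); rewrite divff// -cp /bform; ring.
  by exists (exist _ p H).
- by move=> x y; rewrite /M2d /M2_dist K0' K0''; congr (acosh _ / _); rewrite /ldot /bform; ring.
Qed.

(** Minkowski's inequality in the plane. *)
Lemma sqrt_le_norm (u v u' v' : R) : Num.sqrt ((u + u') ^+ 2 + (v + v') ^+ 2) <=
  Num.sqrt (u ^+ 2 + v ^+ 2) + Num.sqrt (u' ^+ 2 + v' ^+ 2).
Proof.
set a := Num.sqrt (u ^+ 2 + v ^+ 2); set b := Num.sqrt (u' ^+ 2 + v' ^+ 2).
have a0 : 0 <= a by exact: sqrtr_ge0.
have b0 : 0 <= b by exact: sqrtr_ge0.
have a2 : a ^+ 2 = u ^+ 2 + v ^+ 2 by rewrite sqr_sqrtr// addr_ge0 ?sqr_ge0.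
have b2 : b ^+ 2 = u' ^+ 2 + v' ^+ 2 by rewrite sqr_sqrtr// addr_ge0 ?sqr_ge0.
have CSi : u * u' + v * v' <= a * b.
  have [h|h] := leP (u * u' + v * v') 0; first by apply: le_trans h _; exact: mulr_ge0.
  rewrite -(ler_pXn2r (n := 2)) ?nnegrE ?mulr_ge0 ?(ltW h)// exprMn a2 b2 -subr_ge0.
  have -> : (u ^+ 2 + v ^+ 2) * (u' ^+ 2 + v' ^+ 2) - (u * u' + v * v') ^+ 2 =
    (u * v' - v * u') ^+ 2 by ring.
  exact: sqr_ge0.
rewrite -(ler_pXn2r (n := 2)) ?nnegrE ?sqrtr_ge0 ?addr_ge0//.
rewrite sqr_sqrtr ?addr_ge0 ?sqr_ge0//.
have -> : (a + b) ^+ 2 = a ^+ 2 + b ^+ 2 + 2 * (a * b) by ring.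
by rewrite a2 b2; lra.
Qed.

(** The plane is outside the family of quadrics of the curved case and uses the Euclidean law of
    cosines; the radius 1 is an arbitrary scale. *)
Lemma M2_flat : exists p0, good_model (@M2d R 0) p0 1.
Proof.
have car0 (p : pt) : M2_carrier 0 p = (p.2 = 0) by rewrite /M2_carrier ltxx eqxx.
have dE (x y : M2pt 0) : M2d x y =
   Num.sqrt (((sval x).1.1 - (sval y).1.1) ^+ 2 + ((sval x).1.2 - (sval y).1.2) ^+ 2).
  by rewrite /M2d /M2_dist ltxx eqxx.
have c0 : M2_carrier 0 (0 : R, 0 : R, 0 : R) by rewrite car0.
exists (exist _ (0, 0, 0) c0); split => //.
- split; [|split; [|split]].
  + by move=> x y; rewrite dE sqrtr_ge0.
  + move=> x y; rewrite dE; split; last first.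
      by move=> ->; rewrite !subrr expr0n addr0 sqrtr0.
    move=> /eqP; rewrite sqrtr_eq0 => h; apply: sval_M2_inj.
    have : (((sval x).1.1 - (sval y).1.1) ^+ 2 + ((sval x).1.2 - (sval y).1.2) ^+ 2) == 0.
      by rewrite eq_le h addr_ge0 ?sqr_ge0.
    rewrite paddr_eq0 ?sqr_ge0// !sqrf_eq0 !subr_eq0 => /andP[/eqP h1 /eqP h2].
    move: x y h1 h2 {h} => [[[x1 x2] x3] cx] [[[y1 y2] y3] cy]/= -> ->.
    by move: cx cy; rewrite !car0/= => -> ->.
  + by move=> x y; rewrite !dE -(sqrrN (_ - _)) opprB -(sqrrN ((sval x).1.2 - _)) opprB.
  + move=> x y z; rewrite !dE; apply: le_trans (sqrt_le_norm _ _ _ _).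
    by rewrite !addrA !subrK.
- move=> p q _.
  pose g (s : R) : pt := ((1 - s) * (sval p).1.1 + s * (sval q).1.1,
    (1 - s) * (sval p).1.2 + s * (sval q).1.2, 0).
  have [|g' Hg'] := @M2_lift 0 g; first by move=> s _; rewrite car0.
  have ends (x : M2pt (0 : R)) : sval x = ((sval x).1.1, (sval x).1.2, 0).
    have x2 : (sval x).2 = 0 by rewrite -car0; exact: svalP.
    by case: (sval x) x2 => [[x1 y1] z1]/= ->.
  exists g'; split; last split.
  + by apply: sval_M2_inj; rewrite Hg' ?lexx ?ler01// ends /g subr0 !mul1r !mul0r !addr0.
  + by apply: sval_M2_inj; rewrite Hg' ?lexx ?ler01// ends /g subrr !mul1r !mul0r !add0r.
  + move=> s t s01 t01; rewrite !dE !Hg'// /g/= -sqrtr_sqr -sqrtrM ?sqr_ge0//.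
    by congr Num.sqrt; ring.
- move=> a b c /andP[a0 _] /andP[b0 _] /andP[c00 _] abc bac cab.
  have [u [v [uv E]]] : exists u v : R, u ^+ 2 + v ^+ 2 = 1 /\
      a ^+ 2 + c ^+ 2 - 2 * (a * c * u) = b ^+ 2.
    have b1 : b ^+ 2 <= (a + c) ^+ 2 by rewrite ler_pXn2r// nnegrE addr_ge0.
    have b2 : (a - c) ^+ 2 <= b ^+ 2.
      by rewrite -[(a - c) ^+ 2]real_normK ?num_real// ler_pXn2r ?nnegrE// ler_norml; apply/andP; split; lra.
    have [ac|ac] := eqVneq (a * c) 0.
      exists 1, 0; rewrite expr1n expr0n addr0 ac mul0r mulr0 subr0; split => //.
      by apply/eqP; rewrite eq_le; apply/andP; split; lra.
    have acp : 0 < a * c by rewrite lt_neqAle eq_sym ac mulr_ge0.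
    pose u := (a ^+ 2 + c ^+ 2 - b ^+ 2) / (2 * (a * c)).
    have u2 : u ^+ 2 <= 1.
      have ac2 : 0 < 2 * (a * c) by exact: mulr_gt0.
      rewrite sqr_le1E; apply/andP; split.
        by rewrite (ler_pdivlMr _ _ ac2); lra.
      by rewrite (ler_pdivrMr _ _ ac2); lra.
    exists u, (Num.sqrt (1 - u ^+ 2)); rewrite sqr_sqrtr ?subr_ge0// subrKC; split => //.
    by rewrite /u; field; move: ac; rewrite mulf_eq0 negb_or => /andP[-> ->].
  have cy : M2_carrier 0 (a, 0, 0) by rewrite car0.
  have cz : M2_carrier 0 (c * u, c * v, 0) by rewrite car0.
  exists (exist _ _ cy), (exist _ _ cz); rewrite !dE/=; split.
  + by rewrite sub0r subrr expr0n addr0 sqrrN sqrtr_sqr ger0_norm.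
  + rewrite -[RHS](ger0_norm b0) -sqrtr_sqr -E; congr Num.sqrt.
    transitivity (a ^+ 2 - 2 * (a * c * u) + c ^+ 2 * (u ^+ 2 + v ^+ 2)); first by ring.
    by rewrite uv; ring.
  + rewrite -[RHS](ger0_norm c00) -sqrtr_sqr; congr Num.sqrt.
    transitivity (c ^+ 2 * (u ^+ 2 + v ^+ 2)); first by ring.
    by rewrite uv mulr1.
Qed.

(** The bound on [3 * r] gives the perimeter condition of [alex_cmp] to every triangle with sides
    below [r]. *)
Lemma M2_good (K : R) : exists p0 r, good_model (@M2d R K) p0 r /\
  (0 < K -> 3 * r < 2 * pi / Num.sqrt K).
Proof.
have [K0|K0|->] := ltgtP K 0.
- have [p0 H] := M2_hyperbolic K0; exists p0, (pi / (2 * Num.sqrt (- K))); split => // h; lra.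
- have [p0 H] := M2_sphere K0; exists p0, (pi / (2 * Num.sqrt K)); split => // _.
  have k0 : 0 < Num.sqrt K by rewrite sqrtr_gt0.
  have := @pi_gt0 R => pi0.
  rewrite ltr_pdivlMr//.
  have -> : 3 * (pi / (2 * Num.sqrt K)) * Num.sqrt K = 3 / 2 * pi by field; rewrite gt_eqF.
  lra.
- by have [p0 H] := M2_flat; exists p0, 1; split => //; rewrite ltxx.
Qed.

End ModelPlane.

(** * Transfer of curvature bounds *)

Section LiftSide.
Variable R : realType.
Variables (I : set R) (f : R -> R) (X M : Type) (d : X -> X -> R) (dM : M -> M -> R).
Hypotheses (fc : cont_on I f) (f0 : forall t, I t -> 0 < f t).
Hypotheses (mX : is_metric d) (mM : is_metric dM).
Local Notation CX := (cone I f d).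
Local Notation CM := (cone I f dM).

(** The side projects to a reparametrization of [gX]; running [h] with the same parameter [th]
    preserves all fibre distances along the side, hence all values of [tau] on it. *)
Lemma lift_side (g : R -> R * X) a b (x y : R * X) :
  maximal_curve (S := CX) g a b x y -> geodesic_space d ->
  (forall s t, a <= s <= b -> a <= t <= b -> forall p q,
     dM p q = d (g s).2 (g t).2 -> exists h, geod_seg dM h p q) ->
  (exists2 m, 0 < m & forall t, x.1 <= t <= y.1 -> m <= f t) ->
  exists gX, geod_seg d gX x.2 y.2 /\
  forall w w' h, dM w w' = d x.2 y.2 -> geod_seg dM h w w' ->
  exists g' : R -> R * M, maximal_curve (S := CM) g' a b (x.1, w) (y.1, w') /\
  forall s, a <= s <= b ->
    ltau (S := CM) (x.1, w) (g' s) = ltau (S := CX) x (g s) /\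
    exists th, [/\ 0 <= th <= 1, g s = ((g s).1, gX th) & g' s = ((g s).1, h th)].
Proof.
move=> mx gsX gsM fm; have [C0 [ga [gb _]]] := mx.
have ab : a < b by case: C0.
have aI : a <= a <= b by rewrite lexx ltW.
have bI : a <= b <= b by rewrite lexx ltW.
have [gX [gXs HgX]] := maximal_geodesic fc f0 mX mx (gsX _ _) fm.
exists gX; split => // w w' h ww' hs.
pose th s := d x.2 (g s).2 / d x.2 y.2.
pose be' s := h (th s).
have dbe s t : a <= s <= b -> a <= t <= b -> dM (be' s) (be' t) = d (g s).2 (g t).2.
  move=> sI tI; have [es s01] := HgX _ sI; have [et t01] := HgX _ tI.
  by rewrite es et -/(th s) -/(th t) gXs.2.2// hs.2.2// ww'.
have bea : be' a = w by rewrite /be' /th ga (mX.2.1 x.2 x.2).2// mul0r hs.1.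
have beb : be' b = w'.
  rewrite /be' /th gb; have [D0|D0] := eqVneq (d x.2 y.2) 0; last by rewrite divff// hs.2.1.
  by rewrite D0 mul0r hs.1; apply/mM.2.1; rewrite ww'.
exists (fun t => ((g t).1, be' t)).
have gW s t : a <= s <= b -> a <= t <= b -> exists sg, geod_seg dM sg (be' s) (be' t).
  by move=> sI tI; exact: gsM sI tI _ _ (dbe _ _ sI tI).
have gZ s t : a <= s <= b -> a <= t <= b -> exists sg, geod_seg d sg (g s).2 (g t).2.
  by move=> _ _; exact: gsX.
split.
  by have := lift_maximal fc f0 mX mM dbe gZ gW mx; rewrite bea beb.
move=> s sI; split.
  by have := lift_ltau fc f0 mX mM dbe gZ gW aI sI; rewrite bea ga.
by have [es s01] := HgX _ sI; exists (th s); split => //; rewrite -es -surjective_pairing.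
Qed.

End LiftSide.

(* Causally convex as soon as m bounds f from below. *)
Definition diamond (R : realType) (X : Type) (d : X -> X -> R) (m t0 rho : R) (x0 : X) :
    set (R * X) := [set y | `|y.1 - t0| + m * d x0 y.2 < rho].

(** * The conditions of a timelike curvature bound on a small diamond *)

Section Diamond.
Variable R : realType.
Variables (I : set R) (f : R -> R) (X M : Type) (d : X -> X -> R) (dM : M -> M -> R).
Variables (t0 : R) (x0 : X) (p0 : M) (m r rho : R).
Hypotheses (fc : cont_on I f) (f0 : forall t, I t -> 0 < f t).
Hypotheses (mX : is_metric d) (gsX : geodesic_space d) (gmM : good_model dM p0 r).
Hypotheses (m0 : 0 < m) (mf : forall t, `|t - t0| < rho -> m <= f t).
Hypothesis (rhor : 4 * rho <= m * r).
Local Notation CX := (cone I f d).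
Local Notation CM := (cone I f dM).

Local Notation U := (diamond d m t0 rho x0).

Variable UU : set (R * M).
Hypothesis UUin : forall t p, `|t - t0| < rho -> m * dM p0 p < 4 * rho -> UU (t, p).

Let mM : is_metric dM. Proof. by case: gmM. Qed.
Let dX0 x y : 0 <= d x y. Proof. by case: mX. Qed.
Let dXxx x : d x x = 0. Proof. exact/mX.2.1. Qed.
Let dXC x y : d x y = d y x. Proof. by case: mX => _ [_ []]. Qed.
Let dXT x y z : d x z <= d x y + d y z. Proof. by case: mX => _ [_ []]. Qed.
Let dMxx x : dM x x = 0. Proof. exact/mM.2.1. Qed.
Let dMT x y z : dM x z <= dM x y + dM y z. Proof. by case: mM => _ [_ []]. Qed.
Let r0 : 0 < r. Proof. by case: gmM. Qed.
Let gM p q : dM p q < r -> exists g, geod_seg dM g p q. Proof. by case: gmM => _ _ + _; exact. Qed.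
Let tM a b c : 0 <= a < r / 2 -> 0 <= b < r / 2 -> 0 <= c < r / 2 -> a <= b + c -> b <= a + c ->
  c <= a + b -> exists y z, [/\ dM p0 y = a, dM y z = b & dM p0 z = c].
Proof.
have rr : r / 2 < r by have := r0; lra.
case: gmM => _ _ _ H /andP[a0 /lt_trans/(_ rr) ar] /andP[b0 /lt_trans/(_ rr) br].
by move=> /andP[c0 /lt_trans/(_ rr) cr]; apply: H; apply/andP.
Qed.
Let md0 x y : 0 <= m * d x y. Proof. by rewrite mulr_ge0 ?(ltW m0). Qed.

Lemma diamond_time y : U y -> `|y.1 - t0| < rho.
Proof. by apply: le_lt_trans; rewrite lerDl. Qed.

Lemma diamond_rad y : U y -> m * d x0 y.2 < rho.
Proof. by apply: le_lt_trans; rewrite lerDr. Qed.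

Lemma diamond_diam u v : U u -> U v -> m * d u.2 v.2 < 2 * rho.
Proof.
move=> /diamond_rad hu /diamond_rad hv.
have : m * d u.2 v.2 <= m * (d x0 u.2 + d x0 v.2).
  rewrite ler_wpM2l ?(ltW m0)//; apply: le_trans (dXT u.2 x0 v.2) _.
  by rewrite (dXC u.2 x0).
by rewrite mulrDr; lra.
Qed.

(** Half of [r] leaves room for one segment of length [r / 2] in the model on which every distance
    within the diamond can be marked off. *)
Lemma diamond_lt u v : U u -> U v -> d u.2 v.2 < r / 2.
Proof. by move=> Uu Uv; rewrite -(ltr_pM2l m0); move: (diamond_diam Uu Uv) rhor; lra. Qed.

Let drange u v : U u -> U v -> 0 <= d u.2 v.2 < r / 2.
Proof. by move=> Uu Uv; rewrite dX0 diamond_lt. Qed.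

Let time_between u v t : U u -> U v -> u.1 <= t <= v.1 -> m <= f t.
Proof.
move=> /diamond_time + /diamond_time; rewrite !ltr_norml => hu hv tuv.
by apply: mf; rewrite ltr_norml; lra.
Qed.

Let gMd u v p q : U u -> U v -> dM p q <= d u.2 v.2 -> exists g, geod_seg dM g p q.
Proof. by move=> Uu Uv h; apply: gM; have := diamond_lt Uu Uv; have := r0; lra. Qed.

Let UU_p0 u : U u -> UU (u.1, p0).
Proof.
move=> Uu; apply: UUin; first exact: diamond_time.
by rewrite dMxx mulr0; have := diamond_time Uu; have := normr_ge0 (u.1 - t0); lra.
Qed.

Let UU_dist u v w p : U u -> U v -> U w -> dM p0 p = d u.2 v.2 -> UU (w.1, p).
Proof.
move=> Uu Uv Uw E; apply: UUin; first exact: diamond_time.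
by rewrite E; have := diamond_diam Uu Uv; have := md0 u.2 v.2; lra.
Qed.

Let tau_eq u v w w' : U u -> U v -> dM w w' = d u.2 v.2 ->
  ltau (S := CM) (u.1, w) (v.1, w') = ltau (S := CX) u v.
Proof.
case: u v => [s z] [t z'] Uu Uv E; have [g hg] := gsX z z'.
have [|h hh] := gMd Uu Uv (p := w) (q := w'); first by rewrite E.
exact: esym (ltau_transfer fc f0 s t mX mM hg hh E).
Qed.

Let ll_imp u v w w' : U u -> U v -> dM w w' = d u.2 v.2 ->
  lll (S := CX) u v -> lll (S := CM) (u.1, w) (v.1, w').
Proof.
case: u v => [s z] [t z'] Uu Uv E uv.
have [|h hh] := gMd Uu Uv (p := w) (q := w'); first by rewrite E.
have le : dM w w' <= d z z' by rewrite E.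
exact (lll_mono fc f0 mX mM hh le uv).
Qed.

Let ex_dist D : 0 <= D < r / 2 -> exists p, dM p0 p = D.
Proof.
move=> /andP[D0 Dr]; have r2 : 0 < r / 2 by rewrite divr_gt0.
have [||||||p [q [h _ _]]] := @tM D 0 D; rewrite ?D0 ?Dr ?lexx ?r2 ?add0r ?addr0//.
  by rewrite addr_ge0.
by exists p.
Qed.

(** On the diamond, [tau u v] equals [tau] in the model cone between the point over [p0] at time
    [u.1] and the point at time [v.1] over a fixed ray at distance [d u.2 v.2] from [p0]. These
    points depend continuously on [u] and [v]. *)
Lemma diamond_cont :
  (forall u v, UU u -> UU v -> forall e, 0 < e -> exists del, 0 < del /\
     forall u' v', UU u' -> UU v' -> coneD dM u u' < del -> coneD dM v v' < del ->
       `|fine (ltau (S := CM) u' v') - fine (ltau (S := CM) u v)| < e) ->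
  forall u v, U u -> U v -> forall e, 0 < e -> exists del, 0 < del /\
     forall u' v', U u' -> U v' -> coneD d u u' < del -> coneD d v v' < del ->
       `|fine (ltau (S := CX) u' v') - fine (ltau (S := CX) u v)| < e.
Proof.
move=> H u v Uu Uv e e0.
have r4 : 0 < r / 2 by rewrite divr_gt0.
have rr : r / 2 < r by have := r0; lra.
have [zz dzz] : exists p, dM p0 p = r / 2.
  case: gmM => _ _ _ HM; have [||||||y [z [h _ _]]] := HM (r / 2) 0 (r / 2);
    rewrite ?(ltW r4) ?rr ?lexx ?r0 ?add0r ?addr0//; last by exists y.
  by rewrite addr_ge0 ?(ltW r4).
have [sg [sg0 [sg1 sgd]]] : exists g, geod_seg dM g p0 zz by apply: gM; rewrite dzz.
pose ray s := sg (s / (r / 2)).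
have rayd s s' : 0 <= s < r / 2 -> 0 <= s' < r / 2 -> dM (ray s) (ray s') = `|s - s'|.
  have nrm s1 : 0 <= s1 < r / 2 -> 0 <= s1 / (r / 2) <= 1.
    by move=> /andP[h1 /ltW h2]; rewrite divr_ge0 ?(ltW r4)// ler_pdivrMr// mul1r.
  move=> /nrm h1 /nrm h2; rewrite sgd// dzz -mulrBl normrM.
  by rewrite (gtr0_norm (_ : 0 < (r / 2)^-1)) ?invr_gt0// divfK// gt_eqF.
have ray0 : ray 0 = p0 by rewrite /ray mul0r.
have p0ray u' v' : U u' -> U v' -> dM p0 (ray (d u'.2 v'.2)) = d u'.2 v'.2.
  move=> h1 h2; rewrite -[in LHS]ray0 rayd ?drange//.
    by rewrite sub0r normrN ger0_norm.
  by rewrite lexx r4.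
have tauE u' v' : U u' -> U v' -> ltau (S := CX) u' v' =
    ltau (S := CM) (u'.1, p0) (v'.1, ray (d u'.2 v'.2)).
  by move=> h1 h2; exact: esym (tau_eq h1 h2 (p0ray _ _ h1 h2)).
have inray u' v' : U u' -> U v' -> UU (v'.1, ray (d u'.2 v'.2)).
  by move=> h1 h2; apply: (UU_dist h1 h2 h2); rewrite p0ray.
have [c [c0 Hc]] := H _ _ (UU_p0 Uu) (inray _ _ Uu Uv) e e0.
(* The position on the ray moves with both arguments, by at most the sum of their displacements. *)
exists (c / 2); split; first by rewrite divr_gt0.
move=> u' v' Uu' Uv' du dv.
rewrite [ltLHS](f_equal2 (fun s t : \bar R => `|fine s - fine t|) (tauE _ _ Uu' Uv')
  (tauE _ _ Uu Uv)); apply: Hc; [exact: UU_p0|exact: inray| |].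
  apply: (@le_lt_trans _ _ (c / 2)); last by lra.
  by apply: le_trans (ltW du); rewrite /coneD/= dMxx addr0 lerDl.
have dv1 : coneD dM (v.1, ray (d u.2 v.2)) (v'.1, ray (d u'.2 v'.2)) =
  `|v.1 - v'.1| + `|d u.2 v.2 - d u'.2 v'.2| by rewrite /coneD/= rayd ?drange.
rewrite dv1.
have h : `|d u.2 v.2 - d u'.2 v'.2| <= d u.2 u'.2 + d v.2 v'.2.
  have h1 := dXT u.2 u'.2 v.2; have h2 := dXT u'.2 v'.2 v.2.
  have h3 := dXT u'.2 u.2 v'.2; have h4 := dXT u.2 v.2 v'.2.
  rewrite (dXC v'.2) in h2; rewrite (dXC u'.2 u.2) in h3.
  rewrite ler_norml; move: h1 h2 h3 h4; move=> h1 h2 h3 h4.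
  by apply/andP; split; lra.
move: du dv h; rewrite /coneD; have := normr_ge0 (u.1 - u'.1); lra.
Qed.

(** A point later than [t0] is compared with the final endpoint and an earlier one with the initial
    endpoint: by [cone_curve_dist], the change of [m] times the fibre distance is paid for by the
    change of time. *)
Lemma diamond_convex (g : R -> R * X) a b : cone_curve false I f d g a b ->
  U (g a) -> U (g b) -> curve_in U g a b.
Proof.
move=> C Ua Ub s /andP[s1 s2].
have fm t : (g a).1 <= t <= (g b).1 -> m <= f t by exact: time_between.
have k1 := cone_curve_dist fc f0 mX C (ltW m0) fm (lexx a) s1 s2.
have k2 := cone_curve_dist fc f0 mX C (ltW m0) fm s1 s2 (lexx b).
have l1 : m * d x0 (g s).2 <= m * d x0 (g a).2 + m * d (g a).2 (g s).2.
  by rewrite -mulrDr ler_wpM2l ?(ltW m0).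
have l2 : m * d x0 (g s).2 <= m * d x0 (g b).2 + m * d (g s).2 (g b).2.
  by rewrite -mulrDr ler_wpM2l ?(ltW m0)// (dXC (g s).2).
move: Ua Ub l1 l2 k1 k2; rewrite /diamond/=.
have := ler_norm ((g b).1 - t0); have := ler_norm (- ((g a).1 - t0)); rewrite normrN.
by have [h|h] := ger0P ((g s).1 - t0); move: h; lra.
Qed.

(** Here the lift goes from the model to [X]: a maximal curve between points over [p0] and over [w],
    at the right distance, projects to a model geodesic, which is replaced by a geodesic of [X]. The
    result stays in the diamond by causal convexity. *)
Lemma diamond_geod :
  (forall u v, UU u -> UU v -> lll (S := CM) u v -> exists (g : R -> R * M) a b,
     lcausal (l := CM) g a b /\ g a = u /\ g b = v /\ curve_in UU g a b /\
     ltau_len (S := CM) g a b = ltau (S := CM) u v) ->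
  forall u v, U u -> U v -> lll (S := CX) u v -> exists (g : R -> R * X) a b,
    lcausal (l := CX) g a b /\ g a = u /\ g b = v /\ curve_in U g a b /\
    ltau_len (S := CX) g a b = ltau (S := CX) u v.
Proof.
move=> H u v Uu Uv uv.
have [w dw] := ex_dist (drange Uu Uv).
have [|sg hsg] := gMd Uu Uv (p := p0) (q := w); first by rewrite dw.
have uvM := ll_imp Uu Uv dw uv.
have [g [a [b [C0 [ga [gb [_ gl]]]]]]] := H _ _ (UU_p0 Uu) (UU_dist Uu Uv Uv dw) uvM.
have mx : maximal_curve (S := CM) g a b (u.1, p0) (v.1, w) by [].
have C : cone_curve false I f dM g a b := C0.
have ab : a <= b by case: C => /ltW.
have aI : a <= a <= b by rewrite lexx.
have bI : a <= b <= b by rewrite lexx ab.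
have fm : exists2 m, 0 < m & forall t, u.1 <= t <= v.1 -> m <= f t.
  by exists m => // t; exact: time_between.
have [gm [gms Hgm]] := maximal_geodesic fc f0 mM mx (ex_intro _ sg hsg) fm.
have [sX hsX] := gsX u.2 v.2.
rewrite /= in gms Hgm.
pose th s := dM p0 (g s).2 / dM p0 w.
pose be' s := sX (th s).
have dbe s t : a <= s <= b -> a <= t <= b -> d (be' s) (be' t) = dM (g s).2 (g t).2.
  move=> sI tI; have [es s01] := Hgm _ sI; have [et t01] := Hgm _ tI.
  by rewrite es et -/(th s) -/(th t) gms.2.2// hsX.2.2// dw.
have bea : be' a = u.2 by rewrite /be' /th ga dMxx mul0r hsX.1.
have beb : be' b = v.2.
  rewrite /be' /th gb /=; have [E|E] := eqVneq (dM p0 w) 0; last by rewrite divff// hsX.2.1.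
  by rewrite E mul0r hsX.1; apply/mX.2.1; rewrite -dw.
have gZ s t : a <= s <= b -> a <= t <= b -> exists sg, geod_seg dM sg (g s).2 (g t).2.
  move=> sI tI; apply: (gMd Uu Uv); have [es s01] := Hgm _ sI; have [et t01] := Hgm _ tI.
  rewrite es et gms.2.2// dw -[leRHS]mul1r ler_wpM2r// ler_norml.
  by move: s01 t01; rewrite dw => /andP[? ?] /andP[? ?]; apply/andP; split; lra.
have gW s t : a <= s <= b -> a <= t <= b -> exists sg, geod_seg d sg (be' s) (be' t).
  by move=> _ _; exact: gsX.
have := lift_maximal fc f0 mM mX dbe gZ gW mx.
rewrite bea beb /= -!surjective_pairing => -[C' [ga' [gb' gl']]].
eexists; exists a, b; split; first exact: C'.
split => //; split => //; split => //.
by apply: diamond_convex C' _ _; rewrite ?ga' ?gb'.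
Qed.

Section comparison.
Variables (lower : bool) (L : lstr R) (K' : R) (UX : set X).
Hypothesis UXin : forall y, U y -> UX y.2.
Hypothesis UUfin : forall u v, UU u -> UU v -> (ltau (S := CM) u v < +oo)%E.
Hypothesis cmpX : forall x y z gxy gyz gxz, UX x -> UX y -> UX z ->
  geod_seg d gxy x y -> geod_seg d gyz y z -> geod_seg d gxz x z ->
  d x y < r / 2 -> d y z < r / 2 -> d x z < r / 2 ->
  forall (x' y' z' : M) (sxy syz sxz : R -> M),
    dM x' y' = d x y -> dM y' z' = d y z -> dM x' z' = d x z ->
    geod_seg dM sxy x' y' -> geod_seg dM syz y' z' -> geod_seg dM sxz x' z' ->
    forall (g h : R -> X) (g' h' : R -> M),
      (g = gxy /\ g' = sxy \/ g = gyz /\ g' = syz \/ g = gxz /\ g' = sxz) ->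
      (h = gxy /\ h' = sxy \/ h = gyz /\ h' = syz \/ h = gxz /\ h' = sxz) ->
      forall s t, 0 <= s <= 1 -> 0 <= t <= 1 ->
        if lower then dM (g' s) (h' t) <= d (g s) (h t) else d (g s) (h t) <= dM (g' s) (h' t).

Let link (gX : R -> X) (h : R -> M) (u : R * X) (ub : R * M) :=
  exists th, [/\ 0 <= th <= 1, u = (u.1, gX th), ub = (u.1, h th) & U u].

(** The lifted side starts over a point within [2 rho / m] of [p0] and has fibre length below
    [2 rho / m], whence the [4 * rho] in [UUin]. Corresponding points survive because [tau] from the
    initial vertex is unchanged. *)
Let side (g : R -> R * X) a b (x y : R * X) : U x -> U y ->
  maximal_curve (S := CX) g a b x y -> curve_in U g a b ->
  exists gX, geod_seg d gX x.2 y.2 /\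
  forall w w' h, dM w w' = d x.2 y.2 -> geod_seg dM h w w' -> m * dM p0 w < 2 * rho ->
  exists g' : R -> R * M, [/\ maximal_curve (S := CM) g' a b (x.1, w) (y.1, w'),
    curve_in UU g' a b &
    forall (x' : lpt L) (k : R -> lpt L) c e u u',
      corr (S := CX) (M := L) x g a b x' k c e u u' -> exists ub, link gX h u ub /\
        corr (S := CM) (M := L) (x.1, w) g' a b x' k c e ub u'].
Proof.
move=> Ux Uy mx cu.
have fm : exists2 m, 0 < m & forall t, x.1 <= t <= y.1 -> m <= f t.
  by exists m => // t; exact: time_between.
have gs s t : a <= s <= b -> a <= t <= b -> forall p q,
    dM p q = d (g s).2 (g t).2 -> exists h, geod_seg dM h p q.
  by move=> sI tI p q E; apply: (gMd (cu _ sI) (cu _ tI)); rewrite E.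
have [gX [hX H]] := lift_side fc f0 mX mM mx gsX gs fm.
exists gX; split => // w w' h E hs pw.
have [g' [mx' H']] := H _ _ _ E hs.
exists g'; split => //.
  move=> s sI; have [_ [th [th01 _ ->]]] := H' _ sI.
  apply: UUin; first exact: diamond_time (cu _ sI).
  have h01 : 0 <= (0 : R) <= 1 by rewrite lexx ler01.
  have hw : dM w (h th) <= d x.2 y.2.
    rewrite -[in leLHS]hs.1 hs.2.2// sub0r normrN E ger0_norm; last by case/andP: th01.
    by rewrite -[leRHS]mul1r ler_wpM2r//; case/andP: th01.
  have : m * dM p0 (h th) <= m * dM p0 w + m * d x.2 y.2.
    rewrite -mulrDr ler_wpM2l ?(ltW m0)//; apply: le_trans (dMT p0 w (h th)) _.
    by rewrite lerD2l.
  by move: pw (diamond_diam Ux Uy); lra.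
move=> x' k c e u u' [[s [sI us]] [ex Eu]]; have [tE [th [th01 es es']]] := H' _ sI.
exists (g' s); split.
  by exists th; rewrite us; split; [exact: th01|exact: es|exact: es'|exact: cu].
have E2 : ltau x' u' = ltau (S := CM) (x.1, w) (g' s) by rewrite Eu us; exact: esym tE.
exact: (conj (ex_intro _ s (conj sI erefl)) (conj ex E2)).
Qed.

(** Side lengths agree, so one comparison triangle in [L] serves both cones. For a lower bound fibre
    distances in the model are smaller, so [tau] is larger there and lies in turn below its value in
    [L]; an upper bound reverses both inequalities. *)
Lemma diamond_cmp : tl_cmp lower (S := CM) L K' UU -> tl_cmp lower (S := CX) L K' U.
Proof.
move=> UUcmp x y z g1 g2 g3 a1 b1 a2 b2 a3 b3 Ux Uy Uz xy yz xz mx1 mx2 mx3 c1 c2 c3 sz.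
have [gX1 [hX1 L1]] := side Ux Uy mx1 c1.
have [gX2 [hX2 L2]] := side Uy Uz mx2 c2.
have [gX3 [hX3 L3]] := side Ux Uz mx3 c3.
have [py [pz [e1 e2 e3]]] : exists py pz, [/\ dM p0 py = d x.2 y.2, dM py pz = d y.2 z.2 &
    dM p0 pz = d x.2 z.2].
  have t1 : d x.2 y.2 <= d y.2 z.2 + d x.2 z.2 by rewrite addrC (dXC y.2 z.2); exact: dXT.
  have t2 : d y.2 z.2 <= d x.2 y.2 + d x.2 z.2 by rewrite (dXC x.2 y.2); exact: dXT.
  exact: tM (drange Ux Uy) (drange Uy Uz) (drange Ux Uz) t1 t2 (dXT _ _ _).
have [|m1 hm1] := gMd Ux Uy (p := p0) (q := py); first by rewrite e1.
have [|m2 hm2] := gMd Uy Uz (p := py) (q := pz); first by rewrite e2.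
have [|m3 hm3] := gMd Ux Uz (p := p0) (q := pz); first by rewrite e3.
have p00 : m * dM p0 p0 < 2 * rho.
  by rewrite dMxx mulr0; move: (diamond_diam Ux Ux); rewrite dXxx mulr0.
have p0y : m * dM p0 py < 2 * rho by rewrite e1; exact: diamond_diam.
have [g1' [mx1' cu1 H1]] := L1 _ _ _ e1 hm1 p00.
have [g2' [mx2' cu2 H2]] := L2 _ _ _ e2 hm2 p0y.
have [g3' [mx3' cu3 H3]] := L3 _ _ _ e3 hm3 p00.
have A := cmpX (UXin Ux) (UXin Uy) (UXin Uz) hX1 hX2 hX3 (diamond_lt Ux Uy) (diamond_lt Uy Uz)
  (diamond_lt Ux Uz) e1 e2 e3 hm1 hm2 hm3.
move=> x' y' z' h1 h2 h3 cc1 d1 cc2 d2 cc3 d3 cx' cy' cz' t1 t2 t3 mh1 mh2 mh3 CC p q p' q'.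
have tr1 := tau_eq Ux Uy e1.
have tr2 := tau_eq Uy Uz e2.
have tr3 := tau_eq Ux Uz e3.
have ix := UU_p0 Ux.
have iy := UU_dist Ux Uy Uy e1.
have iz := UU_dist Ux Uz Uz e3.
pose pairs (g : R -> X) (g' : R -> M) :=
  g = gX1 /\ g' = m1 \/ g = gX2 /\ g' = m2 \/ g = gX3 /\ g' = m3.
have lk u u' : CC u u' -> exists g g' ub, [/\ pairs g g', link g g' u ub &
    corr (S := CM) (M := L) (x.1, p0) g1' a1 b1 x' h1 cc1 d1 ub u' \/
    corr (S := CM) (M := L) (y.1, py) g2' a2 b2 y' h2 cc2 d2 ub u' \/
    corr (S := CM) (M := L) (x.1, p0) g3' a3 b3 x' h3 cc3 d3 ub u'].
  move=> [/H1|[/H2|/H3]] [ub [l c]].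
  - have P : pairs gX1 m1 := or_introl (conj erefl erefl).
    exists gX1, m1, ub; split; [exact P|exact l|exact (or_introl c)].
  - have P : pairs gX2 m2 := or_intror (or_introl (conj erefl erefl)).
    exists gX2, m2, ub; split; [exact P|exact l|exact (or_intror (or_introl c))].
  - have P : pairs gX3 m3 := or_intror (or_intror (conj erefl erefl)).
    exists gX3, m3, ub; split; [exact P|exact l|exact (or_intror (or_intror c))].
move=> /lk[gp [gp' [pb [pp [tp [tp01 ep epb Up]] cp]]]].
move=> /lk[gq [gq' [qb [pq [tq [tq01 eq eqb Uq]] cq]]]].
have xzM := UUfin ix iz.
have szM : size_ok K' (fine (ltau (S := CM) (x.1, p0) (y.1, py)))
  (fine (ltau (S := CM) (y.1, py) (z.1, pz))) (fine (ltau (S := CM) (x.1, p0) (z.1, pz))).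
  have szE (s s' t t' e e' : \bar R) : s = s' -> t = t' -> e = e' ->
    size_ok K' (fine s') (fine t') (fine e') -> size_ok K' (fine s) (fine t) (fine e).
    by move=> -> -> ->.
  exact (szE _ _ _ _ _ _ tr1 tr2 tr3 sz).
rewrite -tr1 in t1; rewrite -tr2 in t2; rewrite -tr3 in t3.
have B := UUcmp _ _ _ _ _ _ _ _ _ _ _ _ ix iy iz (ll_imp Ux Uy e1 xy) (ll_imp Uy Uz e2 yz) xzM
  mx1' mx2' mx3' cu1 cu2 cu3 szM _ _ _ _ _ _ _ _ _ _ _ _ cx' cy' cz' t1 t2 t3 mh1 mh2 mh3
  _ _ _ _ cp cq.
have {}A := A _ _ _ _ pp pq _ _ tp01 tq01.
have dp : d p.2 q.2 = d (gp tp) (gq tq) by rewrite ep eq.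
(* Monotonicity needs a geodesic in the fibre with the smaller distance. In the lower case this is
   the model, where one exists because the distance is bounded by one within the diamond; in the
   upper case it is [X]. *)
move: A B; case: (lower) => A B.
  apply: le_trans B; rewrite epb eqb.
  have [|h hh] := gMd Up Uq (p := gp' tp) (q := gq' tq); first by rewrite dp.
  rewrite {1}ep {1}eq; exact (ltau_mono fc f0 mX mM _ _ hh A).
apply: le_trans B _; rewrite epb eqb.
have [h hh] := gsX (gp tp) (gq tq).
rewrite {2}ep {2}eq; exact (ltau_mono fc f0 mM mX _ _ hh A).
Qed.

End comparison.
End Diamond.

(* lower = true : "bounded below" throughout; lower = false : "bounded above" throughout *)
Theorem theorem5p3 (R : realType) (lower : bool) (K K' : R) (X : Type) (d : X -> X -> R)
    (I : set R) (f : R -> R) :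
  is_metric d -> geodesic_space d -> alex_curv_bound lower d K ->
  open_interval I -> {within I, continuous f} -> (forall t, I t -> 0 < f t) ->
  tl_curv_bound lower (cone I f (@M2d R K)) (coneD (@M2d R K)) (L2 K') K' ->
  tl_curv_bound lower (cone I f d) (coneD d) (L2 K') K'.
Proof.
move=> mX gsX alexX oI cf f0 HM [t0 x0] /= It0.
have fc := cont_onP oI cf.
have [p0 [r [gmM perim]]] := M2_good K.
have r0 : 0 < r by case: gmM.
set dM := @M2d R K in gmM HM *.
have [UU [[_ [r2 [r20 HUU]]] [UUfin [UUcont [UUgeo UUcmp]]]]] := HM (t0, p0) It0.
have [UX [[_ [r1 [r10 HUX]]] cmpX]] := alexX x0.
(* Continuity of [f] at [t0] with tolerance [f t0 / 2] leaves the same number as lower bound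
   nearby. *)
have m0 : 0 < f t0 / 2 by rewrite divr_gt0// f0.
set m := f t0 / 2 in m0.
have [r3 r30 Hr3] := fc t0 It0 m m0.
(* [r3] keeps times where [f >= m], [m * r1] keeps fibre points in [UX], and [m * r / 4] keeps
   comparison triangles small. Time distance below [rho] and fibre distance below [4 rho / m] add up
   to less than [rho (m + 4) / m], whence the bound from [r2]. *)
have [rho [rho0 rho1 rho2 rho3 rho4]] : exists rho, [/\ 0 < rho, rho <= r3, rho <= m * r1,
    4 * rho <= m * r & forall t e, t < rho -> m * e < 4 * rho -> t + e < r2].
  have m40 : 0 < m + 4 by rewrite addr_gt0.
  have h1 : 0 < m * r / 4 by rewrite divr_gt0// mulr_gt0.
  have h2 : 0 < m * r2 / (m + 4) by rewrite divr_gt0// mulr_gt0.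
  exists (Num.min r3 (Num.min (m * r1) (Num.min (m * r / 4) (m * r2 / (m + 4))))); split.
  - by rewrite !lt_min r30 h1 h2 mulr_gt0.
  - by rewrite ge_min lexx.
  - by rewrite !ge_min lexx orbT.
  - by rewrite mulrC -ler_pdivlMr// !ge_min lexx !orbT.
  - set rho := Num.min _ _ => t e ht he.
    have : rho <= m * r2 / (m + 4) by rewrite !ge_min lexx !orbT.
    rewrite ler_pdivlMr// => h3.
    rewrite -(ltr_pM2l m0) mulrDr.
    have : m * t < m * rho by rewrite ltr_pM2l.
    by move: he h3; clear; lra.
have IU t : `|t - t0| < rho -> I t by move=> h; apply: (Hr3 t _).1; exact: lt_le_trans rho1.
have mf t : `|t - t0| < rho -> m <= f t.
  move=> h; have [_] := Hr3 t (lt_le_trans h rho1); rewrite ltr_norml => /andP[+ _].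
  by rewrite /m; clear; lra.
have UUin t p : `|t - t0| < rho -> m * dM p0 p < 4 * rho -> UU (t, p).
  by move=> ht hp; apply: HUU; [exact: IU|rewrite /coneD/= distrC; exact: rho4].
exists (diamond d m t0 rho x0); split; [|split; [|split; [|split]]].
- split; first by move=> y /(diamond_time mX m0); exact: IU.
  have m10 : 0 < 1 + m by rewrite addr_gt0.
  (* The function defining the diamond is at most [1 + m] times [coneD] from the centre. *)
  exists (rho / (1 + m)); split; first by rewrite divr_gt0.
  move=> y _; rewrite /coneD/= ltr_pdivlMr// distrC /diamond/=; apply: le_lt_trans.
  have u0 : 0 <= m * `|y.1 - t0| by rewrite mulr_ge0 ?(ltW m0).
  have v0 : 0 <= d x0 y.2 by case: mX.
  by move: u0 v0; clear; lra.
- by move=> u v _ _; exact: ltau_lty.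
- exact: (diamond_cont fc f0 mX gsX gmM m0 rho3 UUin UUcont).
- exact: (diamond_geod fc f0 mX gsX gmM m0 mf rho3 UUin UUgeo).
- apply: (diamond_cmp fc f0 mX gsX gmM m0 mf rho3 UUin (UX := UX) _ UUfin _ UUcmp).
    move=> y Uy; have h := diamond_rad Uy; apply: HUX => //.
    by rewrite -(ltr_pM2l m0); exact: lt_le_trans rho2.
  move=> x y z gxy gyz gxz Ux Uy Uz h1 h2 h3 l1 l2 l3; apply: cmpX => // /perim.
  by move: l1 l2 l3 r0; clear; lra.
Qed.
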